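(* Let $A$ be a Hopf algebra over a field $k$ with bijective antipode $S$, counit $\varepsilon$ and unit map $\eta:k\to A$. Let $P_\bullet$ be the bar resolution of $k$ as a left $A$-module, so $P_n=A^{\otimes(n+1)}$. Let $f\in\operatorname{Hom}_A(P_m,k)$ and $g\in\operatorname{Hom}_A(P_n,k)$ be cocycles, with $m+n\ge 1$. Then the Gerstenhaber bracket of the classes of $f$ and $g$ in the Hopf algebra cohomology $\mathrm{H}^*(A,k)=\operatorname{Ext}_A^*(k,k)$ is represented by the cochain $$[f,g]=f\bullet g-(-1)^{(m-1)(n-1)}g\bullet f\ \in\operatorname{Hom}_A(P_{m+n-1},k),$$ where $f\bullet g$ is the $A$-linear map given, for $c^1,\dots,c^{m+n-1}\in A$, by $$(f\bullet g)(1\otimes c^1\otimes\cdots\otimes c^{m+n-1})=\varepsilon\Big(\sum\sum_{i=1}^m(-1)^{(n-1)(i-1)}\,\eta\big(f(1\otimes c^1_1\otimes\cdots\otimes c^{i-1}_1\otimes c^*_1\otimes c^{i+n}_1\otimes\cdots\otimes c^{m+n-1}_1)\big)\,c^1_2c^2_2\cdots c^{i-1}_2\,c^*_2\,c^{i+n}_2\cdots c^{m+n-1}_2\,S(c^1_3c^2_3\cdots c^{m+n-1}_3)\Big),$$ with $$c^*=\sum\eta\big(g(1\otimes c^i_1\otimes c^{i+1}_1\otimes\cdots\otimes c^{i+n-1}_1)\big)\,c^i_2c^{i+1}_2\cdots c^{i+n-1}_2,\qquad \Delta(c^* )=\sum c^*_1\otimes c^*_2,$$ and $g\bullet f$ is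 given by the same formula with the roles of $(f,m)$ and $(g,n)$ exchanged.
   Context: Tensor products are over $k$ unless indicated. Superscripts on $c$ index the elements $c^1,\dots,c^{m+n-1}$; subscripts are Sweedler indices: $\Delta(c)=\sum c_1\otimes c_2$ and $\Delta^{(2)}(c)=\sum c_1\otimes c_2\otimes c_3$ for the iterated coproduct. In the formula, each $c^j$ is split by $\Delta^{(2)}$ into $c^j_1,c^j_2,c^j_3$; for $i\le j\le i+n-1$ the parts $c^j_1,c^j_2$ are used inside $c^*$ and $c^j_3$ inside $S(\cdots)$. Empty sums are $0$ and empty products are $1$. The bar resolution $P_\bullet\to k$ has $P_n=A^{\otimes(n+1)}$ with $A$ acting on the leftmost factor, augmentation $\varepsilon:A\to k$, and $$d_n(a_0\otimes\cdots\otimes a_n)=\sum_{i=0}^{n-1}(-1)^ia_0\otimes\cdots\otimes a_ia_{i+1}\otimes\cdots\otimes a_n+(-1)^n\varepsilon(a_n)a_0\otimes\cdots\otimes a_{n-1}.$$ Gerstenhaber bracket on $\mathrm{HH}^*(A)=\operatorname{Ext}^*_{A^e}(A,A)$, $A^e=A\otimes A^{op}$: on bar cochains $F\in\operatorname{Hom}_k(A^{\otimes m},A)$, $G\in\operatorname{Hom}_k(A^{\otimes n},A)$, $$(F\circ G)(a_1\otimes\cdots\otimes a_{m+n-1})=\sum_{i=1}^m(-1)^{(n-1)(i-1)}F(a_1\otimes\cdots\otimes a_{i-1}\otimes G(a_i\otimes\cdots\otimes a_{i+n-1})\otimes a_{i+n}\otimes\cdots\otimes a_{m+n-1}),$$ and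 $[F,G]=F\circ G-(-1)^{(m-1)(n-1)}G\circ F$. Gerstenhaber bracket on $\mathrm{H}^*(A,k)$: let $A^{ad}$ be $A$ with left adjoint action $a\cdot b=\sum a_1bS(a_2)$. Regard $A^e$ as a right $A$-module via the algebra map $a\mapsto\sum a_1\otimes S(a_2)$. Then $A\cong A^e\otimes_Ak$ as $A^e$-modules, via $a\mapsto(a\otimes1)\otimes_A1$, and the Eckmann–Shapiro isomorphism $\operatorname{Hom}_A(P_n,A^{ad})\cong\operatorname{Hom}_{A^e}(A^e\otimes_AP_n,A)$, $\tilde f\mapsto\big((a\otimes b)\otimes_Aq\mapsto a\tilde f(q)b\big)$, yields $\mathrm{H}^*(A,A^{ad}):=\operatorname{Ext}^*_A(k,A^{ad})\cong\mathrm{HH}^*(A)$. The bracket of $\mathrm{HH}^*(A)$ is transported to $\mathrm{H}^*(A,A^{ad})$ along this isomorphism. The $A$-module maps $\eta:k\to A^{ad}$ and $\varepsilon:A^{ad}\to k$ induce an embedding $\eta_*:\mathrm{H}^*(A,k)\to\mathrm{H}^*(A,A^{ad})$ and a map $\varepsilon_*$ back, and the bracket on $\mathrm{H}^*(A,k)$ is $[\alpha,\beta]=\varepsilon_*[\eta_*(\alpha),\eta_*(\beta)]$. *)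

(* Defs.v *)
From HB Require Import structures.
From mathcomp Require Import all_boot all_order all_algebra.
From mathcomp Require Import boolp classical_sets.

Set Implicit Arguments.
Unset Strict Implicit.
Unset Printing Implicit Defensive.

Import GRing.Theory.
Local Open Scope ring_scope.
Local Open Scope quotient_scope.

(* The k-module that is universal among the targets of the maps X -> U       *)
(* satisfying M (multilinear maps, balanced maps...): formal linear          *)
(* combinations of elements of X, two of them being identified when no       *)
(* M-map separates them.                                                     *)
Section UniversalModule.
Variables (k : fieldType) (X : choiceType).
Variable M : forall U : lmodType k, (X -> U) -> Prop.

Definition formal : Type := seq (k * X).

Definition feval (U : lmodType k) (phi : X -> U) (s : formal) : U :=
  \sum_(p <- s) p.1 *: phi p.2.

Definition formal_eqv (s t : formal) : bool :=
  `[< forall (U : lmodType k) (phi : X -> U), M phi -> feval phi s = feval phi t >].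

Lemma formal_eqv_refl : reflexive formal_eqv.
Proof. by move=> s; apply/asboolP. Qed.

Lemma formal_eqv_sym : symmetric formal_eqv.
Proof.
by move=> s t; apply/asboolP/asboolP => h U phi Mphi; rewrite (h U phi Mphi).
Qed.

Lemma formal_eqv_trans : transitive formal_eqv.
Proof.
move=> t s r /asboolP st /asboolP tr; apply/asboolP => U phi Mphi.
by rewrite st // tr.
Qed.

Canonical formal_equiv :=
  EquivRel formal_eqv formal_eqv_refl formal_eqv_sym formal_eqv_trans.

Definition umod : Type := {eq_quot formal_equiv}.
HB.instance Definition _ := Choice.on umod.

Definition ucls (s : formal) : umod := \pi_({eq_quot formal_equiv}) s.
Definition urep (u : umod) : formal := repr (u : {eq_quot formal_equiv}).

Lemma urepK u : ucls (urep u) = u.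
Proof. exact: (@reprK _ {eq_quot formal_equiv}). Qed.

Lemma uclsP s t : ucls s = ucls t <->
  forall (U : lmodType k) (phi : X -> U), M phi -> feval phi s = feval phi t.
Proof.
split=> [st|st]; last by apply/eqP; rewrite eqmodE; apply/asboolP.
by apply/asboolP; move/eqP: st; rewrite eqmodE.
Qed.

(* The linear map induced by phi; meaningful when M phi holds. *)
Definition ulift (U : lmodType k) (phi : X -> U) (u : umod) : U :=
  feval phi (urep u).

Definition upure (x : X) : umod := ucls [:: (1, x)].

Lemma ulift_cls (U : lmodType k) (phi : X -> U) s :
  M phi -> ulift phi (ucls s) = feval phi s.
Proof. by move=> Mphi; apply: (uclsP _ _).1 Mphi; rewrite urepK. Qed.

Lemma ulift_pure (U : lmodType k) (phi : X -> U) x :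
  M phi -> ulift phi (upure x) = phi x.
Proof.
by move=> Mphi; rewrite ulift_cls // /feval big_seq1 scale1r.
Qed.

Lemma umod_sep u v :
  (forall (U : lmodType k) (phi : X -> U), M phi -> ulift phi u = ulift phi v) ->
  u = v.
Proof. by move=> uv; rewrite -(urepK u) -(urepK v); apply/uclsP. Qed.

Definition uzero : umod := ucls [::].
Definition uadd (u v : umod) : umod := ucls (urep u ++ urep v).
Definition uscale (a : k) (u : umod) : umod :=
  ucls [seq (a * p.1, p.2) | p <- urep u].
Definition uopp (u : umod) : umod := uscale (-1) u.

Lemma ulift0 (U : lmodType k) (phi : X -> U) : M phi -> ulift phi uzero = 0.
Proof. by move=> h; rewrite ulift_cls // /feval big_nil. Qed.

Lemma uliftD (U : lmodType k) (phi : X -> U) u v :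
  M phi -> ulift phi (uadd u v) = ulift phi u + ulift phi v.
Proof. by move=> h; rewrite ulift_cls // /feval big_cat. Qed.

Lemma uliftZ (U : lmodType k) (phi : X -> U) a u :
  M phi -> ulift phi (uscale a u) = a *: ulift phi u.
Proof.
move=> h; rewrite ulift_cls // /ulift /feval big_map scaler_sumr.
by apply: eq_bigr => p _; rewrite scalerA.
Qed.

Fact uaddA : associative uadd.
Proof. by move=> u v w; apply: umod_sep => U phi h; rewrite !uliftD ?addrA. Qed.
Fact uaddC : commutative uadd.
Proof. by move=> u v; apply: umod_sep => U phi h; rewrite !uliftD // addrC. Qed.
Fact uadd0 : left_id uzero uadd.
Proof. by move=> u; apply: umod_sep => U phi h; rewrite uliftD ?ulift0 ?add0r. Qed.
Fact uaddN : left_inverse uzero uopp uadd.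
Proof.
move=> u; apply: umod_sep => U phi h.
by rewrite uliftD // uliftZ // ulift0 // scaleN1r addNr.
Qed.

HB.instance Definition _ := GRing.isZmodule.Build umod uaddA uaddC uadd0 uaddN.

Fact uscaleA a b u : uscale a (uscale b u) = uscale (a * b) u.
Proof. by apply: umod_sep => U phi h; rewrite !uliftZ // scalerA. Qed.
Fact uscale1 : left_id 1 uscale.
Proof. by move=> u; apply: umod_sep => U phi h; rewrite uliftZ // scale1r. Qed.
Fact uscaleDr : right_distributive uscale +%R.
Proof.
by move=> a u v; apply: umod_sep => U phi h; rewrite !(uliftZ, uliftD) // scalerDr.
Qed.
Fact uscaleDl u : {morph uscale^~ u : a b / a + b}.
Proof.
by move=> a b; apply: umod_sep => U phi h; rewrite !(uliftZ, uliftD) // scalerDl.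
Qed.

HB.instance Definition _ :=
  GRing.Zmodule_isLmodule.Build k umod uscaleA uscale1 uscaleDr uscaleDl.

Lemma ulift_linear (U : lmodType k) (phi : X -> U) : M phi -> linear (ulift phi).
Proof. by move=> h a u v; rewrite uliftD // uliftZ. Qed.

End UniversalModule.

Section TensorPower.
Variables (k : fieldType) (V : lmodType k).

Definition tset n (t : n.-tuple V) (i : 'I_n) (x : V) : n.-tuple V :=
  [tuple if j == i then x else tnth t j | j < n].

Definition multilinear n (U : lmodType k) (phi : n.-tuple V -> U) : Prop :=
  forall (t : n.-tuple V) (i : 'I_n), linear (fun x => phi (tset t i x)).

Definition tpow (n : nat) : lmodType k := umod (@multilinear n).
Definition tens n (t : n.-tuple V) : tpow n := upure (@multilinear n) t.
Definition tlift n (U : lmodType k) (phi : n.-tuple V -> U) (u : tpow n) : U :=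
  ulift phi u.

Lemma tens_multilinear n : multilinear (@tens n).
Proof.
move=> t i a x y; apply: umod_sep => U phi h.
by rewrite (uliftD _ _ h) (uliftZ _ _ h) !(ulift_pure _ h) h.
Qed.

Lemma tlift_tens n (U : lmodType k) (phi : n.-tuple V -> U) t :
  multilinear phi -> tlift phi (tens t) = phi t.
Proof. exact: ulift_pure. Qed.

Lemma tlift_linear n (U : lmodType k) (phi : n.-tuple V -> U) :
  multilinear phi -> linear (tlift phi).
Proof. exact: ulift_linear. Qed.

End TensorPower.

Section AlgebraTensors.
Variables (k : fieldType) (A : algType k).

Definition tens2_mul (u v : tpow A 2) : tpow A 2 :=
  tlift (fun s => tlift (fun t => tens [tuple s`_0 * t`_0; s`_1 * t`_1]) v) u.

(* The product of A^e = A (x) A^op: the second factor multiplies in A^op. *)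
Definition env_mul (u v : tpow A 2) : tpow A 2 :=
  tlift (fun s => tlift (fun t => tens [tuple s`_0 * t`_0; t`_1 * s`_1]) v) u.

End AlgebraTensors.

HB.mixin Record isHopfAlgebra (k : fieldType) A of GRing.Algebra k A := {
  comul : {linear A -> tpow A 2};
  counit : {lrmorphism A -> k^o};
  antipode : {linear A -> A};
  comul1 : comul 1 = tens [tuple 1; 1];
  comulM : forall a b : A, comul (a * b) = tens2_mul (comul a) (comul b);
  comulA : forall a : A,
    tlift (fun t => tlift (fun s => tens [tuple s`_0; s`_1; t`_1]) (comul t`_0))
      (comul a) =
    tlift (fun t => tlift (fun s => tens [tuple t`_0; s`_0; s`_1]) (comul t`_1))
      (comul a) :> tpow A 3;
  counitl : forall a : A, tlift (fun t => counit t`_0 *: t`_1) (comul a) = a;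
  counitr : forall a : A, tlift (fun t => counit t`_1 *: t`_0) (comul a) = a;
  antipodel : forall a : A,
    tlift (fun t => antipode t`_0 * t`_1) (comul a) = (counit a)%:A;
  antipoder : forall a : A,
    tlift (fun t => t`_0 * antipode t`_1) (comul a) = (counit a)%:A
}.

#[short(type="hopfAlgType")]
HB.structure Definition HopfAlgebra (k : fieldType) :=
  { A of GRing.Algebra k A & isHopfAlgebra k A }.

(* Modules, complexes and cohomology.  A module over an algebra is recorded  *)
(* by the operators that determine linearity: Op := A for left A-modules,    *)
(* and Op := A * A for A^e-modules, (a, b) standing for the generator        *)
(* a (x) b, which acts on an A-bimodule by x |-> a x b.  The module laws are *)
(* not part of the record; it is only used for the explicit modules below.   *)
Section Cohomology.
Variables (k : fieldType) (Op : Type).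

Record opmod := Opmod {
  opcar :> lmodType k;
  opact : Op -> opcar -> opcar
}.

Definition ophom (M N : opmod) (f : M -> N) : Prop :=
  linear f /\ forall a x, f (opact a x) = opact a (f x).

Record complex := Complex {
  cobj :> nat -> opmod;
  cdif : forall n, cobj n.+1 -> cobj n
}.

Variables (C : complex) (N : opmod).

Definition cocycle n (f : C n -> N) : Prop :=
  ophom f /\ forall x : C n.+1, f (cdif x) = 0.

Definition coboundary n : (C n -> N) -> Prop :=
  match n return (C n -> N) -> Prop with
  | 0%N => fun f => forall x, f x = 0
  | p.+1 => fun f => exists2 h : C p -> N, ophom h & forall x, f x = h (cdif x)
  end.

(* The elements of the cohomology H^n(Hom(C, N)) are the cosets of cocycles  *)
(* modulo coboundaries; coclass f is the coset of the cocycle f.             *)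
Definition coclass n (f : C n -> N) : set (C n -> N) :=
  [set f' | cocycle f' /\ coboundary (fun x => f' x - f x)]%classic.

End Cohomology.

(* The image of a class under the map of cohomology induced by the cochain   *)
(* map u: all the cocycles cohomologous to u f for some f in the class.      *)
Definition coh_map (k : fieldType) (Op Op' : Type) (C : complex k Op)
    (N : opmod k Op) (C' : complex k Op') (N' : opmod k Op') m n
    (u : (C m -> N) -> (C' n -> N')) (alpha : set (C m -> N)) :
    set (C' n -> N') :=
  (\bigcup_(f in alpha) coclass (u f))%classic.

Section Hopf.
Variables (k : fieldType) (A : hopfAlgType k).

Definition eta (a : k) : A := a%:A.

Definition comul2 (a : A) : tpow A 3 :=
  tlift (fun t => tlift (fun s => tens [tuple s`_0; s`_1; t`_1]) (comul t`_0))
    (comul a).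

(* The multiplication of the tensor factors i and i + 1. *)
Definition contract n (i : nat) (t : n.+1.-tuple A) : n.-tuple A :=
  [tuple if (j < i)%N then t`_j
         else if j == i :> nat then t`_i * t`_i.+1 else t`_j.+1 | j < n].

Definition trivial_mod : opmod k A :=
  @Opmod k A k^o (fun a x => counit a * x).

Definition adjoint_mod : opmod k A :=
  @Opmod k A A (fun a b => tlift (fun t => t`_0 * b * antipode t`_1) (comul a)).

(* barP is the bar resolution of k by left A-modules and barB, further       *)
(* below, the bar resolution of A by A-bimodules.                            *)
Definition barP_obj n : opmod k A :=
  @Opmod k A (tpow A n.+1)
    (fun a => tlift (fun t => tens
       [tuple if j == ord0 then a * tnth t j else tnth t j | j < n.+1])).

Definition barP_dif n : barP_obj n.+1 -> barP_obj n :=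
  tlift (fun t : n.+2.-tuple A =>
    \sum_(i < n.+1) (-1) ^+ i *: tens (contract i t)
    + (-1) ^+ n.+1 *: (counit t`_n.+1 *: tens [tuple t`_j | j < n.+1])).

Definition barP : complex k A := @Complex k A barP_obj barP_dif.

Definition barP_aug : barP 0%N -> trivial_mod := tlift (fun t => counit t`_0).

Definition bimod : opmod k (A * A) :=
  @Opmod k (A * A) A (fun ab x => ab.1 * x * ab.2).

Definition barB_obj n : opmod k (A * A) :=
  @Opmod k (A * A) (tpow A n.+2)
    (fun ab => tlift (fun t => tens
       [tuple if j == ord0 then ab.1 * tnth t j
              else if j == ord_max then tnth t j * ab.2
              else tnth t j | j < n.+2])).

Definition barB_dif n : barB_obj n.+1 -> barB_obj n :=
  tlift (fun t : n.+3.-tuple A =>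
    \sum_(i < n.+2) (-1) ^+ i *: tens (contract i t)).

Definition barB : complex k (A * A) := @Complex k (A * A) barB_obj barB_dif.

Definition barB_aug : barB 0%N -> bimod := tlift (fun t => t`_0 * t`_1).

(* The right A-module structure of A^e along a |-> sum a_1 (x) S(a_2); ind M *)
(* is then A^e (x)_A M.                                                      *)
Definition env_ract (u : tpow A 2) (a : A) : tpow A 2 :=
  env_mul u (tlift (fun t => tens [tuple t`_0; antipode t`_1]) (comul a)).

Definition balanced (M : opmod k A) (U : lmodType k)
    (phi : tpow A 2 * M -> U) : Prop :=
  [/\ forall q, linear (fun u => phi (u, q)),
      forall u, linear (fun q => phi (u, q)) &
      forall u a q, phi (env_ract u a, q) = phi (u, opact a q)].

Definition ind_pure (M : opmod k A) (u : tpow A 2) (q : M) : umod (@balanced M) :=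
  upure (@balanced M) (u, q).

Definition ind (M : opmod k A) : opmod k (A * A) :=
  @Opmod k (A * A) (umod (@balanced M))
    (fun ab => ulift (fun p : tpow A 2 * M =>
       ind_pure (env_mul (tens [tuple ab.1; ab.2]) p.1) p.2)).

Lemma ind_pure_balanced (M : opmod k A) :
  balanced (fun p : tpow A 2 * M => ind_pure p.1 p.2).
Proof.
split=> [q|u|u a q]; last first.
  by apply: umod_sep => U phi h; rewrite !(ulift_pure _ h); case: h => _ _ ->.
- move=> a q r; apply: umod_sep => U phi h.
  by rewrite (uliftD _ _ h) (uliftZ _ _ h) !(ulift_pure _ h); case: h => _ ->.
- move=> a u v; apply: umod_sep => U phi h.
  by rewrite (uliftD _ _ h) (uliftZ _ _ h) !(ulift_pure _ h); case: h => ->.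
Qed.

Definition ind_map (M N : opmod k A) (phi : M -> N) : ind M -> ind N :=
  ulift (fun p : tpow A 2 * M => ind_pure p.1 (phi p.2)).

Definition indP : complex k (A * A) :=
  @Complex k (A * A) (fun n => ind (barP n)) (fun n => ind_map (@cdif _ _ barP n)).

(* The isomorphism A -> A^e (x)_A k, a |-> (a (x) 1) (x)_A 1. *)
Definition bimod_to_ind (a : A) : ind trivial_mod :=
  ind_pure (M := trivial_mod) (tens [tuple a; 1]) (1 : k^o).

(* The A^e-linear chain maps from the bar resolution of A to the resolution  *)
(* A^e (x)_A P of A ~ A^e (x)_A k that lift the identity of A.  They are the *)
(* maps along which Ext_{A^e}(A, A) computed from A^e (x)_A P is identified  *)
(* with Ext_{A^e}(A, A) computed from bar cochains.                          *)
Definition comparison (theta : forall n, barB n -> indP n) : Prop :=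
  [/\ forall n, ophom (theta n),
      forall n (x : barB n.+1), cdif (theta n.+1 x) = theta n (cdif x) &
      forall x : barB 0%N,
        ind_map (N := trivial_mod) barP_aug (theta 0%N x) =
        bimod_to_ind (barB_aug x)].

Definition eckmann_shapiro n (f : barP n -> adjoint_mod) : indP n -> bimod :=
  ulift (fun p : tpow A 2 * barP n =>
    tlift (fun t => t`_0 * (f p.2 : A) * t`_1) p.1).

Definition ad_to_HH n (alpha : set (barP n -> adjoint_mod)) :
    set (barB n -> bimod) :=
  (\bigcup_(theta in comparison)
     coh_map (fun f => eckmann_shapiro f \o theta n) alpha)%classic.

(* Hom_{A^e}(A (x) A^{(x) n} (x) A, A) ~ Hom_k(A^{(x) n}, A) *)

Definition bar_restrict n (F : barB n -> bimod) : tpow A n -> A :=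
  tlift (fun a : n.-tuple A => F (tens [tuple of 1 :: rcons a 1])).

Definition bar_extend n (F : tpow A n -> A) : barB n -> bimod :=
  tlift (fun t : n.+2.-tuple A =>
    t`_0 * F (tens [tuple t`_j.+1 | j < n]) * t`_n.+1).

(* F o G for N = m + n - 1.  Positions are counted from 0, and n.+1 stands   *)
(* for n - 1 in the sign, as it has the right parity also when n = 0.        *)
Definition circ m n N (F : tpow A m -> A) (G : tpow A n -> A) : tpow A N -> A :=
  tlift (fun a : N.-tuple A =>
    \sum_(i < m) (-1) ^+ (n.+1 * i) *:
      F (tens [tuple if (j < i)%N then a`_j
                     else if j == i then G (tens [tuple a`_(i + l) | l < n])
                     else a`_(j + n).-1 | j < m])).

Definition gerst m n (F : tpow A m -> A) (G : tpow A n -> A) :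
    tpow A (m + n).-1 -> A :=
  fun x => circ F G x - (-1) ^+ (m.+1 * n.+1) *: circ G F x.

Definition HH_bracket m n (alpha : set (barB m -> bimod))
    (beta : set (barB n -> bimod)) : set (barB (m + n).-1 -> bimod) :=
  (\bigcup_(F in alpha) \bigcup_(G in beta)
     coclass (bar_extend (gerst (bar_restrict F) (bar_restrict G))))%classic.

(* The class whose image in HH(A) is the bracket of the images. *)
Definition ad_bracket m n (alpha : set (barP m -> adjoint_mod))
    (beta : set (barP n -> adjoint_mod)) : set (barP (m + n).-1 -> adjoint_mod) :=
  [set h | cocycle h /\
     ad_to_HH (coclass h) = HH_bracket (ad_to_HH alpha) (ad_to_HH beta)]%classic.

Definition eta_push n (f : barP n -> trivial_mod) : barP n -> adjoint_mod :=
  fun x => eta (f x).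

Definition eps_push n (f : barP n -> adjoint_mod) : barP n -> trivial_mod :=
  fun x => counit (f x : A).

Definition hopf_bracket m n (alpha : set (barP m -> trivial_mod))
    (beta : set (barP n -> trivial_mod)) : set (barP (m + n).-1 -> trivial_mod) :=
  coh_map (@eps_push _)
    (ad_bracket (coh_map (@eta_push _) alpha) (coh_map (@eta_push _) beta)).

(* Sum over the Sweedler components of all the elements of s: in phi r, the  *)
(* j-th entry of r consists of the three components of the j-th entry of s.  *)
Fixpoint sweedler (U : lmodType k) (s : seq A) (phi : seq (seq A) -> U) : U :=
  if s is c :: s' then
    tlift (fun t : 3.-tuple A => sweedler s' (fun r => phi (tval t :: r))) (comul2 c)
  else phi [::].

(* c^{j+1}_{p+1} *)
Definition part (r : seq (seq A)) (p j : nat) : A := (nth [::] r j)`_p.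

Definition cstar n (g : barP n -> trivial_mod) (i : nat) (r : seq (seq A)) : A :=
  eta (g (tens [tuple of 1 :: [tuple part r 0 (i + l) | l < n]]))
  * \prod_(i <= j < i + n) part r 1 j.

(* f . g for N = m + n - 1, with the conventions of circ. *)
Definition bullet m n N (f : barP m -> trivial_mod) (g : barP n -> trivial_mod) :
    barP N -> trivial_mod :=
  tlift (fun a : N.+1.-tuple A => counit a`_0 *
    counit (sweedler (behead a) (fun r =>
      \sum_(i < m) (-1) ^+ (n.+1 * i) *:
        tlift (fun d : 2.-tuple A =>
          eta (f (tens [tuple of 1 ::
                [tuple if (j < i)%N then part r 0 j
                       else if j == i then d`_0
                       else part r 0 (j + n).-1 | j < m]]))
          * \prod_(0 <= j < i) part r 1 j
          * d`_1
          * \prod_(i + n <= j < N) part r 1 j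
          * antipode (\prod_(0 <= j < N) part r 2 j))
        (comul (cstar g i r))))).

Definition bullet_bracket m n (f : barP m -> trivial_mod)
    (g : barP n -> trivial_mod) : barP (m + n).-1 -> trivial_mod :=
  fun x => bullet f g x - (-1) ^+ (m.+1 * n.+1) *: bullet g f x.

End Hopf.

(* Main.v *)
Require Import Defs.
From mathcomp Require Import all_boot all_order all_algebra.
From mathcomp Require Import boolp classical_sets.
From mathcomp Require Import zify.

(* The assignment f |-> F, F(c) = sum f(1 (x) c_1) c_2 with c_2 the product of the  *)
(* second Sweedler components, is an isomorphism of cochain complexes from          *)
(* Hom_A(P, A^ad) to the complex of bar cochains; its inverse sends F to            *)
(* c |-> sum F(c_1) S(c_2).  It is induced by an explicit comparison map            *)
(* theta0 : B -> A^e (x)_A P, and any other comparison map is homotopic to it,      *)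
(* because A^e (x)_A P has a contracting homotopy and B is free.  Hence the bracket *)
(* of the classes of eta f and eta g is represented by the image of [F, G] under    *)
(* the inverse, which is the formula of the theorem before counit is applied.       *)
(*   That the Gerstenhaber bracket is well defined on classes follows from its      *)
(* Jacobi identity with the multiplication cochain: the operators D_F of insertion  *)
(* of F into multilinear functions satisfy [D_F, D_G] = D_[F, G] up to sign.        *)

Set Implicit Arguments.
Unset Strict Implicit.
Unset Printing Implicit Defensive.

Import GRing.Theory.
Local Open Scope ring_scope.

(** * Multilinear functions of lists *)

(** The bracket on H(A, A^ad) is defined through classes, while a formula on cochains is wanted. The
    passage is possible because Hom_A(P, A^ad) and the Hochschild cochains are isomorphic as
    complexes, not merely quasi-isomorphic. By [hat_ad_bar] the map [ad_bar] sends f to its twist c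
    |-> sum f(1 (x) c_1) c_2, and [twistK] undoes the twist with the antipode, by coassociativity
    and the two antipode identities. As [ad_bar] commutes with the differentials ([ad_bar_dif]), it
    preserves and reflects cocycles and coboundaries; so a bracket of classes is computed by
    untwisting the bracket of the twisted cochains ([ad_bracketE]).

    Classes are sets of cocycles, and the maps between them are unions over all choices, so two
    independence statements are needed. Independence of the comparison map is [comparison_cohom]:
    two comparison maps differ by a homotopy ([homotopyS]), which a cocycle turns into a coboundary.
    Independence of the Hochschild representatives is [HHbr_cohom]: the differential is, up to sign,
    the bracket with the multiplication ([hat_dif]), and it is a graded derivation of the bracket
    ([gdif_gbr]), a Jacobi identity that follows from [pre_lie].

    For a cochain f with values in k the twist of eta f is [eta_hat f], and the element c^* of the
    theorem is the value of [eta_hat g] on the block of inserted entries. In the twist of f,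
    evaluated on the list with that block replaced by c^* alone, the new entry is split by its
    coproduct like any other; untwisting contributes the factor with the antipode. This is the
    formula for [bullet] before the counit is applied ([swsum_terms], [bulletE]), and the counit
    then gives [bullet_bracket] ([eps_push_bracket]). *)

Section LinearMaps.
Variables (k : fieldType) (U V : lmodType k) (f : U -> V).
Hypothesis f_lin : linear f.

(** Most maps below come with a proof of the predicate [linear] and no bundled structure, so the
    usual consequences are derived from the predicate. *)
Lemma lin0 : f 0 = 0.
Proof.
by have := f_lin (-1) 0 0; rewrite scaler0 addr0 => ->; rewrite scaleN1r addNr.
Qed.

Lemma linD x y : f (x + y) = f x + f y.
Proof. by have := f_lin 1 x y; rewrite !scale1r. Qed.

Lemma linZ a x : f (a *: x) = a *: f x.
Proof. by rewrite -[a *: x]addr0 f_lin lin0 addr0. Qed.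

Lemma linB x y : f (x - y) = f x - f y.
Proof. by rewrite -scaleN1r linD linZ scaleN1r. Qed.

Lemma lin_sum I (r : seq I) (E : I -> U) :
  f (\sum_(i <- r) E i) = \sum_(i <- r) f (E i).
Proof. by elim: r => [|i r IH]; rewrite ?(big_nil, big_cons) ?lin0 // linD IH. Qed.

End LinearMaps.

Lemma lin_comp (k : fieldType) (U V W : lmodType k) (f : V -> W) (g : U -> V) :
  linear f -> linear g -> linear (fun x => f (g x)).
Proof. by move=> hf hg a x y; rewrite hg hf. Qed.

Lemma lin_bigsum (k : fieldType) (U V : lmodType k) I (r : seq I)
    (f : I -> U -> V) :
  (forall i, linear (f i)) -> linear (fun x => \sum_(i <- r) f i x).
Proof.
move=> hf a x y; rewrite scaler_sumr -big_split.
by apply: eq_bigr => i _; rewrite hf.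
Qed.

(** * Linear maps out of a universal module *)

Section UniversalModuleMaps.
Variables (k : fieldType) (X : choiceType).
Variable M : forall U : lmodType k, (X -> U) -> Prop.

(** The pure elements span the universal module; the extensionality lemmas for tensor powers and
    induced modules rest on this. *)
Lemma ucls_sum (s : formal k X) :
  ucls M s = \sum_(p <- s) p.1 *: upure M p.2.
Proof.
apply: umod_sep => U phi h; rewrite (ulift_cls _ h).
rewrite (lin_sum (ulift_linear h)); apply: eq_bigr => p _.
by rewrite (linZ (ulift_linear h)) ulift_pure.
Qed.

Lemma umod_ext (U : lmodType k) (f g : umod M -> U) :
  linear f -> linear g -> (forall x, f (upure M x) = g (upure M x)) -> f =1 g.
Proof.
move=> hf hg fg u; rewrite -(urepK u) ucls_sum !lin_sum //.
by apply: eq_bigr => p _; rewrite !linZ // fg.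
Qed.

End UniversalModuleMaps.

(** * Multilinear functions of lists and their relation to tensor powers *)

Section Multilinear.
Variables (k : fieldType) (A : algType k).
Implicit Types (U : lmodType k) (s u v w : seq A).

(* A cochain of n variables is a function of lists that is linear in each entry   *)
(* of lists of every length and vanishes on the lists of length other than n.     *)
Definition mlin U (phi : seq A -> U) : Prop := forall s1 s2 c x y,
  phi (s1 ++ (c *: x + y) :: s2)
  = c *: phi (s1 ++ x :: s2) + phi (s1 ++ y :: s2).

Definition arity n U (phi : seq A -> U) : Prop :=
  forall s, size s != n -> phi s = 0.

Lemma mlin_lin U (phi : seq A -> U) s1 s2 :
  mlin phi -> linear (fun x => phi (s1 ++ x :: s2)).
Proof. by move=> h c x y; rewrite h. Qed.

Lemma mlin_hd U (phi : seq A -> U) s : mlin phi -> linear (fun x => phi (x :: s)).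
Proof. by move=> h c x y; exact: (h [::]). Qed.

Lemma mlin_cons U (phi : seq A -> U) x : mlin phi -> mlin (fun s => phi (x :: s)).
Proof. by move=> h s1 s2 c a b; rewrite -!cat_cons h. Qed.

Lemma mlin_catl U (phi : seq A -> U) u : mlin phi -> mlin (fun s => phi (u ++ s)).
Proof. by move=> h s1 s2 c a b; rewrite !catA h. Qed.

Lemma mlin_catr U (phi : seq A -> U) u : mlin phi -> mlin (fun s => phi (s ++ u)).
Proof. by move=> h s1 s2 c a b; rewrite -!catA !cat_cons h. Qed.

Lemma mlin_rcons U (phi : seq A -> U) x : mlin phi -> mlin (fun s => phi (rcons s x)).
Proof. by move=> h s1 s2 c a b; rewrite -!cats1 -!catA h. Qed.

Lemma mlin_comp U (V : lmodType k) (f : U -> V) (phi : seq A -> U) :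
  linear f -> mlin phi -> mlin (fun s => f (phi s)).
Proof. by move=> hf h s1 s2 c x y; rewrite h hf. Qed.

Lemma mlin_bigsum U I (r : seq I) (P : I -> seq A -> U) :
  (forall i, mlin (P i)) -> mlin (fun s => \sum_(i <- r) P i s).
Proof.
move=> hP s1 s2 c x y; rewrite scaler_sumr -big_split.
by apply: eq_bigr => i _; rewrite hP.
Qed.

Lemma mlinD U (phi psi : seq A -> U) :
  mlin phi -> mlin psi -> mlin (fun s => phi s + psi s).
Proof. by move=> h h' s1 s2 c x y; rewrite h h' scalerDr addrACA. Qed.

Lemma mlinZ U (phi : seq A -> U) a : mlin phi -> mlin (fun s => a *: phi s).
Proof. by move=> h s1 s2 c x y; rewrite h scalerDr !scalerA mulrC. Qed.

Lemma mlinB U (phi psi : seq A -> U) :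
  mlin phi -> mlin psi -> mlin (fun s => phi s - psi s).
Proof.
by move=> h h' s1 s2 c x y; rewrite h h' scalerBr opprD addrACA.
Qed.

Lemma mlin_prod : mlin (fun s => \prod_(x <- s) x).
Proof.
move=> s1 s2 c x y; rewrite !big_cat !big_cons /=.
by rewrite mulrDl mulrDr -scalerAl -scalerAr.
Qed.

(** A given entry lies in exactly one of the two parts, and linearity in that part is enough. *)
Lemma mlin_cut U (chi : seq A -> seq A -> U) i :
  (forall v, mlin (chi^~ v)) -> (forall u, mlin (chi u)) ->
  mlin (fun s => chi (take i s) (drop i s)).
Proof.
move=> h1 h2 s1 s2 c x y; rewrite !take_cat !drop_cat.
case: ltnP => // le_i; first exact: h2.
case: (i - size s1)%N => [|j] /=; first by rewrite !cats0; exact: (h2 _ [::]).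
exact: h1.
Qed.

Lemma map_nth_ord n s : size s = n -> [seq s`_i | i : 'I_n <- enum 'I_n] = s.
Proof.
move=> sz; rewrite (map_comp (nth 0 s) val) val_enum_ord map_nth_iota0 ?sz //.
by rewrite -sz take_size.
Qed.

(* Zero on the lists of length other than n, so that tn n is multilinear. *)
Definition tn n s : tpow A n :=
  if size s == n then tens [tuple s`_i | i < n] else 0.

Lemma tn_tuple n (t : n.-tuple A) : tn n t = tens t.
Proof.
rewrite /tn size_tuple eqxx; congr tens.
by apply: val_inj; rewrite /= map_nth_ord ?size_tuple.
Qed.

Lemma tn_size n s : size s != n -> tn n s = 0.
Proof. by rewrite /tn => /negPf ->. Qed.

Lemma tens_tn n (t : n.-tuple A) s : tval t = s -> tens t = tn n s.
Proof. by move=> <-; rewrite tn_tuple. Qed.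

Lemma val_tset n (t : n.-tuple A) (i : 'I_n) x :
  tset t i x = take i t ++ x :: drop i.+1 t :> seq A.
Proof.
apply: (@eq_from_nth _ 0).
  rewrite size_cat /= size_take size_drop !size_tuple ltn_ord card_ord.
  by rewrite -addSnnS subnKC.
rewrite size_tuple => j jn.
rewrite -[j in LHS]/(val (Ordinal jn)) -tnth_nth tnth_mktuple nth_cat size_take size_tuple ltn_ord.
rewrite -val_eqE /= (tnth_nth 0) /=.
case: ltngtP => // ji; first by rewrite nth_take.
  rewrite -[(j - i)%N]prednK ?subn_gt0 //= nth_drop; congr nth.
  by rewrite addSn -addnS prednK ?subn_gt0 // subnKC // ltnW.
by rewrite ji subnn.
Qed.

Lemma mlin_tuple U n (phi : seq A -> U) :
  mlin phi -> multilinear (fun t : n.-tuple A => phi t).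
Proof. by move=> h t i c x y; rewrite !val_tset h. Qed.

Lemma mlin_tn n : mlin (tn n).
Proof.
move=> s1 s2 c x y; rewrite /tn !size_cat /=.
case: eqP => [sz|]; last by rewrite scaler0 addr0.
have lt_n : (size s1 < n)%N by rewrite -sz addnS ltnS leq_addr.
have sz0 : size (s1 ++ 0 :: s2) == n by rewrite size_cat /= sz.
pose t := Tuple sz0; pose i := Ordinal lt_n.
have tE z : [tuple (s1 ++ z :: s2)`_i | i < n] = tset t i z.
  apply: val_inj => /=; rewrite val_tset /= take_size_cat // drop_cat ltnNge leqnSn /=.
  by rewrite subSnn /= drop0 map_nth_ord ?size_cat.
by rewrite !tE; apply: tens_multilinear.
Qed.

Lemma arity_tn n : arity n (tn n).
Proof. exact: tn_size. Qed.

Lemma tlift_tn U n (phi : seq A -> U) s : mlin phi -> size s = n ->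
  tlift (fun t : n.-tuple A => phi t) (tn n s) = phi s.
Proof.
move=> h /eqP sz; rewrite -[s]/(tval (Tuple sz)) tn_tuple tlift_tens //.
exact: mlin_tuple.
Qed.

Lemma lin_tlift U n (phi : seq A -> U) : mlin phi ->
  linear (tlift (fun t : n.-tuple A => phi t)).
Proof. by move=> h; apply/tlift_linear/mlin_tuple. Qed.

Lemma tpow_ext U n (f g : tpow A n -> U) : linear f -> linear g ->
  (forall s, size s = n -> f (tn n s) = g (tn n s)) -> f =1 g.
Proof.
move=> hf hg fg; apply: (umod_ext hf hg) => t.
by have := fg t (size_tuple t); rewrite tn_tuple.
Qed.

Lemma eq_tlift U n (phi psi : n.-tuple A -> U) : phi =1 psi -> tlift phi =1 tlift psi.
Proof. by move=> /funext ->. Qed.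

End Multilinear.

(** * Sweedler sums *)

Section Tensor2.
Variables (k : fieldType) (A : algType k).

Definition bilin (V W U : lmodType k) (b : V -> W -> U) : Prop :=
  (forall y, linear (b^~ y)) /\ (forall x, linear (b x)).

Definition pr2 (a b : A) : tpow A 2 := tens [tuple a; b].

Lemma tset2 (t : 2.-tuple A) i (x : A) :
  tset t i x = if i == ord0 then [tuple x; t`_1] else [tuple t`_0; x].
Proof.
apply: val_inj; rewrite [LHS]val_tset.
by case: t => -[|a [|b [|]]] // pt; case: i => -[|[|i]].
Qed.

Lemma bilin_multi (U : lmodType k) (b : A -> A -> U) :
  bilin b -> multilinear (fun t : 2.-tuple A => b t`_0 t`_1).
Proof.
move=> [bl br] t i c x y; rewrite !tset2.
by case: ifP => _ /=; [exact: bl | exact: br].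
Qed.

Lemma tlift_pr2 (U : lmodType k) (b : A -> A -> U) x y : bilin b ->
  tlift (fun t : 2.-tuple A => b t`_0 t`_1) (pr2 x y) = b x y.
Proof. by move=> hb; rewrite tlift_tens //; apply: bilin_multi. Qed.

Lemma lin_tlift2 (U : lmodType k) (b : A -> A -> U) : bilin b ->
  linear (tlift (fun t : 2.-tuple A => b t`_0 t`_1)).
Proof. by move=> hb; apply/tlift_linear/bilin_multi. Qed.

Lemma tens_pr2 (t : 2.-tuple A) : tens t = pr2 t`_0 t`_1.
Proof. by congr tens; apply: val_inj; case: t => -[|a [|b [|]]]. Qed.

Lemma bilin_pr2 : bilin pr2.
Proof.
split=> z c x y.
  have := tens_multilinear [tuple 0; z] ord0 c x y.
  by rewrite !tset2 /=.
have := tens_multilinear [tuple z; 0] ord_max c x y.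
by rewrite !tset2 /=.
Qed.

Lemma tpow2_ext (U : lmodType k) (f g : tpow A 2 -> U) : linear f -> linear g ->
  (forall a b, f (pr2 a b) = g (pr2 a b)) -> f =1 g.
Proof.
move=> hf hg fg; apply: (umod_ext hf hg) => t.
by have := fg t`_0 t`_1; rewrite -tens_pr2.
Qed.

(* u is the sum of the tensors x (x) y of these pairs (x, y). *)
Definition pairs (u : tpow A 2) : seq (A * A) :=
  [seq (p.1 *: (p.2 : 2.-tuple A)`_0, (p.2 : 2.-tuple A)`_1) | p <- urep u].

Lemma tlift_pairs (U : lmodType k) (b : A -> A -> U) u : bilin b ->
  tlift (fun t : 2.-tuple A => b t`_0 t`_1) u = \sum_(p <- pairs u) b p.1 p.2.
Proof.
move=> [bl br]; rewrite big_map; apply: eq_bigr => p _ /=.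
by rewrite (linZ (bl _)).
Qed.

Lemma tlift_pairsE (U : lmodType k) (b : A -> A -> U) phi u : bilin b ->
  (forall t : 2.-tuple A, phi t = b t`_0 t`_1) ->
  tlift phi u = \sum_(p <- pairs u) b p.1 p.2.
Proof. by move=> hb /funext ->; apply: tlift_pairs. Qed.

Lemma tens2_mul_pairs u v :
  tens2_mul u v
  = \sum_(p <- pairs u) \sum_(q <- pairs v) pr2 (p.1 * q.1) (p.2 * q.2).
Proof.
have [bl br] := bilin_pr2.
rewrite /tens2_mul -(tlift_pairs (b := fun x' y' => \sum_(q <- pairs v)
    pr2 (x' * q.1) (y' * q.2))); last first.
  split=> z c a a'; rewrite scaler_sumr -big_split; apply: eq_bigr => q _ /=.
    by rewrite mulrDl -scalerAl bl.
  by rewrite mulrDl -scalerAl br.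
apply: eq_tlift => r.
rewrite -(tlift_pairs (b := fun x' y' => pr2 (r`_0 * x') (r`_1 * y'))) //.
by split=> z c a a'; rewrite mulrDr -scalerAr ?bl ?br.
Qed.

End Tensor2.

(** * Coproducts as finite sums of pairs *)

Section Sweedler.
Variables (k : fieldType) (A : hopfAlgType k).
Implicit Types (U : lmodType k) (s u v w : seq A).

(** A chosen representative of the coproduct of a; the sums of bilinear expressions over it do not
    depend on the choice. *)
Definition sw (a : A) : seq (A * A) := pairs (comul a).

Lemma lin_sw U (b : A -> A -> U) : bilin b ->
  linear (fun a => \sum_(p <- sw a) b p.1 p.2).
Proof.
move=> hb c x y; rewrite -!tlift_pairs // linearP; exact: lin_tlift2.
Qed.

Lemma sw1 U (b : A -> A -> U) : bilin b -> \sum_(p <- sw 1) b p.1 p.2 = b 1 1.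
Proof.
by move=> hb; rewrite -tlift_pairs // comul1 tlift_pr2.
Qed.

Lemma swM U (b : A -> A -> U) x y : bilin b ->
  \sum_(p <- sw (x * y)) b p.1 p.2
  = \sum_(p <- sw x) \sum_(q <- sw y) b (p.1 * q.1) (p.2 * q.2).
Proof.
move=> hb; have linb := lin_tlift2 hb.
rewrite -tlift_pairs // comulM tens2_mul_pairs.
rewrite (lin_sum linb); apply: eq_bigr => p _.
rewrite (lin_sum linb); apply: eq_bigr => q _.
by rewrite tlift_pr2.
Qed.

Definition trilin U (t : A -> A -> A -> U) : Prop :=
  [/\ forall y z, linear (fun x => t x y z), forall x z, linear (fun y => t x y z)
    & forall x y, linear (t x y)].

Lemma trilin_bilin U (t : A -> A -> A -> U) : trilin t ->
  [/\ forall z, bilin (fun x y => t x y z), forall x, bilin (t x) &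
      forall y, bilin (fun x z => t x y z)].
Proof. by case=> h1 h2 h3; split=> z; split=> ?; auto. Qed.

Lemma tset3 (t : 3.-tuple A) i x :
  tset t i x = if i == 0 :> nat then [tuple x; t`_1; t`_2]
               else if i == 1 :> nat then [tuple t`_0; x; t`_2]
               else [tuple t`_0; t`_1; x].
Proof.
apply: val_inj; rewrite [LHS]val_tset.
by case: t => -[|a [|b [|c [|]]]] // pt; case: i => -[|[|[|i]]].
Qed.

Lemma trilin_multi U (t : A -> A -> A -> U) : trilin t ->
  multilinear (fun r : 3.-tuple A => t r`_0 r`_1 r`_2).
Proof.
move=> [h1 h2 h3] r i c x y; rewrite !tset3.
case: eqP => _ /=; first exact: h1.
by case: eqP => _ /=; [exact: h2 | exact: h3].
Qed.

Lemma tlift_tens3 U (t : A -> A -> A -> U) x y z : trilin t ->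
  tlift (fun r : 3.-tuple A => t r`_0 r`_1 r`_2) (tens [tuple x; y; z]) = t x y z.
Proof. by move=> h; rewrite tlift_tens //; apply: trilin_multi. Qed.

Lemma trilin_tens3 : trilin (fun x y z : A => tens [tuple x; y; z]).
Proof.
split=> a b c x y.
- by have := tens_multilinear [tuple 0; a; b] (@Ordinal 3 0 isT) c x y; rewrite !tset3.
- by have := tens_multilinear [tuple a; 0; b] (@Ordinal 3 1 isT) c x y; rewrite !tset3.
- by have := tens_multilinear [tuple a; b; 0] (@Ordinal 3 2 isT) c x y; rewrite !tset3.
Qed.

Lemma comul2_sw a :
  comul2 a = \sum_(p <- sw a) \sum_(q <- sw p.1) tens [tuple q.1; q.2; p.2].
Proof.
have [h12 _ h13] := trilin_bilin trilin_tens3.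
apply: (tlift_pairsE (b := fun x y => \sum_(q <- sw x) tens [tuple q.1; q.2; y])).
  split=> [z|x] c y y'; first exact: (lin_sw (h12 z)).
  rewrite scaler_sumr -big_split; apply: eq_bigr => q _.
  by case: trilin_tens3 => _ _ ->.
move=> t; apply: (tlift_pairsE (b := fun x y => tens [tuple x; y; t`_1])) => //.
Qed.

Lemma tlift_comul2 U (t : A -> A -> A -> U) a : trilin t ->
  tlift (fun r : 3.-tuple A => t r`_0 r`_1 r`_2) (comul2 a)
  = \sum_(p <- sw a) \sum_(q <- sw p.1) t q.1 q.2 p.2.
Proof.
move=> ht; rewrite comul2_sw.
have lt := tlift_linear (trilin_multi ht).
rewrite (lin_sum lt); apply: eq_bigr => p _.
by rewrite (lin_sum lt); apply: eq_bigr => q _; rewrite tlift_tens3.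
Qed.

Lemma sw_coassoc U (t : A -> A -> A -> U) a : trilin t ->
  \sum_(p <- sw a) \sum_(q <- sw p.1) t q.1 q.2 p.2
  = \sum_(p <- sw a) \sum_(q <- sw p.2) t p.1 q.1 q.2.
Proof.
move=> ht; rewrite -tlift_comul2 // /comul2 comulA.
have [_ h23 _] := trilin_bilin trilin_tens3.
have lt := tlift_linear (trilin_multi ht).
rewrite (tlift_pairsE (b := fun x y => \sum_(q <- sw y) tens [tuple x; q.1; q.2])).
- rewrite (lin_sum lt); apply: eq_bigr => p _.
  by rewrite (lin_sum lt); apply: eq_bigr => q _; rewrite tlift_tens3.
- split=> [z|x] c y y'; last exact: (lin_sw (h23 x)).
  rewrite scaler_sumr -big_split; apply: eq_bigr => q _.
  by case: trilin_tens3 => ->.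
- move=> r; apply: (tlift_pairsE (b := fun x y => tens [tuple r`_0; x; y])) => //.
Qed.

Lemma counit_sw_l U (f : A -> U) a : linear f ->
  \sum_(p <- sw a) counit p.1 *: f p.2 = f a.
Proof.
move=> hf; rewrite -[in RHS](counitl a).
rewrite (tlift_pairsE (b := fun x y => counit x *: y)) //.
  by rewrite (lin_sum hf); apply: eq_bigr => p _; rewrite (linZ hf).
split=> z c x y; last by rewrite scalerDr !scalerA mulrC.
by rewrite linearP /= scalerDl scalerA.
Qed.

Lemma counit_sw_r U (f : A -> U) a : linear f ->
  \sum_(p <- sw a) counit p.2 *: f p.1 = f a.
Proof.
move=> hf; rewrite -[in RHS](counitr a).
rewrite (tlift_pairsE (b := fun x y => counit y *: x)) //.
  by rewrite (lin_sum hf); apply: eq_bigr => p _; rewrite (linZ hf).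
split=> z c x y; first by rewrite scalerDr !scalerA mulrC.
by rewrite linearP /= scalerDl scalerA.
Qed.

Lemma sw_antipodel a : \sum_(p <- sw a) antipode p.1 * p.2 = (counit a : k) *: (1 : A).
Proof.
rewrite -antipodel (tlift_pairsE (b := fun x y => antipode x * y)) //.
split=> z c x y; first by rewrite linearP mulrDl -scalerAl.
by rewrite mulrDr -scalerAr.
Qed.

Lemma sw_antipoder a : \sum_(p <- sw a) p.1 * antipode p.2 = (counit a : k) *: (1 : A).
Proof.
rewrite -antipoder (tlift_pairsE (b := fun x y => x * antipode y)) //.
split=> z c x y; first by rewrite mulrDl -scalerAl.
by rewrite linearP mulrDr -scalerAr.
Qed.

End Sweedler.

(** * The antipode is compatible with the counit and reverses products *)

Section Antipode.
Variables (k : fieldType) (A : hopfAlgType k).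
Implicit Types (x y : A).

Lemma counit_lin : linear (counit : A -> k^o).
Proof. exact: linearP. Qed.

Lemma antipode_lin : linear (antipode : A -> A).
Proof. exact: linearP. Qed.

(** Apply the counit to sum S(x_1) x_2 = counit(x) 1; the counit law contracts the left side to
    counit(S(x)). *)
Lemma counit_antipode x : counit (antipode x) = counit x :> k^o.
Proof.
have := congr1 (counit : A -> k^o) (sw_antipodel x).
rewrite (lin_sum counit_lin) (linZ counit_lin) rmorph1 [_ *: _]mulr1 => <-.
rewrite -[in LHS](counit_sw_r x (f := fun z : A => z)) //.
rewrite (lin_sum antipode_lin) (lin_sum counit_lin); apply: eq_bigr => p _.
by rewrite rmorphM (linZ antipode_lin) (linZ counit_lin) mulrC.
Qed.

(* Both sides are convolution inverses of the multiplication map. *)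
Lemma antipodeM x y : antipode (x * y) = antipode y * antipode x.
Proof.
have linr (a : A) : linear (fun z : A => antipode (a * z)).
  by move=> c z t; rewrite mulrDr -scalerAr linearP.
have linl (a : A) : linear (fun z : A => antipode (z * a)).
  by move=> c z t; rewrite mulrDl -scalerAl linearP.
(* The common value of both sides is the sum of S(x_1 y_1) x_2 y_2 S(y_3) S(x_3). Contracting y_2
   S(y_3) and then x_2 S(x_3) leaves S(x y). *)
pose X4 (q1 t1 q2 t2 r2 p2 : A) :=
  antipode (q1 * t1) * (q2 * t2) * (antipode r2 * antipode p2).
transitivity (\sum_(p <- sw x) \sum_(q <- sw p.2) \sum_(r <- sw y)
    \sum_(t <- sw r.2) X4 p.1 r.1 q.1 t.1 t.2 q.2).
  rewrite -(counit_sw_r x (linl y)); apply: eq_bigr => p _.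
  transitivity (antipode (p.1 * y) * \sum_(q <- sw p.2) q.1 * antipode q.2).
    by rewrite sw_antipoder -scalerAr mulr1.
  rewrite mulr_sumr; apply: eq_bigr => q _.
  rewrite -(counit_sw_r y (linr p.1)) mulr_suml; apply: eq_bigr => r _.
  transitivity (antipode (p.1 * r.1) * (q.1 *
     (\sum_(t <- sw r.2) t.1 * antipode t.2) * antipode q.2)).
    by rewrite sw_antipoder -!(scalerAl, scalerAr) mulr1.
  rewrite mulr_sumr mulr_suml mulr_sumr; apply: eq_bigr => t _.
  by rewrite /X4 !mulrA.
transitivity (\sum_(p <- sw x) \sum_(q <- sw p.1) \sum_(r <- sw y)
    \sum_(t <- sw r.1) X4 q.1 t.1 q.2 t.2 r.2 p.2).
  rewrite -(sw_coassoc (t := fun q1 q2 p2 => \sum_(r <- sw y)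
    \sum_(t <- sw r.2) X4 q1 r.1 q2 t.1 t.2 p2)); last first.
    split=> a b c z z'; rewrite scaler_sumr -big_split; apply: eq_bigr => r _ /=;
    rewrite scaler_sumr -big_split; apply: eq_bigr => t _ /=; rewrite /X4.
    - by rewrite linl mulrDl -scalerAl mulrDl -scalerAl.
    - by rewrite mulrDl -scalerAl mulrDr mulrDl -!(scalerAr, scalerAl).
    - by rewrite linearP mulrDr mulrDr -!(scalerAr, scalerAl).
  apply: eq_bigr => p _; apply: eq_bigr => q _.
  rewrite -(sw_coassoc (t := fun t1 t2 r2 => X4 q.1 t1 q.2 t2 r2 p.2)) //.
  split=> a b c z z'; rewrite /X4.
  - by rewrite linr mulrDl -scalerAl mulrDl -scalerAl.
  - by rewrite mulrDr mulrDr mulrDl -!(scalerAr, scalerAl).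
  - by rewrite linearP mulrDl mulrDr -!(scalerAr, scalerAl).
(* In the other grouping S(x_1 y_1) x_2 y_2 is contracted to counit(x y), since the coproduct is
   multiplicative; what remains is S(y) S(x). *)
rewrite -[in RHS](counit_sw_l y (f := fun z => antipode z)); last first.
  by move=> c z t; rewrite linearP.
rewrite -[in RHS](counit_sw_l x (f := fun z => antipode z)); last first.
  by move=> c z t; rewrite linearP.
rewrite mulr_sumr; apply: eq_bigr => p _.
rewrite exchange_big mulr_suml; apply: eq_bigr => r _ /=.
transitivity ((\sum_(z <- sw (p.1 * r.1)) antipode z.1 * z.2)
              * (antipode r.2 * antipode p.2)); last first.
  rewrite sw_antipodel -scalerAl mul1r rmorphM.
  by rewrite -scalerAl -scalerAr scalerA mulrC.
rewrite (swM _ _ (b := fun u v => antipode u * v)); last first.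
  split=> a c z t; first by rewrite linearP mulrDl -scalerAl.
  by rewrite mulrDr -scalerAr.
by rewrite mulr_suml; apply: eq_bigr => q _; rewrite mulr_suml.
Qed.

End Antipode.

(** * Entrywise coproducts of lists *)

Section IteratedSweedler.
Variables (k : fieldType) (A : hopfAlgType k).
Implicit Types (U : lmodType k) (s u v w : seq A).

(** The coproduct of the coalgebra A^{(x) n}: each entry is split, and the first and the second
    components are collected in two lists. *)
Fixpoint sws s : seq (seq A * seq A) :=
  if s is c :: s' then
    [seq (x.1 :: p.1, x.2 :: p.2) | x <- sw c, p <- sws s']
  else [:: ([::], [::])].

Definition swsum U (chi : seq A -> seq A -> U) s : U :=
  \sum_(p <- sws s) chi p.1 p.2.

Definition bmlin U (chi : seq A -> seq A -> U) : Prop :=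
  (forall v, mlin (chi^~ v)) /\ (forall u, mlin (chi u)).

Lemma swsum_nil U (chi : seq A -> seq A -> U) : swsum chi [::] = chi [::] [::].
Proof. exact: big_seq1. Qed.

Lemma swsum_cons U (chi : seq A -> seq A -> U) c s :
  swsum chi (c :: s)
  = \sum_(x <- sw c) swsum (fun u v => chi (x.1 :: u) (x.2 :: v)) s.
Proof. by rewrite /swsum /= big_allpairs_dep. Qed.

Lemma eq_swsum_size U (chi chi' : seq A -> seq A -> U) s :
  (forall u v, size u = size s -> size v = size s -> chi u v = chi' u v) ->
  swsum chi s = swsum chi' s.
Proof.
elim: s chi chi' => [|c s IH] chi chi' e; first by rewrite !swsum_nil e.
rewrite !swsum_cons; apply: eq_bigr => x _; apply: IH => u v su sv.
by apply: e => /=; rewrite ?su ?sv.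
Qed.

Lemma eq_swsum U (chi chi' : seq A -> seq A -> U) s :
  (forall u v, chi u v = chi' u v) -> swsum chi s = swsum chi' s.
Proof. by move=> e; apply: eq_bigr. Qed.

Lemma swsum_cat U (chi : seq A -> seq A -> U) s1 s2 :
  swsum chi (s1 ++ s2)
  = swsum (fun u v => swsum (fun u' v' => chi (u ++ u') (v ++ v')) s2) s1.
Proof.
elim: s1 chi => [|c s1 IH] chi; first by rewrite swsum_nil.
by rewrite cat_cons !swsum_cons; apply: eq_bigr => x _; rewrite IH.
Qed.

Lemma swsum_lin U (V : lmodType k) (f : U -> V) chi s : linear f ->
  f (swsum chi s) = swsum (fun u v => f (chi u v)) s.
Proof. by move=> hf; rewrite /swsum (lin_sum hf). Qed.

Lemma swsum_sum U I (r : seq I) (chi : I -> seq A -> seq A -> U) s :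
  swsum (fun u v => \sum_(i <- r) chi i u v) s
  = \sum_(i <- r) swsum (chi i) s.
Proof. exact: exchange_big. Qed.

Lemma bmlin_bilin U (chi : seq A -> seq A -> U) u u' v v' : bmlin chi ->
  bilin (fun x y => chi (u ++ x :: u') (v ++ y :: v')).
Proof. by move=> [h1 h2]; split=> z c x y; [exact: h1 | exact: h2]. Qed.

Lemma lin_swsum U (V : lmodType k) (chi : V -> seq A -> seq A -> U) s :
  (forall u v, linear (fun x => chi x u v)) -> linear (fun x => swsum (chi x) s).
Proof. by move=> h; apply: lin_bigsum => p; apply: h. Qed.

Lemma lin_swsum_hd U (chi : seq A -> seq A -> U) s : bmlin chi ->
  linear (fun x => swsum chi (x :: s)).
Proof.
move=> h c x y; rewrite !swsum_cons -!swsum_sum.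
apply: (lin_swsum (chi := fun x u v =>
  \sum_(q <- sw x) chi (q.1 :: u) (q.2 :: v))) => u v.
exact: (lin_sw (bmlin_bilin [::] u [::] v h)).
Qed.

Lemma mlin_swsum U (chi : seq A -> seq A -> U) : bmlin chi -> mlin (swsum chi).
Proof.
move=> [h1 h2] s1 s2 c x y; rewrite !swsum_cat.
apply: (lin_swsum (chi := fun x u v =>
  swsum (fun u' v' => chi (u ++ u') (v ++ v')) (x :: s2))) => u v d z t.
apply: (lin_swsum_hd (chi := fun u' v' => chi (u ++ u') (v ++ v'))).
by split=> w; [exact: (mlin_catl u (h1 (v ++ w))) | exact: (mlin_catl v (h2 (u ++ w)))].
Qed.

Definition tmlin U (t : seq A -> seq A -> seq A -> U) : Prop :=
  [/\ forall v w, mlin (fun u => t u v w), forall u w, mlin (fun v => t u v w)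
    & forall u v, mlin (t u v)].

Lemma tmlin_cons U (t : seq A -> seq A -> seq A -> U) x y z : tmlin t ->
  tmlin (fun u v w => t (x :: u) (y :: v) (z :: w)).
Proof.
move=> [h1 h2 h3]; split=> u v.
- exact: (mlin_cons x (h1 (y :: u) (z :: v))).
- exact: (mlin_cons y (h2 (x :: u) (z :: v))).
- exact: (mlin_cons z (h3 (x :: u) (y :: v))).
Qed.

(** Coassociativity of the entries, applied one entry at a time. *)
Lemma swsum_coassoc U (t : seq A -> seq A -> seq A -> U) s : tmlin t ->
  swsum (fun w v => swsum (fun u u' => t u u' v) w) s
  = swsum (fun u w => swsum (fun u' v => t u u' v) w) s.
Proof.
elim: s t => [|c s IH] t ht; first by rewrite !swsum_nil.
rewrite !swsum_cons.
under eq_bigr => p _ do under eq_swsum => u v do rewrite swsum_cons.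
under eq_bigr => p _.
  rewrite swsum_sum; under eq_bigr => q _ do rewrite (IH _ (tmlin_cons _ _ _ ht)).
  over.
under [RHS]eq_bigr => p _.
  under eq_swsum => u v do rewrite swsum_cons.
  rewrite swsum_sum; over.
apply: (sw_coassoc (t := fun x y z => swsum (fun u w =>
  swsum (fun u' v => t (x :: u) (y :: u') (z :: v)) w) s)).
have [h1 h2 h3] := ht.
split=> a b; apply: lin_bigsum => p; apply: lin_bigsum => q c' x y.
- exact: (h1 _ _ [::]).
- exact: (h2 _ _ [::]).
- exact: (h3 _ _ [::]).
Qed.

(** Multiplicativity of the coproduct: multiplying out a list commutes with splitting it. *)
Lemma swsum_prod U (b : A -> A -> U) s : bilin b ->
  swsum (fun u v => b (\prod_(x <- u) x) (\prod_(x <- v) x)) s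
  = \sum_(p <- sw (\prod_(x <- s) x)) b p.1 p.2.
Proof.
elim: s b => [|c s IH] b hb; first by rewrite swsum_nil !big_nil sw1.
rewrite swsum_cons [in RHS]big_cons swM //; apply: eq_bigr => x _.
rewrite -(IH (fun y z => b (x.1 * y) (x.2 * z))).
  by apply: eq_swsum => u v; rewrite !big_cons.
by have [bl br] := hb; split=> z d y y'; rewrite mulrDr -scalerAr ?bl ?br.
Qed.

(** The counit of a product is the product of the counits, so the counit law applies to each entry
    separately. *)
Lemma swsum_counitr U (phi : seq A -> U) s : mlin phi ->
  swsum (fun u v => counit (\prod_(x <- v) x) *: phi u) s = phi s.
Proof.
elim: s phi => [|c s IH] phi hphi.
  by rewrite swsum_nil big_nil rmorph1 scale1r.
rewrite swsum_cons -(counit_sw_r c (mlin_hd s hphi)); apply: eq_bigr => x _.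
rewrite -(IH (fun r => phi (x.1 :: r))) ?mlin_cons //; last exact: mlin_cons.
rewrite /swsum scaler_sumr; apply: eq_bigr => p _.
by rewrite big_cons rmorphM scalerA.
Qed.

End IteratedSweedler.

(** * Insertion of cochains and the Gerstenhaber bracket *)

Section Insertion.
Variables (k : fieldType) (A : algType k).
Implicit Types (U : lmodType k) (s u v w : seq A) (F G : seq A -> A) (e : k) (i m n : nat).

(* The sum over i of e ^+ i times phi with F, of arity n, inserted at position  *)
(* i; with e = (-1) ^+ (n - 1) this is the composition phi o F of cochains.      *)
Fixpoint ins n e F U (phi : seq A -> U) s : U :=
  phi (F (take n s) :: drop n s) +
  (if s is c :: s' then e *: ins n e F (fun r => phi (c :: r)) s' else 0).

Lemma ins_nil n e F U (phi : seq A -> U) : ins n e F phi [::] = phi [:: F [::]].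
Proof. by rewrite /= addr0. Qed.

Lemma ins_cons n e F U (phi : seq A -> U) c s :
  ins n e F phi (c :: s) = phi (F (take n (c :: s)) :: drop n (c :: s))
    + e *: ins n e F (fun r => phi (c :: r)) s.
Proof. by []. Qed.

(** The positions with fewer than n entries to their right are kept; if F has arity n and phi is
    multilinear, their terms vanish. *)
Lemma insE n e F U (phi : seq A -> U) s :
  ins n e F phi s = \sum_(i < (size s).+1) e ^+ i *:
    phi (take i s ++ F (take n (drop i s)) :: drop n (drop i s)).
Proof.
elim: s phi => [|c s IH] phi.
  by rewrite big_ord1 /= addr0 scale1r.
rewrite ins_cons IH [in RHS]big_ord_recl /= expr0 scale1r; congr (_ + _).
rewrite scaler_sumr; apply: eq_bigr => i _ /=.
by rewrite scalerA exprS.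
Qed.

(** A list into which a value has been inserted is never empty. *)
Lemma eq_ins_size n e F U (phi psi : seq A -> U) s :
  (forall r, (0 < size r)%N -> phi r = psi r) -> ins n e F phi s = ins n e F psi s.
Proof.
by move=> h; rewrite !insE; apply: eq_bigr => i _; rewrite h // size_cat addnS.
Qed.

Lemma eq_ins n e F U (phi psi : seq A -> U) s :
  (forall r, phi r = psi r) -> ins n e F phi s = ins n e F psi s.
Proof. by move=> h; apply: eq_ins_size. Qed.

Lemma lin_ins n e F U (V : lmodType k) (f : U -> V) phi s : linear f ->
  f (ins n e F phi s) = ins n e F (fun r => f (phi r)) s.
Proof.
by move=> hf; rewrite !insE (lin_sum hf); apply: eq_bigr => i _; rewrite (linZ hf).
Qed.

Lemma ins_phiD n e F U (phi psi : seq A -> U) s :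
  ins n e F (fun r => phi r + psi r) s = ins n e F phi s + ins n e F psi s.
Proof.
by rewrite !insE -big_split; apply: eq_bigr => i _; rewrite scalerDr.
Qed.

Lemma ins_phiZ n e F U a (phi : seq A -> U) s :
  ins n e F (fun r => a *: phi r) s = a *: ins n e F phi s.
Proof.
by rewrite !insE scaler_sumr; apply: eq_bigr => i _; rewrite !scalerA mulrC.
Qed.

Lemma ins_phiB n e F U a (phi psi : seq A -> U) s :
  ins n e F (fun r => phi r - a *: psi r) s
  = ins n e F phi s - a *: ins n e F psi s.
Proof.
rewrite -[in RHS]scaleNr -ins_phiZ -ins_phiD.
by apply: eq_ins => r; rewrite scaleNr.
Qed.

Lemma ins_phi0 n e F U (phi : seq A -> U) s :
  (forall r, (0 < size r)%N -> phi r = 0) -> ins n e F phi s = 0.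
Proof.
by move=> h; rewrite insE big1 // => i _; rewrite h ?scaler0 // size_cat addnS.
Qed.

Lemma ins_opB n e F G a U (phi : seq A -> U) s : mlin phi ->
  ins n e (fun r => F r - a *: G r) phi s
  = ins n e F phi s - a *: ins n e G phi s.
Proof.
move=> h; rewrite !insE scaler_sumr -sumrB; apply: eq_bigr => i _.
rewrite -scaleNr addrC h addrC scaleNr scalerBr; congr (_ - _).
by rewrite !scalerA mulrC.
Qed.

Lemma ins_op0 n e F U (phi : seq A -> U) s : mlin phi ->
  (forall r, F r = 0) -> ins n e F phi s = 0.
Proof.
move=> h F0; rewrite insE big1 // => i _.
by rewrite F0 (lin0 (mlin_lin _ _ h)) scaler0.
Qed.

Lemma arity_ins m n e F U (phi : seq A -> U) : mlin phi -> arity n F ->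
  arity m phi -> arity (m + n).-1 (ins n e F phi).
Proof.
move=> hphi aF aphi s sz; rewrite insE big1 // => i _.
set t := take n _; have [szt|szt] := eqVneq (size t) n; last first.
  by rewrite aF // (lin0 (mlin_lin _ _ hphi)) scaler0.
rewrite aphi ?scaler0 //; apply: contra_neq sz.
rewrite size_cat /= size_drop size_takel; last by rewrite -ltnS.
move: szt (ltn_ord i); rewrite /t size_take size_drop ltnS => szt ile <-.
move: szt; case: ltnP => [lt _|le szn].
  by rewrite addnS addSn /= -addnA subnK ?subnKC // ltnW.
by rewrite -szn subnn addn1 addSn /= subnKC.
Qed.

Lemma mlin_cut3 U (chi : seq A -> seq A -> seq A -> U) i n :
  (forall v w, mlin (fun u => chi u v w)) -> (forall u w, mlin (fun v => chi u v w)) ->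
  (forall u v, mlin (chi u v)) ->
  mlin (fun s => chi (take i s) (take n (drop i s)) (drop n (drop i s))).
Proof.
move=> h1 h2 h3.
apply: (mlin_cut (chi := fun u v => chi u (take n v) (drop n v))) => [v|u].
  exact: h1.
exact: (mlin_cut (chi := chi u)).
Qed.

Lemma mlin_ins n e F U (phi : seq A -> U) : mlin F -> mlin phi ->
  mlin (ins n e F phi).
Proof.
move=> hF hphi s1 s2 c x y; rewrite !insE !size_cat /= scaler_sumr -big_split.
apply: eq_bigr => i _ /=.
have := @mlin_cut3 _ (fun u v w => phi (u ++ F v :: w)) i n.
move=> ->; first by rewrite scalerDr !scalerA mulrC.
- by move=> v w; exact: (mlin_catr (F v :: w)).
- by move=> u w; exact: (mlin_comp (mlin_lin u w hphi) hF).
- by move=> u v; exact: (mlin_cons (F v) (mlin_catl u hphi)).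
Qed.

Lemma take_pred_size m n s (c : A) : (0 < m + n)%N ->
  take (m + n) (c :: s) = c :: take (m + n).-1 s.
Proof. by case: (m + n)%N. Qed.

Lemma drop_pred_size m n s (c : A) : (0 < m + n)%N ->
  drop (m + n) (c :: s) = drop (m + n).-1 s.
Proof. by case: (m + n)%N. Qed.

(** An insertion falls either into the block read by the first argument of [chi], which then stems
    from m + n - 1 entries, or into the rest, after the n entries of the block, whence the factor e
    ^+ n. *)
Lemma ins_cut m n e F U (chi : seq A -> seq A -> U) s :
  mlin F -> arity m F ->
  (forall v, mlin (chi^~ v)) -> (forall u, mlin (chi u)) ->
  (forall v, arity n (chi^~ v)) ->
  ins m e F (fun r => chi (take n r) (drop n r)) s
  = ins m e F (chi^~ (drop (m + n).-1 s)) (take (m + n).-1 s)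
    + e ^+ n *: ins m e F (chi (take n s)) (drop n s).
Proof.
move=> lF aF; elim: n s chi => [|n IH] s chi l1 l2 ar.
  rewrite addn0 take0 drop0 expr0 scale1r.
  rewrite [X in X + _]ins_phi0 ?add0r; last first.
    by move=> r; rewrite lt0n => r0; apply: ar.
  by apply: eq_ins => r; rewrite take0 drop0.
rewrite addnS /=; case: s => [|c s].
  rewrite !ins_nil take_oversize // drop_oversize //=.
  by rewrite (ar _ [::]) // scaler0 addr0.
rewrite [LHS]ins_cons.
have lc1 v : mlin (fun u => chi (c :: u) v) by exact: (mlin_cons c (l1 v)).
have lc2 u : mlin (chi (c :: u)) by exact: l2.
have ac v : arity n (fun u => chi (c :: u) v) by move=> u su; exact: (ar v (c :: u)).
rewrite (IH s (fun u v => chi (c :: u) v)) // exprS -scalerA /= scalerDr addrA.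
congr (_ + _); have [mn0|mn0] := posnP (m + n)%N; last first.
  have tE : take m (c :: take (m + n).-1 s) = take m (c :: s).
    by rewrite -take_pred_size // take_takel ?leq_addr.
  have dE : drop m (c :: take (m + n).-1 s) = take n (drop m (c :: s)).
    by rewrite -take_pred_size // take_drop addnC.
  have hE : drop n (drop m (c :: s)) = drop (m + n).-1 s.
    by rewrite drop_drop addnC drop_pred_size.
  by rewrite take_pred_size // drop_pred_size // ins_cons tE dE hE.
move: mn0 => /eqP; rewrite addn_eq0 => /andP[/eqP m0 /eqP n0].
by rewrite m0 n0 !take0 !drop0 !ins_nil (ar s [:: c; _]) ?n0 // scaler0 addr0.
Qed.

(* As in circ, n.+1 stands for n - 1 in the exponents of signs. *)
Definition sgn n : k := (-1) ^+ n.+1.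

Lemma sgn2 n : sgn n * sgn n = 1.
Proof. by rewrite -expr2 sqrr_sign. Qed.

Definition sgn_xchg m n : k := (-1) ^+ (m.+1 * n.+1).

Lemma sgn_xchgC m n : sgn_xchg m n = sgn_xchg n m.
Proof. by rewrite /sgn_xchg mulnC. Qed.

Lemma sgn_xchg2 m n : sgn_xchg m n * sgn_xchg m n = 1.
Proof. by rewrite -expr2 sqrr_sign. Qed.

Lemma sgn_exp m n : sgn m ^+ n = sgn_xchg m n * sgn m.
Proof.
by rewrite /sgn /sgn_xchg mulnS exprD mulrAC -expr2 sqrr_sign mul1r exprM.
Qed.

(* The bracket [G, F]: G o F is ins m (sgn m) F G. *)
Definition gbr m n F G s : A :=
  ins m (sgn m) F G s - sgn_xchg m n *: ins n (sgn n) G F s.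

Lemma mlin_gbr m n F G : mlin F -> mlin G -> mlin (gbr m n F G).
Proof. by move=> lF lG; apply: mlinB; [|apply: mlinZ]; apply: mlin_ins. Qed.

Lemma arity_gbr m n F G : mlin F -> mlin G -> arity m F -> arity n G ->
  arity (m + n).-1 (gbr m n F G).
Proof.
move=> lF lG aF aG s sz; rewrite /gbr (arity_ins (m := n)) //; last by rewrite addnC.
by rewrite (arity_ins (m := m)) // scaler0 subr0.
Qed.

Lemma gbr00 F G s : arity 0 F -> arity 0 G -> gbr 0 0 F G s = 0.
Proof.
by move=> aF aG; rewrite /gbr !ins_phi0 ?scaler0 ?subr0 // => r;
   rewrite lt0n => /[dup] /aF ? /aG.
Qed.

Lemma gbrC m n F G s : gbr m n F G s = - sgn_xchg m n *: gbr n m G F s.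
Proof.
rewrite /gbr scaleNr scalerBr scalerA sgn_xchgC sgn_xchg2 scale1r opprB.
by [].
Qed.

(* The insertions of F and G at disjoint places cancel, those of F into G and of  *)
(* G into F remain.                                                              *)
Lemma pre_lie m n F G U (phi : seq A -> U) s :
  mlin F -> mlin G -> mlin phi -> arity m F -> arity n G ->
  ins m (sgn m) F (ins n (sgn n) G phi) s
    - sgn_xchg m n *: ins n (sgn n) G (ins m (sgn m) F phi) s
  = ins (m + n).-1 (sgn m * sgn n) (gbr m n F G) phi s.
Proof.
move=> lF lG lphi aF aG.
pose R n' G' (psi : seq A -> U) t : U :=
  if t is c :: t' then sgn n' *: ins n' (sgn n') G' (fun r => psi (c :: r)) t' else 0.
have insR n' G' (psi : seq A -> U) t :
    ins n' (sgn n') G' psi t = psi (G' (take n' t) :: drop n' t) + R n' G' psi t.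
  by case: t.
have hdE m' n' F' G' (psi : seq A -> U) t :
    mlin F' -> mlin G' -> mlin psi -> arity m' F' -> arity n' G' ->
    ins m' (sgn m') F' (fun r => psi (G' (take n' r) :: drop n' r)) t
    = psi (ins m' (sgn m') F' G' (take (m' + n').-1 t) :: drop (m' + n').-1 t)
      + (sgn_xchg m' n' * sgn m') *:
        ins m' (sgn m') F' (fun r => psi (G' (take n' t) :: r)) (drop n' t).
  move=> lF' lG' lpsi aF' aG'.
  rewrite (@ins_cut m' n' _ F' _ (fun u v => psi (G' u :: v))) ?sgn_exp //.
  - by rewrite (lin_ins _ _ _ _ _ (mlin_hd (drop (m' + n').-1 t) lpsi)).
  - by move=> v; apply: (mlin_comp (mlin_hd v lpsi) lG').
  - by move=> u; apply: mlin_cons.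
  - by move=> v u /aG' ->; rewrite (lin0 (mlin_hd v lpsi)).
(* The double insertions, sorted: F' inside G' at the head, F' to the right of G' at the head, F' at
   the head with G' to its right, and those that leave the first entry of t alone. *)
have D2E m' n' F' G' (psi : seq A -> U) t :
    mlin F' -> mlin G' -> mlin psi -> arity m' F' -> arity n' G' ->
    ins m' (sgn m') F' (ins n' (sgn n') G' psi) t
    = psi (ins m' (sgn m') F' G' (take (m' + n').-1 t) :: drop (m' + n').-1 t)
      + (sgn_xchg m' n' * sgn m') *:
        ins m' (sgn m') F' (fun r => psi (G' (take n' t) :: r)) (drop n' t)
      + (sgn n' *: ins n' (sgn n') G' (fun r => psi (F' (take m' t) :: r)) (drop m' t)
      + (if t is c :: t' then (sgn m' * sgn n') *:
           ins m' (sgn m') F' (ins n' (sgn n') G' (fun r => psi (c :: r))) t' else 0)).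
  move=> lF' lG' lpsi aF' aG'.
  under eq_ins => r do rewrite insR.
  rewrite (ins_phiD _ _ _ (fun r => psi (G' (take n' r) :: drop n' r))).
  rewrite (hdE m' n' F' G' psi) //; congr (_ + _).
  case: t => [|c t]; first by rewrite ins_nil /= !addr0.
  rewrite ins_cons [R _ _ _ (_ :: _)]/= -scalerA; congr (_ + _ *: _).
  by rewrite -ins_phiZ.
(* P and Q stand for the insertions at disjoint places; they occur in both orders and cancel because
   the exchange sign x squares to 1. *)
have alg (a b P Q T1 T2 : U) (x y z : k) : x * x = 1 ->
    a + (x * y) *: P + (z *: Q + T1) - x *: (b + (x * z) *: Q + (y *: P + T2))
    = (a - x *: b) + (T1 - x *: T2).
  move=> xx; rewrite !scalerDr !scalerA mulrA xx mul1r.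
  rewrite [z *: Q + T1]addrC addrACA [_ *: P + x *: T2]addrC [X in _ - X]addrACA.
  by rewrite [z *: Q + _]addrC [X in _ - X]addrC addrKA opprD addrACA.
elim: s phi lphi => [|c s IH] phi lphi;
  rewrite (D2E m n) // (D2E n m) // (sgn_xchgC n m) alg ?sgn_xchg2 // [(n + m)%N]addnC /=.
  rewrite scaler0 subr0 !addr0 /gbr.
  by rewrite (linB (mlin_hd _ lphi)) (linZ (mlin_hd _ lphi)) !ins_nil.
rewrite [gbr _ _ _ _ (take _ _)]/gbr (linB (mlin_hd _ lphi)) (linZ (mlin_hd _ lphi)).
congr (_ + _); rewrite -(IH (fun r => phi (c :: r))); last exact: mlin_cons.
by rewrite scalerBr !scalerA [sgn n * sgn m]mulrC [_ * sgn_xchg m n]mulrC.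
Qed.

Definition mul2 s : A := if s is [:: a; b] then a * b else 0.

Lemma arity_mul2 : arity 2 mul2.
Proof. by case=> [|a [|b [|c s]]]. Qed.

Lemma mlin_mul2 : mlin mul2.
Proof.
move=> [|a [|b [|d s1]]] [|a' [|b' s2]] c x y //=; rewrite ?scaler0 ?addr0 //.
  by rewrite mulrDl scalerAl.
by rewrite mulrDr scalerAr.
Qed.

Lemma sgnS n : sgn n.+1 = - sgn n.
Proof. by rewrite /sgn exprS mulN1r. Qed.

Lemma sgn_xchg_2 n : sgn_xchg 2 n = sgn n.
Proof. by rewrite /sgn_xchg /sgn -signr_odd -[RHS]signr_odd oddM. Qed.

Lemma sgn_xchgSl m n : sgn_xchg m.+1 n = sgn_xchg m n * sgn n.
Proof. by rewrite /sgn_xchg /sgn mulSn exprD mulrC. Qed.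

Lemma sgn_xchgSr m n : sgn_xchg m n.+1 = sgn_xchg m n * sgn m.
Proof. by rewrite sgn_xchgC sgn_xchgSl sgn_xchgC. Qed.

Lemma sgnD m n : (0 < m + n)%N -> sgn (m + n).-1 = sgn m * sgn n.
Proof.
by move=> mn; rewrite /sgn prednK // -exprD addnS addSn -[LHS]signr_odd -[RHS]signr_odd /= negbK.
Qed.

(* The opposite of the Hochschild differential. *)
Definition gdif n F : seq A -> A := gbr 2%N n mul2 F.

Lemma arity_gdif n F : mlin F -> arity n F -> arity n.+1 (gdif n F).
Proof.
by move=> lF aF; apply: (arity_gbr mlin_mul2 lF arity_mul2 aF).
Qed.

(** The graded Jacobi identity for F, G and the multiplication: [pre_lie] is used for each two of
    the three, acting on the third. *)
Lemma gdif_gbr m n F G s :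
  mlin F -> mlin G -> arity m F -> arity n G ->
  gdif (m + n).-1 (gbr m n F G) s
  = gbr m.+1 n (gdif m F) G s + sgn m *: gbr m n.+1 F (gdif n G) s.
Proof.
move=> lF lG aF aG.
have PL1 := pre_lie s lF lG mlin_mul2 aF aG.
have s2 : sgn 2 = -1 by rewrite /sgn !exprS expr0 mulr1 mulrN1 opprK mulr1.
have PL2 := pre_lie s mlin_mul2 lF lG arity_mul2 aF.
have PL3 := pre_lie s mlin_mul2 lG lF arity_mul2 aG.
rewrite s2 sgn_xchg_2 mulN1r -sgnS /= in PL2.
rewrite s2 sgn_xchg_2 mulN1r -sgnS /= in PL3.
have -> : gdif (m + n).-1 (gbr m n F G) s
    = ins 2%N (-1) mul2 (gbr m n F G) s
      - (sgn m * sgn n) *: ins (m + n).-1 (sgn m * sgn n) (gbr m n F G) mul2 s.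
  (* For m = n = 0 the truncated degree has the wrong sign, but the bracket of two 0-cochains is
     0. *)
  have [mn0|mn] := posnP (m + n)%N; last first.
    by rewrite /gdif {1}/gbr sgn_xchg_2 sgnD // s2.
  move: mn0 => /eqP; rewrite addn_eq0 => /andP[/eqP m0 /eqP n0].
  have gb0 r : gbr m n F G r = 0.
    by move: aF aG; rewrite m0 n0; apply: gbr00.
  rewrite /gdif {1}/gbr !(ins_op0 _ _ _ mlin_mul2 gb0) !scaler0.
  by rewrite !ins_phi0 // => r _.
rewrite -PL1.
rewrite [gbr m.+1 n _ _ _]/gbr -PL2 [gbr m n.+1 _ _ _]/gbr -PL3.
rewrite sgn_xchgSl sgn_xchgSr.
rewrite !(ins_phiB, sgn_xchg_2, s2).
move: (sgn m) (sgn n) (sgn_xchg m n) (sgn2 m) => a b x aa.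
(* With names for the six double insertions, the claim is an identity of linear combinations that
   only uses a * a = 1. *)
set p := ins 2 _ _ (ins m _ _ _) s; set q := ins 2 _ _ (ins n _ _ _) s.
set r := ins m _ _ (ins n _ _ _) s; set t := ins n _ _ (ins m _ _ _) s.
set u := ins m _ _ (ins 2 _ _ _) s; set v := ins n _ _ (ins 2 _ _ _) s.
rewrite !scalerBr !scalerA [a * (x * a)]mulrCA aa mulr1.
have -> : x * b * a = a * b * x by rewrite -mulrA mulrC [b * a]mulrC.
rewrite !opprB [RHS]addrACA !subrKA.
by rewrite addrACA [RHS]addrACA [X in _ + X = _]addrC.
Qed.

(** In the derivation rule the term with the differential of the cocycle F drops out; so brackets of
    F with coboundaries are coboundaries. *)
Lemma gbr_gdifr m n F G s :
  mlin F -> mlin G -> arity m F -> arity n G -> (forall r, gdif m F r = 0) ->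
  gbr m n.+1 F (gdif n G) s = sgn m *: gdif (m + n).-1 (gbr m n F G) s.
Proof.
move=> lF lG aF aG dF.
rewrite gdif_gbr // scalerDr scalerA sgn2 scale1r.
rewrite [gbr m.+1 n _ _ _]/gbr (ins_op0 _ _ _ lG dF) ins_phi0 => [|r _].
  by rewrite scaler0 subr0 scaler0 add0r.
exact: dF.
Qed.

Lemma gdif_gbr0 m n F G s :
  mlin F -> mlin G -> arity m F -> arity n G ->
  (forall r, gdif m F r = 0) -> (forall r, gdif n G r = 0) ->
  gdif (m + n).-1 (gbr m n F G) s = 0.
Proof.
move=> lF lG aF aG dF dG; rewrite gdif_gbr // /gbr.
rewrite (ins_op0 _ _ _ lG dF) (ins_op0 _ _ _ lF dG).
by rewrite !ins_phi0 => [|r _|r _]; rewrite ?dF ?dG ?scaler0 ?subr0 ?scaler0 ?addr0.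
Qed.

End Insertion.

(** * Bar resolutions *)

Section Contraction.
Variables (k : fieldType) (A : hopfAlgType k).
Implicit Types (U : lmodType k) (s u v w : seq A) (n : nat).

(* The Hochschild differential without its two outer terms, up to sign. *)
Definition dmul U (phi : seq A -> U) : seq A -> U := ins 2%N (-1) (@mul2 k A) phi.

Lemma mlin_dmul U (phi : seq A -> U) : mlin phi -> mlin (dmul phi).
Proof. by apply: mlin_ins; apply: mlin_mul2. Qed.

Lemma dmul0 U (phi : seq A -> U) : mlin phi -> dmul phi [::] = 0.
Proof. by move=> h; rewrite /dmul ins_nil (lin0 (mlin_hd [::] h)). Qed.

Lemma dmul1 U (phi : seq A -> U) a : mlin phi -> dmul phi [:: a] = 0.
Proof.
move=> h; rewrite /dmul ins_cons ins_nil /= (lin0 (mlin_hd [::] h)).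
by rewrite (lin0 (mlin_hd [::] (mlin_cons a h))) scaler0 addr0.
Qed.

Lemma dmul_cons U (phi : seq A -> U) a b s :
  dmul phi (a :: b :: s) = phi (a * b :: s) - dmul (fun r => phi (a :: r)) (b :: s).
Proof. by rewrite /dmul ins_cons scaleN1r /= take0 drop0. Qed.

Lemma dmul_rcons U (phi : seq A -> U) s y z : mlin phi ->
  dmul phi (rcons (rcons s y) z)
  = dmul (fun r => phi (rcons r z)) (rcons s y)
    + (-1) ^+ size s *: phi (rcons s (y * z)).
Proof.
elim: s phi => [|a s IH] phi h.
  rewrite dmul_cons !dmul1 ?subr0 ?add0r ?scale1r //; first exact: mlin_rcons.
  exact: mlin_cons.
have IHa := IH (fun r => phi (a :: r)) (mlin_cons a h).
case: s IH IHa => [|b s] IH IHa; rewrite !rcons_cons !dmul_cons in IHa *.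
  by rewrite IHa opprD addrA /= expr1 scaleN1r scale1r.
by rewrite IHa opprD addrA [in RHS]exprS mulN1r scaleNr.
Qed.

(** Separates the two terms in which the outer coefficients x and y absorb an entry from those that
    leave x and y alone. *)
Lemma dmul_ends U (phi : seq A -> U) x c s t e y : mlin phi -> c :: s = rcons t e ->
  dmul phi (x :: rcons (c :: s) y)
  = phi (x * c :: rcons s y) - dmul (fun r => phi (x :: rcons r y)) (c :: s)
    - (-1) ^+ size t *: phi (x :: rcons t (e * y)).
Proof.
move=> h E; rewrite rcons_cons dmul_cons -rcons_cons E dmul_rcons.
  by rewrite opprD addrA.
exact: mlin_cons.
Qed.

Lemma dmul_lin U (V : lmodType k) (f : U -> V) phi s : linear f ->
  f (dmul phi s) = dmul (fun r => f (phi r)) s.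
Proof. exact: lin_ins. Qed.

Lemma eq_dmul U (phi psi : seq A -> U) s :
  (forall r, phi r = psi r) -> dmul phi s = dmul psi s.
Proof. exact: eq_ins. Qed.

Lemma val_contract n i (t : n.+1.-tuple A) : (i < n)%N ->
  contract i t = take i t ++ t`_i * t`_i.+1 :: drop i.+2 t :> seq A.
Proof.
move=> lt_in; have szt := size_tuple t.
apply: (@eq_from_nth _ 0).
  rewrite size_tuple size_cat /= size_take size_drop szt.
  by rewrite ltnS ltnW // -addSnnS subSS subnKC.
rewrite size_tuple => j jn.
rewrite -[j in LHS]/(val (Ordinal jn)) -tnth_nth tnth_mktuple /= nth_cat.
rewrite size_take szt (leqW lt_in).
case: ltngtP => // ji; first by rewrite nth_take.
  rewrite -[(j - i)%N]prednK ?subn_gt0 //= nth_drop; congr nth.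
  by rewrite !addSn -addnS prednK ?subn_gt0 // subnKC // ltnW.
by rewrite ji subnn.
Qed.

Lemma sum_contract n (t : n.+2.-tuple A) :
  \sum_(i < n.+1) (-1) ^+ i *: tens (contract i t) = dmul (tn n.+1) t.
Proof.
have szt := size_tuple t.
have tn0 s1 s2 : tn n.+1 (s1 ++ 0 :: s2) = 0 :> tpow A _.
  by rewrite (lin0 (mlin_lin _ _ (@mlin_tn _ _ _))).
(* The last two positions leave fewer than two entries to multiply, so [mul2] is 0 there. *)
rewrite /dmul insE szt [in RHS]big_ord_recr [in RHS]big_ord_recr /=.
have d2 : drop n.+2 t = [::] by rewrite drop_oversize ?szt.
have d1 : drop n.+1 t = [:: t`_n.+1] by rewrite (drop_nth 0) ?szt // d2.
rewrite d2 d1 /= !tn0 !scaler0 !addr0.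
apply: eq_bigr => i _; congr (_ *: _).
apply: tens_tn; rewrite val_contract //.
rewrite (drop_nth 0 (n := i)) ?szt; last by rewrite ltnW // ltnS.
have hi : (i.+1 < size t)%N by rewrite szt ltnS; exact: ltn_ord.
rewrite (drop_nth 0 hi) /=.
by rewrite take0 ?drop0.
Qed.

End Contraction.

(** * Actions and differentials of the two bar resolutions on generators *)

Section BarResolutions.
Variables (k : fieldType) (A : hopfAlgType k).
Implicit Types (U : lmodType k) (s u v w : seq A) (n : nat) (a b c : A).

Lemma lin_mull c : linear (fun x : A => c * x).
Proof. by move=> a x y; rewrite mulrDr scalerAr. Qed.

Lemma lin_mulr c : linear (fun x : A => x * c).
Proof. by move=> a x y; rewrite mulrDl scalerAl. Qed.

Lemma size_ends a s b : size (a :: rcons s b) = (size s).+2.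
Proof. by rewrite /= size_rcons. Qed.

Lemma take_rcons_size n s b : size s = n -> take n (rcons s b) = s.
Proof. by move=> <-; rewrite -cats1 take_size_cat. Qed.

Lemma drop_rcons_size n s b : size s = n -> drop n (rcons s b) = [:: b].
Proof. by move=> <-; rewrite -cats1 drop_size_cat. Qed.

Definition trilinB U (gamma : A -> seq A -> A -> U) : Prop :=
  [/\ forall s b, linear (fun a => gamma a s b),
      forall a b, mlin (fun s => gamma a s b) & forall a s, linear (gamma a s)].

(* The products pick the only entry of lists of length 1; unlike [nth] they   *)
(* are multilinear in lists of every length.                                 *)
Definition barB_lift n U (gamma : A -> seq A -> A -> U) : tpow A n.+2 -> U :=
  tlift (fun t : n.+2.-tuple A =>
    gamma (\prod_(x <- take 1 t) x) (take n (drop 1 t))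
          (\prod_(x <- drop n (drop 1 t)) x)).

Lemma mlin_barB_lift n U (gamma : A -> seq A -> A -> U) : trilinB gamma ->
  mlin (fun s => gamma (\prod_(x <- take 1 s) x) (take n (drop 1 s))
                       (\prod_(x <- drop n (drop 1 s)) x)).
Proof.
move=> [h1 h2 h3].
apply: (mlin_cut3 (chi := fun u v w => gamma (\prod_(x <- u) x) v (\prod_(x <- w) x))).
- by move=> v w; apply: (mlin_comp (h1 v _) (@mlin_prod _ _)).
- by move=> u w; apply: h2.
- by move=> u v; apply: (mlin_comp (h3 _ _) (@mlin_prod _ _)).
Qed.

Lemma lin_barB_lift n U (gamma : A -> seq A -> A -> U) : trilinB gamma ->
  linear (@barB_lift n U gamma).
Proof. by move=> h; exact: (lin_tlift (mlin_barB_lift n h)). Qed.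

Lemma barB_liftE n U (gamma : A -> seq A -> A -> U) a s b : trilinB gamma ->
  size s = n -> barB_lift gamma (tn n.+2 (a :: rcons s b)) = gamma a s b.
Proof.
move=> h sz; rewrite /barB_lift (tlift_tn (mlin_barB_lift n h)) /= ?size_rcons ?sz //.
by rewrite take0 drop0 take_rcons_size // drop_rcons_size // !big_seq1.
Qed.

Lemma barB_ext n U (f g : tpow A n.+2 -> U) : linear f -> linear g ->
  (forall a s b, size s = n ->
     f (tn n.+2 (a :: rcons s b)) = g (tn n.+2 (a :: rcons s b))) -> f =1 g.
Proof.
move=> hf hg fg; apply: (tpow_ext hf hg) => -[|a s] //; case/lastP: s => [|s b] //.
by rewrite /= size_rcons => -[] sz; apply: fg.
Qed.

Definition bilinP U (gamma : A -> seq A -> U) : Prop :=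
  (forall s, linear (fun a => gamma a s)) /\ (forall a, mlin (gamma a)).

Definition barP_lift n U (gamma : A -> seq A -> U) : tpow A n.+1 -> U :=
  tlift (fun t : n.+1.-tuple A => gamma (\prod_(x <- take 1 t) x) (drop 1 t)).

Lemma mlin_barP_lift U (gamma : A -> seq A -> U) : bilinP gamma ->
  mlin (fun s => gamma (\prod_(x <- take 1 s) x) (drop 1 s)).
Proof.
move=> [h1 h2]; apply: (mlin_cut (chi := fun u v => gamma (\prod_(x <- u) x) v)).
- by move=> v; apply: (mlin_comp (h1 v) (@mlin_prod _ _)).
- by move=> u; apply: h2.
Qed.

Lemma lin_barP_lift n U (gamma : A -> seq A -> U) : bilinP gamma ->
  linear (@barP_lift n U gamma).
Proof. by move=> h; exact: (lin_tlift (mlin_barP_lift h)). Qed.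

Lemma barP_liftE n U (gamma : A -> seq A -> U) a s : bilinP gamma ->
  size s = n -> barP_lift gamma (tn n.+1 (a :: s)) = gamma a s.
Proof.
move=> h sz; rewrite /barP_lift (tlift_tn (mlin_barP_lift h)) /= ?sz //.
by rewrite take0 drop0 !big_seq1.
Qed.

Lemma barP_ext n U (f g : tpow A n.+1 -> U) : linear f -> linear g ->
  (forall a s, size s = n -> f (tn n.+1 (a :: s)) = g (tn n.+1 (a :: s))) -> f =1 g.
Proof.
move=> hf hg fg; apply: (tpow_ext hf hg) => -[|a s] //.
by move=> -[] sz; apply: fg.
Qed.

Lemma bilinP_tn n : bilinP (fun a s => tn n.+1 (a :: s)).
Proof.
split=> [s|a]; first exact: (mlin_hd s (@mlin_tn _ _ _)).
exact: (mlin_cons a (@mlin_tn _ _ _)).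
Qed.

Lemma trilinB_tn n : trilinB (fun a s b => tn n.+2 (a :: rcons s b)).
Proof.
split=> [s b|a b|a s].
- exact: (mlin_hd _ (@mlin_tn _ _ _)).
- exact: (mlin_rcons b (mlin_cons a (@mlin_tn _ _ _))).
- have := mlin_lin (a :: s) [::] (@mlin_tn _ A n.+2).
  by move=> h c x y; have := h c x y; rewrite /= !cats1.
Qed.

Lemma tens_mktuple n (E : 'I_n -> A) s : size s = n ->
  (forall j : 'I_n, E j = s`_j) -> tens [tuple E j | j < n] = tn n s.
Proof.
move=> sz e; rewrite /tn sz eqxx; congr tens.
by apply: eq_from_tnth => j; rewrite !tnth_mktuple.
Qed.

Lemma barP_actE n a : opact (o := barP A n) a = barP_lift (fun x s => tn n.+1 (a * x :: s)).
Proof.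
apply/funext => u; apply: eq_tlift => t.
case/tupleP: t => x t; apply: tens_mktuple.
  by rewrite /= drop0 size_tuple.
move=> j; rewrite -val_eqE (tnth_nth 0) /= take0 big_seq1 drop0.
by case: j => -[|j].
Qed.

Lemma lin_barP_act n a : linear (opact (o := barP A n) a).
Proof.
rewrite barP_actE; apply: lin_barP_lift; have [h1 h2] := bilinP_tn n.
by split=> [s|b]; [apply: (lin_comp (h1 s) (lin_mull a)) | apply: h2].
Qed.

Lemma barP_act n a b s :
  opact (o := barP A n) a (tn n.+1 (b :: s)) = tn n.+1 (a * b :: s).
Proof.
have [sz|sz] := eqVneq (size s) n; last first.
  by rewrite !tn_size ?(lin0 (lin_barP_act _)) //= eqSS.
rewrite barP_actE barP_liftE //; have [h1 h2] := bilinP_tn n.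
by split=> [t|c]; [apply: (lin_comp (h1 t) (lin_mull a)) | apply: h2].
Qed.

Lemma trilinB_barB_act n a b : trilinB (fun x s y => tn n.+2 (a * x :: rcons s (y * b))).
Proof.
have [h1 h2 h3] := trilinB_tn n; split=> [s y|x y|x s].
- exact: (lin_comp (h1 s (y * b)) (lin_mull a)).
- exact: h2.
- exact: (lin_comp (h3 _ s) (lin_mulr b)).
Qed.

Lemma barB_actE n ab : opact (o := barB A n) ab =
  barB_lift (fun x s y => tn n.+2 (ab.1 * x :: rcons s (y * ab.2))).
Proof.
apply/funext => u; apply: eq_tlift => t.
case/tupleP: t => x t.
have [s [y [tE sz]]] : exists s y, tval t = rcons s y /\ size s = n.
  have := size_tuple t; case/lastP: (tval t) => // s y.
  by rewrite size_rcons => -[]; exists s, y.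
apply: tens_mktuple.
  by rewrite /= drop0 tE take_rcons_size // size_rcons sz.
move=> j; rewrite -!val_eqE !(tnth_nth 0) /= take0 drop0 tE.
rewrite take_rcons_size // drop_rcons_size // !big_seq1.
case: j => -[|j] //= jn; rewrite !nth_rcons sz eqSS.
by case: ltngtP => // /eqP.
Qed.

Lemma lin_barB_act n ab : linear (opact (o := barB A n) ab).
Proof. by rewrite barB_actE; apply/lin_barB_lift/trilinB_barB_act. Qed.

Lemma barB_act n a b x s y :
  opact (o := barB A n) (a, b) (tn n.+2 (x :: rcons s y))
  = tn n.+2 (a * x :: rcons s (y * b)).
Proof.
have [sz|sz] := eqVneq (size s) n; last first.
  by rewrite !tn_size ?(lin0 (lin_barB_act _)) ?size_ends ?eqSS.
by rewrite barB_actE barB_liftE //; apply: trilinB_barB_act.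
Qed.

Lemma barB_difE n :
  @cdif _ _ (barB A) n = tlift (fun t : n.+3.-tuple A => dmul (tn n.+2) t).
Proof. by apply/funext => u; apply: eq_tlift => t; rewrite sum_contract. Qed.

Lemma lin_barB_dif n : linear (@cdif _ _ (barB A) n).
Proof. by rewrite barB_difE; apply/lin_tlift/mlin_dmul/mlin_tn. Qed.

Lemma barB_dif_tn n s : @cdif _ _ (barB A) n (tn n.+3 s) = dmul (tn n.+2) s.
Proof.
have [sz|sz] := eqVneq (size s) n.+3.
  by rewrite barB_difE tlift_tn //; apply/mlin_dmul/mlin_tn.
rewrite tn_size // (lin0 (@lin_barB_dif n)); apply/esym.
apply: (arity_ins _ (@mlin_tn _ A n.+2) (@arity_mul2 _ A) (@arity_tn _ A n.+2)).
by rewrite addn2.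
Qed.

Lemma ophom_barB_dif n : ophom (@cdif _ _ (barB A) n).
Proof.
have ld := @lin_barB_dif n; split=> // -[a b]; have la := lin_barB_act (a, b).
apply: barB_ext (lin_comp ld (@la n.+1)) (lin_comp (@la n) ld) _ => x s y sz.
have lt := @mlin_tn _ A n.+2.
have lta : mlin (fun s => opact (o := barB A n) (a, b) (tn n.+2 s)).
  exact: (mlin_comp (@la n) lt).
rewrite barB_act // !barB_dif_tn (@dmul_lin k A (tpow A n.+2) (tpow A n.+2) _ _ _ (@la n)).
case: s sz => // c s [sz]; case/lastP E: (c :: s) => [|t e] //; rewrite -E.
have szt : size t = n by have := congr1 size E; rewrite /= size_rcons sz => -[].
rewrite !(dmul_ends _ _ _ E) // !barB_act // !mulrA.
congr (_ - _ - _).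
by apply: eq_dmul => r; rewrite barB_act.
Qed.

Lemma barP_difE n :
  @cdif _ _ (barP A) n = tlift (fun t : n.+2.-tuple A => dmul (tn n.+1) t
    + (-1) ^+ n.+1 *: (counit (\prod_(x <- drop n.+1 t) x) *: tn n.+1 (take n.+1 t))).
Proof.
apply/funext => u; apply: eq_tlift => t; rewrite sum_contract; congr (_ + _ *: _).
have szt := size_tuple t.
rewrite (drop_nth 0) ?szt // drop_oversize ?szt // big_seq1; congr (_ *: _).
apply: tens_mktuple; first by rewrite size_take szt ltnSn.
by move=> j; rewrite nth_take.
Qed.

Lemma mlin_barP_dif n : mlin (fun s => dmul (tn n.+1) s
    + (-1) ^+ n.+1 *: (counit (\prod_(x <- drop n.+1 s) x) *: tn n.+1 (take n.+1 s))).
Proof.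
apply: mlinD; first exact/mlin_dmul/mlin_tn.
apply: mlinZ; apply: (mlin_cut (chi := fun u v => counit (\prod_(x <- v) x) *: tn n.+1 u)).
  by move=> v; apply/mlinZ/mlin_tn.
move=> u; apply: (mlin_comp (f := fun x => counit x *: tn n.+1 u)) (@mlin_prod _ _) => c x y.
by rewrite linearP scalerDl scalerA.
Qed.

Lemma lin_barP_dif n : linear (@cdif _ _ (barP A) n).
Proof. by rewrite barP_difE; apply: (lin_tlift (mlin_barP_dif n)). Qed.

Lemma barP_dif_tn n s b : size s = n.+1 ->
  @cdif _ _ (barP A) n (tn n.+2 (rcons s b))
  = dmul (tn n.+1) (rcons s b) + (-1) ^+ n.+1 *: (counit b *: tn n.+1 s).
Proof.
move=> sz; rewrite barP_difE (tlift_tn (mlin_barP_dif n)) ?size_rcons ?sz //.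
by rewrite drop_rcons_size // take_rcons_size // big_seq1.
Qed.

End BarResolutions.

(** * Cohomology classes and the bracket on Hochschild cohomology *)

Section Classes.
Variables (k : fieldType) (Op : Type) (C : complex k Op) (N : opmod k Op).
Hypothesis act_lin : forall a, linear (opact (o := N) a).

Lemma ophom0 n : ophom (fun _ : C n => 0 : N).
Proof.
by split=> [a x y|a x]; rewrite ?(lin0 (act_lin _)) // scaler0 addr0.
Qed.

Lemma ophomB n (f g : C n -> N) : ophom f -> ophom g -> ophom (fun x => f x - g x).
Proof.
move=> [lf af] [lg ag]; split=> [a x y|a x].
  by rewrite lf lg scalerBr opprD addrACA.
by rewrite af ag (linB (act_lin _)).
Qed.

Lemma coboundary0 n : coboundary (fun _ : C n => 0 : N).
Proof. by case: n => [|n] //=; exists (fun=> 0) => //; apply: ophom0. Qed.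

Lemma coboundaryB n (f g : C n -> N) :
  coboundary f -> coboundary g -> coboundary (fun x => f x - g x).
Proof.
case: n f g => [|n] f g /=; first by move=> f0 g0 x; rewrite f0 g0 subr0.
move=> [h oh fh] [l ol gl]; exists (fun x => h x - l x); first exact: ophomB.
by move=> x; rewrite fh gl.
Qed.

Lemma eq_coboundary n (f g : C n -> N) : f =1 g -> coboundary f -> coboundary g.
Proof. by move=> /funext ->. Qed.

Lemma coboundary_sym n (f g : C n -> N) :
  coboundary (fun x => f x - g x) -> coboundary (fun x => g x - f x).
Proof.
move=> h; apply: eq_coboundary (coboundaryB (coboundary0 n) h) => x.
by rewrite sub0r opprB.
Qed.

Lemma coboundary_trans n (f g h : C n -> N) :
  coboundary (fun x => f x - g x) -> coboundary (fun x => g x - h x) ->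
  coboundary (fun x => f x - h x).
Proof.
move=> fg /coboundary_sym gh; apply: eq_coboundary (coboundaryB fg gh) => x.
by rewrite opprB addrA subrK.
Qed.

Lemma mem_coclass n (f : C n -> N) : cocycle f -> coclass f f.
Proof.
by split=> //; apply: eq_coboundary (coboundary0 n) => x; rewrite subrr.
Qed.

Lemma coclass_eq n (f g : C n -> N) :
  coboundary (fun x => f x - g x) -> coclass f = coclass g.
Proof.
move=> fg; apply/seteqP; split=> h [ch hh]; split=> //.
  exact: coboundary_trans hh fg.
exact: coboundary_trans hh (coboundary_sym fg).
Qed.

Lemma coclass_inj n (f g : C n -> N) : cocycle f -> coclass f = coclass g ->
  coboundary (fun x => f x - g x).
Proof. by move=> /mem_coclass + fg; rewrite fg => -[]. Qed.

End Classes.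

(** * Hochschild cochains, their differential, and the bracket of classes *)

Section Hochschild.
Variables (k : fieldType) (A : hopfAlgType k).
Implicit Types (s u v w : seq A) (m n : nat) (a b c : A) (phi psi : seq A -> A).

Lemma bimod_act_lin ab : linear (opact (o := bimod A) ab).
Proof. exact: (lin_comp (lin_mulr ab.2) (lin_mull ab.1)). Qed.

(* The bar cochain in Hom_k(A^n, A) of a bimodule map on the bar resolution. *)
Definition hat n (F : barB A n -> bimod A) s : A := F (tn n.+2 (1 :: rcons s 1)).

Lemma mlin_hat n (F : barB A n -> bimod A) : linear F -> mlin (hat F).
Proof.
move=> lF; apply: (mlin_comp (f := F) lF).
exact: (mlin_rcons 1 (mlin_cons 1 (@mlin_tn _ _ _))).
Qed.

Lemma arity_hat n (F : barB A n -> bimod A) : linear F -> arity n (hat F).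
Proof.
by move=> lF s sz; rewrite /hat tn_size ?(lin0 lF) //= size_rcons !eqSS.
Qed.

(** The bar resolution of A is free on the tensors with outer factors 1, so [hat F] determines F. *)
Lemma hatE n (F : barB A n -> bimod A) a s b : ophom F ->
  F (tn n.+2 (a :: rcons s b)) = a * hat F s * b.
Proof.
move=> [_ aF]; rewrite /hat; have := aF (a, b) (tn n.+2 (1 :: rcons s 1)).
by rewrite barB_act mulr1 mul1r.
Qed.

Lemma bimod_ext n (F G : barB A n -> bimod A) : ophom F -> ophom G ->
  (forall s, size s = n -> hat F s = hat G s) -> F =1 G.
Proof.
move=> oF oG FG; apply: barB_ext (proj1 oF) (proj1 oG) _ => a s b sz.
by rewrite !hatE // FG.
Qed.

(** Only the insertions at the first two positions yield lists of length two. *)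
Lemma ins_mul2 n e phi a s t b : arity n phi -> size s = n -> a :: s = rcons t b ->
  ins n e phi (@mul2 k A) (a :: s) = phi t * b + e *: (a * phi s).
Proof.
move=> aphi sz st; have szt : size t = n.
  by have := congr1 size st; rewrite /= size_rcons sz => -[].
rewrite ins_cons st take_rcons_size // drop_rcons_size //; congr (_ + _ *: _).
case: s sz st => [|c s] sz st; first by rewrite ins_nil.
rewrite ins_cons take_oversize ?sz // drop_oversize ?sz //.
rewrite insE big1 ?scaler0 ?addr0 // => i _.
by case: (take i s) => [|d u] /=; rewrite scaler0.
Qed.

(** The outer terms of the bar differential are the compositions of the multiplication with [hat F],
    the inner ones are [hat F] composed with the multiplication. *)
Lemma hat_dif n (F : barB A n -> bimod A) s : ophom F -> size s = n.+1 ->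
  F (@cdif _ _ (barB A) n (tn n.+3 (1 :: rcons s 1))) = - gdif n (hat F) s.
Proof.
move=> oF sz; have lF := proj1 oF.
rewrite barB_dif_tn (dmul_lin _ _ lF).
case: s sz => [|x s] // [sz].
case/lastP E: (x :: s) => [|t y] //; rewrite -E.
have szt : size t = n by have := congr1 size E; rewrite /= size_rcons sz => -[].
rewrite (dmul_ends _ _ _ E); last exact: (mlin_comp lF (@mlin_tn _ _ _)).
rewrite !hatE // mulr1 !mul1r -/(hat F) /gdif /gbr sgn_xchg_2.
rewrite (ins_mul2 _ (arity_hat lF) sz E) szt mulr1.
rewrite [ins 2 _ _ _ _](_ : _ = dmul (hat F) (x :: s)); last first.
  by rewrite /dmul /sgn !exprS expr0 mulr1 mulrN1 opprK mulr1.
rewrite scalerDr scalerA sgn2 scale1r opprB /sgn exprS mulN1r scaleNr.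
by rewrite addrC addrA.
Qed.

Lemma gdif_cocycle n (F : barB A n -> bimod A) s : cocycle F -> gdif n (hat F) s = 0.
Proof.
move=> [oF dF]; have lF := proj1 oF.
have [sz|sz] := eqVneq (size s) n.+1.
  by apply/eqP; rewrite -oppr_eq0 -hat_dif // dF.
exact: (arity_gdif (mlin_hat lF) (arity_hat lF)).
Qed.

Definition bext n phi : barB A n -> bimod A := barB_lift (fun a s b => a * phi s * b).

Lemma trilinB_bext phi : mlin phi -> trilinB (fun a s b => a * phi s * b).
Proof.
move=> h; split=> [s b|a b|a s].
- exact: (lin_comp (lin_mulr b) (lin_mulr (phi s))).
- exact: (mlin_comp (lin_mulr b) (mlin_comp (lin_mull a) h)).
- exact: lin_mull.
Qed.

Lemma hat_bext n phi s : mlin phi -> arity n phi -> hat (@bext n phi) s = phi s.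
Proof.
move=> h ar; have [sz|sz] := eqVneq (size s) n.
  by rewrite /hat /bext barB_liftE ?mul1r ?mulr1 //; apply: trilinB_bext.
rewrite ar // (arity_hat _ sz) //; exact: lin_barB_lift (trilinB_bext h).
Qed.

Lemma ophom_bext n phi : mlin phi -> ophom (@bext n phi).
Proof.
move=> h; have lb := lin_barB_lift (n:=n) (trilinB_bext h); split=> // -[a b].
have l2 : linear (fun x => @bext n phi (opact (o := barB A n) (a, b) x)).
  exact: (lin_comp lb (@lin_barB_act _ _ n (a, b))).
have l3 : linear (fun x : barB A n => opact (o := bimod A) (a, b) (@bext n phi x)).
  exact: (lin_comp (bimod_act_lin (a, b)) lb).
apply: (barB_ext l2 l3) => x s y sz.
by rewrite barB_act /bext !(barB_liftE _ _ (trilinB_bext h)) // /= !mulrA.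
Qed.

Lemma cocycle_bext n phi : mlin phi -> arity n phi ->
  (forall s, gdif n phi s = 0) -> cocycle (@bext n phi).
Proof.
move=> h ar d0; have ob := ophom_bext n h; split=> //.
have lb := proj1 ob.
have [ld ad] := @ophom_barB_dif k A n.
have l2 : linear (fun x => @bext n phi (@cdif _ _ (barB A) n x)) := lin_comp lb ld.
have l0 : linear (fun _ : tpow A n.+3 => 0 : A) by move=> c x y; rewrite scaler0 addr0.
apply: (barB_ext l2 l0) => a s b sz.
have -> : tn n.+3 (a :: rcons s b)
    = opact (o := barB A n.+1) (a, b) (tn n.+3 (1 :: rcons s 1)).
  by rewrite barB_act mulr1 mul1r.
rewrite ad (proj2 ob) /= (hat_dif ob) //.
by rewrite (_ : hat _ = phi) ?d0 ?oppr0 ?mulr0 ?mul0r //; apply/funext => r; apply: hat_bext.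
Qed.

(** The counterpart of [coboundary] for functions of lists; [cobP] relates the two. *)
Fixpoint cob n phi : Prop :=
  if n is p.+1 then
    exists psi, [/\ mlin psi, arity p psi & forall s, phi s = - gdif p psi s]
  else forall s, phi s = 0.

Lemma cobP n (F : barB A n -> bimod A) : ophom F -> coboundary F <-> cob n (hat F).
Proof.
case: n F => [|p] F oF; split.
- by move=> F0 s; apply: F0.
- move=> F0; apply: (bimod_ext oF (@ophom0 k _ (barB A) (bimod A) bimod_act_lin 0)).
  by move=> s _; rewrite F0.
- move=> [h oh Fh]; have lh := proj1 oh; exists (hat h).
  split; [exact: mlin_hat | exact: arity_hat | move=> s].
  have [sz|sz] := eqVneq (size s) p.+1; first by rewrite /hat Fh -hat_dif.
  rewrite (arity_hat (proj1 oF)) // (arity_gdif (mlin_hat lh) (arity_hat lh)) //.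
  by rewrite oppr0.
- move=> [psi [lpsi apsi Fpsi]]; have oh := ophom_bext p lpsi.
  exists (@bext p psi) => //.
  have [ld ad] := @ophom_barB_dif k A p.
  have o2 : ophom (fun x : barB A p.+1 => @bext p psi (@cdif _ _ (barB A) p x)).
    by split=> [|ab x]; [exact: (lin_comp (proj1 oh) ld) | rewrite ad (proj2 oh)].
  apply: (bimod_ext oF o2) => s sz; rewrite [RHS]/hat (hat_dif oh) // Fpsi.
  by rewrite (_ : hat _ = psi) //; apply/funext => r; apply: hat_bext.
Qed.

Lemma gbrBl m n phi phi' (e : k) psi s : mlin psi ->
  gbr m n (fun r => phi r - e *: phi' r) psi s
  = gbr m n phi psi s - e *: gbr m n phi' psi s.
Proof.
move=> lG; rewrite /gbr ins_opB // ins_phiB !scalerBr !scalerA [e * _]mulrC.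
by rewrite !opprB !addrA addrAC [X in _ = X]addrAC; congr (_ + _); rewrite addrAC.
Qed.

Lemma gbrBr m n phi (e : k) psi psi' s : mlin phi ->
  gbr m n phi (fun r => psi r - e *: psi' r) s
  = gbr m n phi psi s - e *: gbr m n phi psi' s.
Proof.
move=> lphi; rewrite gbrC gbrBl // [in RHS]gbrC [gbr m n phi psi' s]gbrC.
by rewrite scalerBr !scalerA mulrC.
Qed.

Lemma gbr0r m n phi s : mlin phi -> gbr m n phi (fun=> 0) s = 0.
Proof.
by move=> h; rewrite /gbr ins_phi0 // (ins_op0 _ _ _ h) // scaler0 subr0.
Qed.

Lemma gbrZr m n phi (e : k) psi s : mlin phi ->
  gbr m n phi (fun r => e *: psi r) s = e *: gbr m n phi psi s.
Proof.
move=> h; have := gbrBr m n (- e) (fun=> 0) psi s h.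
rewrite gbr0r // sub0r scaleNr opprK => <-; congr gbr.
by apply/funext => r; rewrite sub0r scaleNr opprK.
Qed.

Lemma cob0 n : cob n (fun=> 0).
Proof.
case: n => [|n] //=; exists (fun=> 0); split=> //.
- by move=> s1 s2 c x y; rewrite scaler0 addr0.
- by move=> s; rewrite /gdif (gbr0r _ _ _ (@mlin_mul2 _ _)) oppr0.
Qed.

Lemma cobB n phi psi (e : k) :
  cob n phi -> cob n psi -> cob n (fun s => phi s - e *: psi s).
Proof.
case: n => [|n] /=; first by move=> h1 h2 s; rewrite h1 h2 scaler0 subr0.
move=> [p [lp ap hp]] [q [lq aq hq]]; exists (fun s => p s - e *: q s); split.
- exact: mlinB lp (mlinZ e lq).
- by move=> s sz; rewrite ap // aq // scaler0 subr0.
- move=> s; rewrite hp hq /gdif (gbrBr _ _ _ _ _ _ (@mlin_mul2 _ _)).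
  move: (gbr _ _ _ p s) (gbr _ _ _ q s) => P Q.
  by rewrite scalerN opprK opprB addrC.
Qed.

Lemma eq_cob n phi psi : phi =1 psi -> cob n phi -> cob n psi.
Proof. by move=> /funext ->. Qed.

(** If psi is the differential of chi, then up to sign the bracket with phi is the differential of
    the bracket of phi and chi ([gbr_gdifr]). *)
Lemma cob_gbrr m n phi psi : mlin phi -> arity m phi ->
  (forall s, gdif m phi s = 0) -> mlin psi -> cob n psi -> cob (m + n).-1 (gbr m n phi psi).
Proof.
move=> lphi aphi dphi lpsi; case: n => [psi0|n [chi [lchi achi psiE]]].
  apply: eq_cob (cob0 _) => s; rewrite /gbr (ins_op0 _ _ _ lphi psi0) ins_phi0.
    by rewrite scaler0 subr0.
  by move=> r _; apply: psi0.
have E s : gbr m n.+1 phi psi s = - (sgn k m *: gdif (m + n).-1 (gbr m n phi chi) s).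
  rewrite -gbr_gdifr // -scaleN1r -gbrZr //; congr gbr.
  by apply/funext => r; rewrite psiE scaleN1r.
apply: eq_cob (fun s => esym (E s)) _.
(* For m = n = 0 the result lies in degree 0, where a coboundary has to vanish; it does, as the
   bracket of the 0-cochains phi and chi is 0. *)
rewrite addnS /=; have [mn0|mn] := posnP (m + n)%N.
  move: mn0 => /eqP; rewrite addn_eq0 => /andP[/eqP m0 /eqP n0].
  have gb0 r : gbr m n phi chi r = 0.
    by move: aphi achi; rewrite m0 n0; apply: gbr00.
  apply: eq_cob (cob0 _) => s; rewrite (_ : gbr m n phi chi = fun=> 0); last exact/funext.
  by rewrite /gdif (gbr0r _ _ _ (@mlin_mul2 _ _)) scaler0 oppr0.
rewrite -[X in cob X _]prednK //=; exists (fun s => sgn k m *: gbr m n phi chi s); split.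
- by apply: mlinZ; apply: mlin_gbr.
- by move=> s sz; rewrite (arity_gbr lphi lchi aphi achi) // scaler0.
move=> s; congr (- _).
by rewrite /gdif (gbrZr _ _ _ _ _ (@mlin_mul2 _ _)).
Qed.

(** Graded antisymmetry reduces this to [cob_gbrr]. *)
Lemma cob_gbrl m n phi psi : mlin phi -> arity n psi ->
  (forall s, gdif n psi s = 0) -> mlin psi -> cob m phi -> cob (m + n).-1 (gbr m n phi psi).
Proof.
move=> lphi apsi dpsi lpsi cphi; have := cob_gbrr lpsi apsi dpsi lphi cphi.
move=> /(cobB (sgn_xchg k m n) (cob0 _)); rewrite addnC.
by apply: eq_cob => s; rewrite sub0r -scaleNr -gbrC.
Qed.

Lemma val_rcons n (t : n.-tuple A) a b : [tuple of a :: rcons t b] = a :: rcons t b :> seq A.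
Proof. by []. Qed.

Lemma bar_restrictE n (F : barB A n -> bimod A) :
  bar_restrict F = tlift (fun t : n.-tuple A => hat F t).
Proof.
apply/funext => u; apply: eq_tlift => t; rewrite /hat; congr F.
by apply: tens_tn; rewrite val_rcons.
Qed.

Lemma bar_restrict_tn n (F : barB A n -> bimod A) s : linear F ->
  bar_restrict F (tn n s) = hat F s.
Proof.
move=> lF; have [sz|sz] := eqVneq (size s) n.
  by rewrite bar_restrictE (tlift_tn (mlin_hat lF)).
rewrite tn_size // (arity_hat lF) // bar_restrictE.
exact: (lin0 (lin_tlift (mlin_hat lF))).
Qed.

Lemma lin_bar_restrict n (F : barB A n -> bimod A) : linear F -> linear (bar_restrict F).
Proof. by move=> lF; rewrite bar_restrictE; apply/lin_tlift/mlin_hat. Qed.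

Lemma bar_extendE n (F : tpow A n -> A) : bar_extend F = @bext n (fun s => F (tn n s)).
Proof.
apply/funext => u; apply: eq_tlift => t; case/tupleP: t => x t.
have [s [y [tE sz]]] : exists s y, tval t = rcons s y /\ size s = n.
  have := size_tuple t; case/lastP: (tval t) => // s y.
  by rewrite size_rcons => -[]; exists s, y.
have -> : tens [tuple [tuple of x :: t]`_j.+1 | j < n] = tn n s.
  by apply: tens_mktuple => // j; rewrite /= tE nth_rcons sz ltn_ord.
rewrite /= take0 drop0 tE take_rcons_size // drop_rcons_size // !big_seq1.
by rewrite nth_rcons sz ltnn eqxx.
Qed.

(** On a list of length m + n - 1 the positions from m on leave fewer than n entries for psi. *)
Lemma ins_trunc m n (e : k) (U : lmodType k) psi (phi : seq A -> U) s : size s = (m + n).-1 ->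
  mlin phi -> arity m phi -> arity n psi ->
  ins n e psi phi s = \sum_(i < m) e ^+ i *:
    phi (take i s ++ psi (take n (drop i s)) :: drop n (drop i s)).
Proof.
move=> sz lphi aphi apsi; have [mn0|mn] := posnP (m + n)%N.
  have m0 : m = 0%N by lia.
  rewrite ins_phi0 => [|r r0]; last by rewrite aphi // m0 -lt0n.
  by rewrite big1 // => -[i im]; exfalso; lia.
rewrite insE sz prednK // big_split_ord /= [X in _ + X]big1 ?addr0 // => i _.
rewrite [psi _]apsi ?(lin0 (mlin_lin _ _ lphi)) ?scaler0 //.
by rewrite size_take size_drop sz; case: ltnP; have := ltn_ord i; lia.
Qed.

(** N is a separate variable because the opposite composition in [gerst] has type degree (m + n).-1
    and not (n + m).-1. *)
Lemma circE m n N (F : tpow A m -> A) (G : tpow A n -> A) :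
  N = (m + n).-1 -> linear F -> linear G ->
  circ F G = tlift (fun t : N.-tuple A =>
    ins n (sgn k n) (fun s => G (tn n s)) (fun s => F (tn m s)) t).
Proof.
move=> NE lF lG; apply/funext => u; apply: eq_tlift => t.
have szt : size t = (m + n).-1 by rewrite size_tuple.
have ar p (H : tpow A p -> A) : linear H -> arity p (fun s => H (tn p s)).
  by move=> lH s sz; rewrite tn_size ?(lin0 lH).
rewrite (ins_trunc _ szt (mlin_comp lF (@mlin_tn _ _ _)) (ar _ _ lF) (ar _ _ lG)).
apply: eq_bigr => i _; have im := ltn_ord i.
rewrite /sgn -exprM; congr (_ *: F _).
have szd : size (take n (drop i t)) = n.
  by rewrite size_take size_drop szt; case: ltnP; lia.
apply: tens_mktuple.
  by rewrite size_cat /= size_take !size_drop szt; case: ltnP; lia.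
move=> j; have jm := ltn_ord j.
rewrite nth_cat size_takel ?szt; last by lia.
rewrite -val_eqE /=; case: ltngtP => ji; first by rewrite nth_take.
  rewrite -[(j - i)%N]prednK ?subn_gt0 //= !nth_drop; congr nth; lia.
rewrite ji subnn /=; congr G; apply: tens_mktuple => // l.
by rewrite nth_take // nth_drop.
Qed.

Definition HH_cochain_bracket m n (F : barB A m -> bimod A) (G : barB A n -> bimod A) :
  barB A (m + n).-1 -> bimod A := bar_extend (gerst (bar_restrict F) (bar_restrict G)).

(** F and G change places because the leading term of [gbr] inserts its first cochain into its
    second. *)
Lemma HHbrE m n (F : barB A m -> bimod A) (G : barB A n -> bimod A) :
  linear F -> linear G ->
  HH_cochain_bracket F G = @bext (m + n).-1 (gbr n m (hat G) (hat F)).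
Proof.
move=> lF lG; rewrite /HH_cochain_bracket bar_extendE.
have rE p (H : barB A p -> bimod A) : linear H -> (fun s => bar_restrict H (tn p s)) = hat H.
  by move=> lH; apply/funext => s; apply: bar_restrict_tn.
have [mF mG] := (mlin_hat lF, mlin_hat lG).
have [lrF lrG] := (lin_bar_restrict lF, lin_bar_restrict lG).
have cE1 := circE (erefl (m + n).-1) lrF lrG; rewrite !rE // in cE1.
have cE2 := circE (congr1 predn (addnC m n)) lrG lrF; rewrite !rE // in cE2.
have m1 := mlin_ins n (sgn k n) mG mF; have m2 := mlin_ins m (sgn k m) mF mG.
congr (bext (n := (m + n).-1)); apply/funext => s; rewrite /gerst cE1 cE2.
have [sz|sz] := eqVneq (size s) (m + n).-1; last first.
  rewrite (arity_gbr mG mF (arity_hat lG) (arity_hat lF)); last by rewrite addnC.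
  by rewrite tn_size // (lin0 (lin_tlift m1)) (lin0 (lin_tlift m2)) scaler0 subr0.
by rewrite (tlift_tn m1) // (tlift_tn m2) // /gbr /sgn_xchg mulnC.
Qed.

Lemma cocycle_HHbr m n (F : barB A m -> bimod A) (G : barB A n -> bimod A) :
  cocycle F -> cocycle G -> cocycle (HH_cochain_bracket F G).
Proof.
move=> cF cG; have [lF lG] := (proj1 (proj1 cF), proj1 (proj1 cG)).
have [mF mG] := (mlin_hat lF, mlin_hat lG).
have [aF aG] := (arity_hat lF, arity_hat lG).
rewrite HHbrE //; apply: cocycle_bext; first exact: mlin_gbr.
  by rewrite addnC; apply: arity_gbr.
by move=> s; rewrite addnC; apply: gdif_gbr0 => // r; apply: gdif_cocycle.
Qed.

Lemma hat_HHbr m n (F : barB A m -> bimod A) (G : barB A n -> bimod A) s :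
  linear F -> linear G -> hat (HH_cochain_bracket F G) s = gbr n m (hat G) (hat F) s.
Proof.
move=> lF lG; have [mF mG] := (mlin_hat lF, mlin_hat lG).
rewrite HHbrE // hat_bext //; first exact: mlin_gbr.
by rewrite addnC; apply: arity_gbr => //; apply: arity_hat.
Qed.

(** [F', G'] - [F, G] = [F' - F, G'] + [F, G' - G], and both terms bracket a cocycle with a
    coboundary. *)
Lemma HHbr_cohom m n (F F' : barB A m -> bimod A) (G G' : barB A n -> bimod A) :
  cocycle F -> cocycle F' -> cocycle G -> cocycle G' ->
  coboundary (fun x => F' x - F x) -> coboundary (fun x => G' x - G x) ->
  coboundary (fun x => HH_cochain_bracket F' G' x - HH_cochain_bracket F G x).
Proof.
move=> cF cF' cG cG' dF dG.
have oB := ophomB (C := barB A) (N := bimod A) bimod_act_lin.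
have lin p (H : barB A p -> bimod A) : cocycle H -> linear H by case=> -[].
have mh p (H : barB A p -> bimod A) (cH : cocycle H) := mlin_hat (lin p H cH).
have ah p (H : barB A p -> bimod A) (cH : cocycle H) := arity_hat (lin p H cH).
apply/(cobP (oB _ _ _ (cocycle_HHbr cF' cG').1 (cocycle_HHbr cF cG).1)).
have {}dF := (cobP (oB _ _ _ cF'.1 cF.1)).1 dF.
have {}dG := (cobP (oB _ _ _ cG'.1 cG.1)).1 dG.
have := cobB (-1) (cob_gbrr (mh _ _ cG') (ah _ _ cG')
    (fun s => gdif_cocycle s cG') (mlinB (mh _ _ cF') (mh _ _ cF)) dF)
  (cob_gbrl (mlinB (mh _ _ cG') (mh _ _ cG)) (ah _ _ cF)
    (fun s => gdif_cocycle s cF) (mh _ _ cF) dG).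
rewrite addnC; apply: eq_cob => s.
have -> : hat (fun x => HH_cochain_bracket F' G' x - HH_cochain_bracket F G x) s
    = hat (HH_cochain_bracket F' G') s - hat (HH_cochain_bracket F G) s by [].
rewrite !hat_HHbr; try exact: lin.
have hB phi psi : (fun r => phi r - psi r) = (fun r => phi r - (1 : k) *: psi r).
  by apply/funext => r; rewrite scale1r.
rewrite (hB (hat F') (hat F)) (hB (hat G') (hat G)).
rewrite (gbrBr _ _ _ _ _ _ (mh _ _ cG')) (gbrBl _ _ _ _ _ _ (mh _ _ cF)).
by rewrite scaleN1r opprK !scale1r addrA subrK.
Qed.

Lemma HH_bracketE m n (F : barB A m -> bimod A) (G : barB A n -> bimod A) :
  cocycle F -> cocycle G -> HH_bracket (coclass F) (coclass G) = coclass (HH_cochain_bracket F G).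
Proof.
move=> cF cG; apply/seteqP; split=> [H [F' [cF' dF'] [G' [cG' dG']]] h|H h].
  rewrite -(coclass_eq bimod_act_lin (HHbr_cohom cF cF' cG cG' dF' dG')).
  exact: h.
by exists F; [exact: (mem_coclass bimod_act_lin) | exists G;
  [exact: (mem_coclass bimod_act_lin) | exact: h]].
Qed.

End Hochschild.

(** * The induced modules and the comparison map *)

Section Induction.
Variables (k : fieldType) (A : hopfAlgType k).
Implicit Types (U : lmodType k) (M : opmod k A) (m n : nat) (a b c x : A).

Lemma env_mul_pr2E a b (v : tpow A 2) :
  env_mul (pr2 a b) v = \sum_(q <- pairs v) pr2 (a * q.1) (q.2 * b).
Proof.
have [bl br] := @bilin_pr2 _ A.
have E (r : 2.-tuple A) :
    tlift (fun t : 2.-tuple A => tens [tuple r`_0 * t`_0; t`_1 * r`_1]) v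
    = \sum_(q <- pairs v) pr2 (r`_0 * q.1) (q.2 * r`_1).
  rewrite (tlift_pairsE (b := fun x y => pr2 (r`_0 * x) (y * r`_1))) //.
  split=> z c x y; first by rewrite lin_mull bl.
  by rewrite lin_mulr br.
rewrite /env_mul; under eq_tlift => r do rewrite E.
rewrite (tlift_pr2 (b := fun x y => \sum_(q <- pairs v) pr2 (x * q.1) (q.2 * y))) //.
split=> z; apply: lin_bigsum => q c x y; first by rewrite lin_mulr bl.
by rewrite lin_mull br.
Qed.

Lemma lin_env_mull (v : tpow A 2) : linear (fun u : tpow A 2 => env_mul u v).
Proof.
have [bl br] := @bilin_pr2 _ A.
have E u : env_mul u v
    = tlift (fun r : 2.-tuple A => \sum_(q <- pairs v) pr2 (r`_0 * q.1) (q.2 * r`_1)) u.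
  apply: eq_tlift => r.
  rewrite (tlift_pairsE (b := fun x y => pr2 (r`_0 * x) (y * r`_1))) //.
  split=> z c x y; first by rewrite lin_mull bl.
  by rewrite lin_mulr br.
move=> c y z; rewrite !E.
apply: (lin_tlift2 (b := fun x y => \sum_(q <- pairs v) pr2 (x * q.1) (q.2 * y))).
split=> t; apply: lin_bigsum => q d x x'; first by rewrite lin_mulr bl.
by rewrite lin_mull br.
Qed.

Lemma lin_env_mulr a b : linear (env_mul (pr2 a b) : tpow A 2 -> tpow A 2).
Proof.
have [bl br] := @bilin_pr2 _ A.
have bb : bilin (fun x y => pr2 (a * x) (y * b)).
  split=> z c x y; first by rewrite lin_mull bl.
  by rewrite lin_mulr br.
move=> c x y; rewrite !env_mul_pr2E -!(tlift_pairs _ bb).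
exact: (lin_tlift2 bb).
Qed.

Lemma env_mul_pr2 a b c d : env_mul (pr2 a b) (pr2 c d) = pr2 (a * c) (d * b).
Proof.
have [bl br] := @bilin_pr2 _ A.
rewrite env_mul_pr2E -(tlift_pairs (b := fun x y => pr2 (a * x) (y * b))).
  rewrite (tlift_pr2 (b := fun x y => pr2 (a * x) (y * b))) //.
  split=> z e x y; first by rewrite lin_mull bl.
  by rewrite lin_mulr br.
split=> z e x y; first by rewrite lin_mull bl.
by rewrite lin_mulr br.
Qed.

Lemma env_ract_pr2 a b x :
  env_ract (pr2 a b) x = \sum_(p <- sw x) pr2 (a * p.1) (antipode p.2 * b).
Proof.
have [bl br] := @bilin_pr2 _ A.
rewrite /env_ract (tlift_pairsE (b := fun x y => pr2 x (antipode y))) //.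
  rewrite (lin_sum (lin_env_mulr a b)); apply: eq_bigr => p _.
  by rewrite env_mul_pr2.
by split=> z c y t; rewrite ?linearP ?bl ?br.
Qed.

Definition ind_tens M a b (q : M) : ind M := ind_pure (pr2 a b) q.

Lemma lin_ind_tens M :
  [/\ forall b q, linear (fun a => @ind_tens M a b q),
      forall a q, linear (fun b => @ind_tens M a b q) & forall a b, linear (@ind_tens M a b)].
Proof.
have [h1 h2 _] := @ind_pure_balanced _ _ M; have [bl br] := @bilin_pr2 _ A.
split=> [b q|a q|a b].
- exact: (lin_comp (h1 q) (bl b)).
- exact: (lin_comp (h1 q) (br a)).
- exact: h2.
Qed.

Lemma lin_ind_pure M (q : M) : linear (fun u => ind_pure u q).
Proof. by have [h1 h2 _] := @ind_pure_balanced _ _ M; apply: h1. Qed.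

Lemma ind_ext M U (f g : ind M -> U) : linear f -> linear g ->
  (forall a b q, f (ind_tens a b q) = g (ind_tens a b q)) -> f =1 g.
Proof.
move=> hf hg fg; apply: (umod_ext hf hg) => -[u q].
apply: (tpow2_ext (f := fun u => f (ind_pure u q)) (g := fun u => g (ind_pure u q))).
- exact: (lin_comp hf (lin_ind_pure q)).
- exact: (lin_comp hg (lin_ind_pure q)).
- by move=> a b; apply: fg.
Qed.

Lemma ind_tens_act M a b x (q : M) :
  ind_tens a b (opact x q) = \sum_(p <- sw x) ind_tens (a * p.1) (antipode p.2 * b) q.
Proof.
have [_ _ h] := @ind_pure_balanced _ _ M.
by rewrite /ind_tens -h /= env_ract_pr2 (lin_sum (lin_ind_pure q)).
Qed.

Definition balanced_trilin M U (gamma : A -> A -> M -> U) : Prop :=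
  [/\ forall q, bilin (fun a b => gamma a b q), forall a b, linear (gamma a b) &
      forall a b x q, \sum_(p <- sw x) gamma (a * p.1) (antipode p.2 * b) q
                      = gamma a b (opact x q)].

Definition indlift M U (gamma : A -> A -> M -> U) : ind M -> U :=
  ulift (fun p : tpow A 2 * M => tlift (fun t : 2.-tuple A => gamma t`_0 t`_1 p.2) p.1).

Lemma balanced_indlift M U (gamma : A -> A -> M -> U) : balanced_trilin gamma ->
  balanced (fun p : tpow A 2 * M => tlift (fun t : 2.-tuple A => gamma t`_0 t`_1 p.2) p.1).
Proof.
move=> [h1 h2 h3]; split=> /= [q|u|u x q].
- exact: (lin_tlift2 (h1 q)).
- move=> c q r; rewrite !(tlift_pairs _ (h1 _)).
  by rewrite scaler_sumr -big_split; apply: eq_bigr => p _; rewrite h2.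
- have l1 : linear (fun u => tlift (fun t : 2.-tuple A => gamma t`_0 t`_1 q) (env_ract u x)).
    by apply: (lin_comp (lin_tlift2 (h1 q))); apply: lin_env_mull.
  have l2 := lin_tlift2 (h1 (opact x q)).
  move: u; apply: (tpow2_ext l1 l2) => a b; rewrite (tlift_pr2 _ _ (h1 _)) env_ract_pr2.
  rewrite (lin_sum (lin_tlift2 (h1 q))) -h3; apply: eq_bigr => p _.
  by rewrite (tlift_pr2 _ _ (h1 q)).
Qed.

Lemma lin_indlift M U (gamma : A -> A -> M -> U) : balanced_trilin gamma -> linear (indlift gamma).
Proof. by move=> /balanced_indlift h; apply: ulift_linear. Qed.

Lemma indliftE M U (gamma : A -> A -> M -> U) a b q : balanced_trilin gamma ->
  indlift gamma (ind_tens a b q) = gamma a b q.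
Proof.
move=> h; have [h1 _ _] := h; rewrite /indlift /ind_tens /ind_pure ulift_pure.
  by rewrite (tlift_pr2 _ _ (h1 q)).
exact: balanced_indlift.
Qed.

Lemma balanced_ind_act M a b : balanced_trilin (fun x y (q : M) => ind_tens (a * x) (y * b) q).
Proof.
have [h1 h2 h3] := lin_ind_tens M; split=> [q|x y|x y z q].
- split=> z; first exact: (lin_comp (h1 _ q) (lin_mull a)).
  exact: (lin_comp (h2 _ q) (lin_mulr b)).
- exact: h3.
- by rewrite ind_tens_act; apply: eq_bigr => p _; rewrite !mulrA.
Qed.

Lemma ind_actE M a b :
  opact (o := ind M) (a, b) = indlift (fun x y (q : M) => ind_tens (a * x) (y * b) q).
Proof.
apply/funext => u; congr ulift; apply/funext => -[v q] /=.
rewrite -[tens _]/(pr2 a b) env_mul_pr2E (lin_sum (lin_ind_pure q)).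
rewrite (tlift_pairsE (b := fun x y => ind_tens (a * x) (y * b) q)) //.
by have [h1 _ _] := balanced_ind_act M a b.
Qed.

Lemma lin_ind_act M ab : linear (opact (o := ind M) ab).
Proof. by case: ab => a b; rewrite ind_actE; apply/lin_indlift/balanced_ind_act. Qed.

Lemma ind_act M a b x y (q : M) :
  opact (o := ind M) (a, b) (ind_tens x y q) = ind_tens (a * x) (y * b) q.
Proof. by rewrite ind_actE indliftE //; apply: balanced_ind_act. Qed.

(** An [opmod] over A * A records the action of pure tensors only; bilinearity is what allows
    bimodule maps on the bar resolution to be defined on generators. *)
Lemma bilin_ind_act M (z : ind M) : bilin (fun a b => opact (o := ind M) (a, b) z).
Proof.
have [h1 h2 h3] := lin_ind_tens M.
have lincomb (V W : lmodType k) (f g : V -> W) (c : k) :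
    linear f -> linear g -> linear (fun y => c *: f y + g y).
  move=> hf hg d x y; rewrite hf hg !scalerDr !scalerA mulrC.
  by rewrite -!addrA; congr (_ + _); rewrite addrCA.
split=> b c x y; move: z.
  apply: (ind_ext (@lin_ind_act M (_, _)) (lincomb _ _ _ _ c (@lin_ind_act M (_, _))
    (@lin_ind_act M (_, _)))) => a' b' q.
  by rewrite !ind_act mulrDl -scalerAl h1.
apply: (ind_ext (@lin_ind_act M (_, _)) (lincomb _ _ _ _ c (@lin_ind_act M (_, _))
  (@lin_ind_act M (_, _)))) => a' b' q.
by rewrite !ind_act mulrDr -scalerAr h2.
Qed.

Lemma ind_actM M a b a' b' (z : ind M) :
  opact (o := ind M) (a, b) (opact (o := ind M) (a', b') z)
  = opact (o := ind M) (a * a', b' * b) z.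
Proof.
move: z; apply: ind_ext.
- exact: (lin_comp (@lin_ind_act M (a, b)) (@lin_ind_act M (a', b'))).
- exact: lin_ind_act.
- by move=> x y q; rewrite !ind_act !mulrA.
Qed.

Lemma balanced_ind_map M (N : opmod k A) (phi : M -> N) : ophom phi ->
  balanced (fun p : tpow A 2 * M => ind_pure p.1 (phi p.2)).
Proof.
move=> [lphi aphi]; have [h1 h2 h3] := @ind_pure_balanced _ _ N.
split=> [q|u|u a q] /=.
- exact: h1.
- exact: (lin_comp (h2 u) lphi).
- by rewrite aphi -(h3 u a).
Qed.

Lemma lin_ind_map M (N : opmod k A) (phi : M -> N) : ophom phi -> linear (ind_map phi).
Proof. by move=> /balanced_ind_map h; apply: ulift_linear. Qed.

Lemma ind_map_pure M (N : opmod k A) (phi : M -> N) a b q : ophom phi ->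
  ind_map phi (ind_tens a b q) = ind_tens a b (phi q).
Proof. by move=> /balanced_ind_map h; rewrite /ind_map /ind_tens /ind_pure ulift_pure. Qed.

Lemma ophom_ind_map M (N : opmod k A) (phi : M -> N) : ophom phi -> ophom (ind_map phi).
Proof.
move=> ophi; have l := lin_ind_map ophi; split=> // -[a b].
apply: ind_ext (lin_comp l (@lin_ind_act M (a, b))) (lin_comp (@lin_ind_act N (a, b)) l) _.
by move=> x y q; rewrite !(ind_act, ind_map_pure).
Qed.

(** The module laws, which [opmod] does not contain. *)
Definition is_action M : Prop :=
  [/\ forall q, linear (fun a => opact (o := M) a q), forall a, linear (opact (o := M) a),
      forall q, opact (o := M) 1 q = q &
      forall a b q, opact (o := M) a (opact b q) = opact (o := M) (a * b) q].

(** Balancing moves x_1 back from q into A^e, where S(x_2) x_3 contracts to the counit. For a = 1 it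
    follows that the tensors with first factor 1 span the induced module. *)
Lemma ind_tens_absorb M a b x (q : M) : is_action M ->
  \sum_(p <- sw x) ind_tens a (p.2 * b) (opact p.1 q) = ind_tens (a * x) b q.
Proof.
move=> [l1 l2 _ _]; have [h1 h2 h3] := lin_ind_tens M.
under eq_bigr => p _ do rewrite ind_tens_act.
rewrite (sw_coassoc (t := fun x y z => ind_tens (a * x) (antipode y * (z * b)) q)); last first.
  split=> y z.
  - exact: (lin_comp (h1 _ q) (lin_mull a)).
  - exact: (lin_comp (h2 _ q) (lin_comp (lin_mulr _) (@antipode_lin _ A))).
  - exact: (lin_comp (h2 _ q) (lin_comp (lin_mull _) (lin_mulr b))).
rewrite -(counit_sw_r x (f := fun z => ind_tens (a * z) b q)); last first.
  exact: (lin_comp (h1 b q) (lin_mull a)).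
apply: eq_bigr => p _.
transitivity (ind_tens (a * p.1) ((\sum_(t <- sw p.2) antipode t.1 * t.2) * b) q).
  rewrite mulr_suml (lin_sum (h2 _ q)); apply: eq_bigr => t _.
  by rewrite mulrA.
by rewrite sw_antipodel -scalerAl mul1r (linZ (h2 _ q)).
Qed.

(* The extension to A^e (x)_A M of a linear map sigma, which need not be      *)
(* A-linear; it turns contracting homotopies into contracting homotopies.     *)
Definition ind_contraction M (N : opmod k A) (sigma : M -> N) : ind M -> ind N :=
  indlift (fun a b q => \sum_(p <- sw a) ind_tens 1 (p.2 * b) (sigma (opact p.1 q))).

(** The balancing condition holds because x_2 S(x_3) contracts to the counit after regrouping. *)
Lemma balanced_ind_contraction M (N : opmod k A) (sigma : M -> N) : is_action M -> linear sigma ->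
  balanced_trilin (fun a b q => \sum_(p <- sw a) ind_tens 1 (p.2 * b) (sigma (opact p.1 q))).
Proof.
move=> [l1 l2 act1 actM] ls; have [h1 h2 h3] := lin_ind_tens N.
have bil b q : bilin (fun x y => ind_tens 1 (y * b) (sigma (opact x q))).
  split=> z; first exact: (lin_comp (h3 1 _) (lin_comp ls (l1 q))).
  exact: (lin_comp (h2 1 _) (lin_mulr b)).
split=> [q|a b|a b x q].
- split=> [b|a]; first exact: (lin_sw (bil b q)).
  by apply: lin_bigsum => p; apply: (lin_comp (h2 1 _) (lin_mull _)).
- apply: lin_bigsum => p; apply: (lin_comp (h3 1 _) (lin_comp ls (l2 _))).
- under eq_bigr => p _ do rewrite (swM _ _ (bil _ q)).
  rewrite exchange_big; apply: eq_bigr => r _ /=.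
  rewrite (sw_coassoc (t := fun t1 t2 p2 =>
    ind_tens 1 (r.2 * t2 * (antipode p2 * b)) (sigma (opact (r.1 * t1) q)))); last first.
    split=> y z.
    + exact: (lin_comp (h3 1 _) (lin_comp ls (lin_comp (l1 q) (lin_mull _)))).
    + exact: (lin_comp (h2 1 _) (lin_comp (lin_mulr _) (lin_mull _))).
    + exact: (lin_comp (h2 1 _) (lin_comp (lin_mull _)
        (lin_comp (lin_mulr b) (@antipode_lin _ A)))).
  rewrite actM -(counit_sw_r x (f := fun y => ind_tens 1 (r.2 * b) (sigma (opact (r.1 * y) q)))).
    apply: eq_bigr => p _.
    transitivity (ind_tens 1 (r.2 * (\sum_(t <- sw p.2) t.1 * antipode t.2) * b)
                    (sigma (opact (r.1 * p.1) q))).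
      rewrite mulr_sumr mulr_suml (lin_sum (h2 1 _)); apply: eq_bigr => t _.
      by rewrite !mulrA.
    by rewrite sw_antipoder -scalerAr mulr1 -scalerAl (linZ (h2 1 _)).
  exact: (lin_comp (h3 1 _) (lin_comp ls (lin_comp (l1 q) (lin_mull _)))).
Qed.

Lemma lin_ind_contraction M (N : opmod k A) (sigma : M -> N) :
  is_action M -> linear sigma -> linear (ind_contraction sigma).
Proof. by move=> aM ls; apply/lin_indlift/balanced_ind_contraction. Qed.

(** After [ind_tens_absorb] has brought a tensor to first factor 1, the homotopy identity is the
    given one in the module factor. *)
Lemma ind_contract M (N L : opmod k A) (sigma : M -> N) (d : N -> M)
    (d' : M -> L) (sigma' : L -> M) :
  is_action M -> is_action L -> linear sigma -> linear sigma' -> ophom d -> ophom d' ->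
  (forall q, d (sigma q) + sigma' (d' q) = q) ->
  forall z, ind_map d (ind_contraction sigma z) + ind_contraction sigma' (ind_map d' z) = z.
Proof.
move=> aM aL ls ls' od od' hom.
have g := balanced_ind_contraction aM ls; have g' := balanced_ind_contraction aL ls'.
have lg : linear (fun z => ind_map d (ind_contraction sigma z)).
  exact: (lin_comp (lin_ind_map od) (lin_indlift g)).
have lg' : linear (fun z => ind_contraction sigma' (ind_map d' z)).
  exact: (lin_comp (lin_indlift g') (lin_ind_map od')).
apply: (ind_ext (f := fun z => ind_map d (ind_contraction sigma z) + ind_contraction sigma' (ind_map d' z))
  (g := fun z => z)) => [c z t|//|a b q].
  by rewrite lg lg' scalerDr addrACA.
rewrite ind_map_pure // /ind_contraction !indliftE // (lin_sum (lin_ind_map od)) -big_split /=.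
rewrite -[in RHS](mul1r a) -ind_tens_absorb //; apply: eq_bigr => p _.
have [_ _ h3] := lin_ind_tens M.
by rewrite ind_map_pure // -(proj2 od') -(linD (h3 _ _)) hom.
Qed.

End Induction.

(** * Exactness of the induced resolution and comparison maps *)

Section Comparison.
Variables (k : fieldType) (A : hopfAlgType k).
Implicit Types (U : lmodType k) (s u v : seq A) (m n : nat) (a b c : A).

Lemma lin_id U : linear (fun z : U => z).
Proof. by move=> c x y. Qed.

Lemma is_action_trivial : is_action (trivial_mod A).
Proof.
split=> [q|a|q|a b q] /=.
- by move=> c x y; rewrite linearP mulrDl scalerAl.
- by move=> c x y; rewrite mulrDr scalerAr.
- by rewrite rmorph1 mul1r.
- by rewrite rmorphM mulrA.
Qed.

Lemma is_action_barP n : is_action (barP A n).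
Proof.
have [h1 h2] := @bilinP_tn _ A n.
split=> [q|a|q|a b q].
- move=> c x y; move: q; apply: barP_ext.
  + exact: lin_barP_act.
  + move=> d z t; rewrite !(@lin_barP_act _ _ _ _ d z t) !scalerDr !scalerA mulrC.
    by rewrite addrACA.
  + by move=> a s _; rewrite !barP_act mulrDl -scalerAl h1.
- exact: lin_barP_act.
- move: q; apply: barP_ext; [exact: lin_barP_act | exact: lin_id|].
  by move=> a s _; rewrite barP_act mul1r.
- move: q; apply: barP_ext.
  + exact: (lin_comp (@lin_barP_act _ _ n a) (@lin_barP_act _ _ n b)).
  + exact: lin_barP_act.
  + by move=> x s _; rewrite !barP_act mulrA.
Qed.

Lemma barP_dif_cons n (x : A) c s t e : size s = n -> c :: s = rcons t e ->
  @cdif _ _ (barP A) n (tn n.+2 (x :: c :: s))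
  = tn n.+1 (x * c :: s) - dmul (fun r => tn n.+1 (x :: r)) (c :: s)
    - (-1) ^+ n *: (counit e *: tn n.+1 (x :: t)).
Proof.
move=> sz E; have szt : size t = n.
  by have := congr1 size E; rewrite /= size_rcons sz => -[].
rewrite E -rcons_cons barP_dif_tn /= ?szt // exprS mulN1r scaleNr.
by rewrite -E dmul_cons.
Qed.

Lemma ophom_barP_dif n : ophom (@cdif _ _ (barP A) n).
Proof.
have ld := @lin_barP_dif _ A n; split=> // a.
have la p := @lin_barP_act _ A p a.
apply: barP_ext (lin_comp ld (la n.+1)) (lin_comp (la n) ld) _ => x s.
case: s => // c s [sz]; case/lastP E: (c :: s) => [|t e] //; rewrite -E.
rewrite barP_act !(barP_dif_cons _ sz E) 2!(linB (la n)) 2!(linZ (la n)) !barP_act mulrA.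
rewrite (@dmul_lin k A (tpow A n.+1) (tpow A n.+1) _ _ _ (la n)); congr (_ - _ - _).
by apply: eq_dmul => r; rewrite barP_act.
Qed.

(** The standard contracting homotopy of the bar resolution of k; it is only k-linear. *)
Definition barP_contraction n : barP A n -> barP A n.+1 :=
  tlift (fun t : n.+1.-tuple A => tn n.+2 (1 :: t)).

Lemma mlin_tn1 n : mlin (fun s => tn n.+1 ((1 : A) :: s)).
Proof. exact: (mlin_cons 1 (@mlin_tn _ _ _)). Qed.

Lemma lin_barP_contraction n : linear (@barP_contraction n).
Proof. exact: (lin_tlift (@mlin_tn1 n.+1)). Qed.

Lemma barP_contraction_tn n s : barP_contraction (tn n.+1 s) = tn n.+2 (1 :: s).
Proof.
have [sz|sz] := eqVneq (size s) n.+1.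
  by rewrite /barP_contraction (tlift_tn (@mlin_tn1 n.+1)).
by rewrite !tn_size ?(lin0 (@lin_barP_contraction n)).
Qed.

Definition barP_unit : trivial_mod A -> barP A 0 := fun c : k^o => c *: tn 1 [:: 1 : A].

Lemma lin_barP_unit : linear barP_unit.
Proof. by move=> c x y; rewrite /barP_unit scalerDl scalerA. Qed.

Lemma barP_augE :
  @barP_aug _ A = tlift (fun t : 1.-tuple A => counit (\prod_(y <- t) y)).
Proof.
apply/funext => u; apply: eq_tlift => t; case: t => -[|x [|]] // sz.
by rewrite big_seq1.
Qed.

Lemma mlin_barP_aug : mlin (fun s => counit (\prod_(y <- s) y) : k^o).
Proof. exact: (mlin_comp (@counit_lin _ A) (@mlin_prod _ A)). Qed.

Lemma barP_aug_tn (x : A) : barP_aug (tn 1 [:: x]) = counit x.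
Proof. by rewrite barP_augE (tlift_tn mlin_barP_aug) // big_seq1. Qed.

Lemma ophom_barP_aug : ophom (@barP_aug _ A).
Proof.
have l : linear (@barP_aug _ A) by rewrite barP_augE; apply: lin_tlift mlin_barP_aug.
split=> // a; have la := @lin_barP_act _ A 0 a; have [_ lt _ _] := is_action_trivial.
apply: barP_ext (lin_comp l la) (lin_comp (lt a) l) _ => x [|//] _.
by rewrite barP_act !barP_aug_tn rmorphM.
Qed.

Lemma barP_contractionE n (q : barP A n.+1) :
  @cdif _ _ (barP A) n.+1 (barP_contraction q) + barP_contraction (@cdif _ _ (barP A) n q) = q.
Proof.
have ld p := @lin_barP_dif _ A p; have ls p := @lin_barP_contraction p.
move: q; apply: barP_ext => [c y z||x s sz].
- by rewrite ls (ld n.+1) (ld n) ls scalerDr addrACA.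
- exact: lin_id.
have [c [s' Es]] : exists c s', s = c :: s' by case: s sz => // c s' _; exists c, s'.
rewrite Es; rewrite {}Es in sz; case: sz => sz.
case/lastP E: (c :: s') => [|t e] //.
have E' : x :: c :: s' = rcons (x :: t) e by rewrite E.
have sz1 : size (c :: s') = n.+1 by rewrite /= sz.
rewrite -E barP_contraction_tn (barP_dif_cons 1 sz1 E') mul1r (barP_dif_cons _ sz E).
rewrite 2!(linB (ls n)) 2!(linZ (ls n)) !barP_contraction_tn exprS mulN1r scaleNr opprK.
rewrite dmul_cons (@dmul_lin k A (tpow A n.+1) (tpow A n.+2) _ _ _ (ls n)).
rewrite [dmul (fun r => barP_contraction _) _](_ : _ =
  dmul (fun r => tn n.+2 (1 :: x :: r)) (c :: s')); last first.
  by apply: eq_dmul => r; rewrite barP_contraction_tn.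
by rewrite -addrA [X in _ + X]addrC subrK subrK.
Qed.

Lemma barP_contractionE0 (q : barP A 0) :
  @cdif _ _ (barP A) 0 (barP_contraction q) + barP_unit (barP_aug q) = q.
Proof.
have ld p := @lin_barP_dif _ A p; have ls p := @lin_barP_contraction p.
have [la _] := ophom_barP_aug.
move: q; apply: barP_ext => [c y z||x [|//] _].
- by rewrite ls (ld 0) la lin_barP_unit scalerDr addrACA.
- exact: lin_id.
rewrite barP_contraction_tn (@barP_dif_cons 0 1 x [::] [::] x) // mul1r dmul1; last first.
  exact: mlin_tn1.
by rewrite subr0 expr0 scale1r barP_aug_tn /barP_unit subrK.
Qed.

Lemma indP_exact n (z : indP A n.+1) : @cdif _ _ (indP A) n z = 0 ->
  @cdif _ _ (indP A) n.+1 (ind_contraction (@barP_contraction n.+1) z) = z.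
Proof.
move=> dz; have := ind_contract (is_action_barP n.+1) (is_action_barP n)
  (@lin_barP_contraction n.+1) (@lin_barP_contraction n) (ophom_barP_dif n.+1) (ophom_barP_dif n)
  (@barP_contractionE n) z.
rewrite (_ : ind_map _ z = 0) // (lin0 (lin_ind_contraction (is_action_barP n) (@lin_barP_contraction n))).
by rewrite addr0.
Qed.

Lemma indP_exact0 (z : indP A 0) :
  ind_map (N := trivial_mod A) (@barP_aug _ A) z = 0 ->
  @cdif _ _ (indP A) 0 (ind_contraction (@barP_contraction 0) z) = z.
Proof.
move=> dz; have := ind_contract (is_action_barP 0) is_action_trivial
  (@lin_barP_contraction 0) lin_barP_unit (ophom_barP_dif 0) ophom_barP_aug barP_contractionE0 z.
by rewrite dz (lin0 (lin_ind_contraction is_action_trivial lin_barP_unit)) addr0.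
Qed.

Lemma dmul_dmul U (phi : seq A -> U) s : mlin phi -> dmul (dmul phi) s = 0.
Proof.
elim: s phi => [|a s IH] phi h.
  by rewrite dmul0 //; apply: mlin_dmul.
case: s IH => [|b s] IH; first by rewrite dmul1 //; apply: mlin_dmul.
rewrite dmul_cons.
(* [head] and [behead] express the first product as a function of r; their values on the empty list
   are never reached, since [dmul] evaluates at nonempty lists. *)
have E : dmul (fun r => dmul phi (a :: r)) (b :: s)
    = dmul (fun r => phi (a * head 0 r :: behead r)) (b :: s)
      - dmul (dmul (fun r => phi (a :: r))) (b :: s).
  have := ins_phiB 2 (-1) (@mul2 k A) 1 (fun r => phi (a * head 0 r :: behead r))
    (dmul (fun r => phi (a :: r))) (b :: s).
  rewrite scale1r -!/(dmul _ _) => <-; rewrite /dmul; apply: eq_ins_size => -[|c r] // _.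
  by rewrite -/(dmul phi _) dmul_cons scale1r.
rewrite E IH ?subr0; last exact: mlin_cons.
case: s {IH E} => [|c s].
  rewrite !dmul1 ?subrr // => -[|y s1] s2 c x z /=; last first.
    exact: (mlin_cons (a * y) h).
  by rewrite mulrDr -scalerAr (mlin_hd s2 h).
by rewrite !dmul_cons /= mulrA subrr.
Qed.

Lemma barB_difK n (x : barB A n.+2) :
  @cdif _ _ (barB A) n (@cdif _ _ (barB A) n.+1 x) = 0.
Proof.
have ld p := @lin_barB_dif _ A p.
move: x; apply: (tpow_ext (lin_comp (ld n) (ld n.+1))) => [c y z|s sz].
  by rewrite scaler0 addr0.
rewrite barB_dif_tn (@dmul_lin k A (tpow A n.+3) (tpow A n.+2) _ _ _ (ld n)).
rewrite -[RHS](dmul_dmul s (@mlin_tn _ A n.+2)).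
by apply: eq_dmul => r; apply: barB_dif_tn.
Qed.

Definition ind_barB_lift M n (z : seq A -> ind M) : barB A n -> ind M :=
  barB_lift (fun a s b => opact (o := ind M) (a, b) (z s)).

Lemma trilinB_ind M (z : seq A -> ind M) : mlin z ->
  trilinB (fun a s b => opact (o := ind M) (a, b) (z s)).
Proof.
move=> h; split=> [s b|a b|a s].
- by have [h1 _] := bilin_ind_act (z s); apply: h1.
- exact: (mlin_comp (@lin_ind_act _ _ M (a, b)) h).
- by have [_ h2] := bilin_ind_act (z s); apply: h2.
Qed.

Lemma ind_barB_liftE M n (z : seq A -> ind M) a s b : mlin z -> size s = n ->
  @ind_barB_lift M n z (tn n.+2 (a :: rcons s b)) = opact (o := ind M) (a, b) (z s).
Proof. by move=> h sz; rewrite /ind_barB_lift barB_liftE //; apply: trilinB_ind. Qed.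

Lemma ophom_ind_barB_lift M n (z : seq A -> ind M) : mlin z -> ophom (@ind_barB_lift M n z).
Proof.
move=> h; have l : linear (@ind_barB_lift M n z) by apply: lin_barB_lift (trilinB_ind h).
split=> // -[a b].
apply: barB_ext (lin_comp l (@lin_barB_act _ A n (a, b)))
  (lin_comp (@lin_ind_act _ _ M (a, b)) l) _ => x s y sz.
by rewrite barB_act !ind_barB_liftE // ind_actM.
Qed.

Lemma ind_gen_ext M n (f g : barB A n -> ind M) : ophom f -> ophom g ->
  (forall s, size s = n ->
     f (tn n.+2 (1 :: rcons s 1)) = g (tn n.+2 (1 :: rcons s 1))) -> f =1 g.
Proof.
move=> [lf af] [lg ag] fg; apply: (barB_ext lf lg) => a s b sz.
have -> : tn n.+2 (a :: rcons s b)
    = opact (o := barB A n) (a, b) (tn n.+2 (1 :: rcons s 1)).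
  by rewrite barB_act mulr1 mul1r.
by rewrite af ag fg.
Qed.

(** By freeness it suffices to choose preimages of the generators, and sigma chooses them
    linearly. *)
Lemma lift_cycle M M' n (d : ind M' -> ind M) (sigma : ind M -> ind M')
    (z : barB A n -> ind M) :
  ophom d -> linear sigma -> ophom z -> (forall x, d (sigma (z x)) = z x) ->
  exists2 h : barB A n -> ind M', ophom h & forall x, d (h x) = z x.
Proof.
move=> od ls oz dz.
have lz : mlin (fun s => sigma (z (tn n.+2 (1 :: rcons s 1)))).
  apply: (mlin_comp ls); apply: (mlin_comp (proj1 oz)).
  exact: (mlin_rcons 1 (mlin_cons 1 (@mlin_tn _ _ _))).
have oh := ophom_ind_barB_lift n lz.
exists (@ind_barB_lift M' n (fun s => sigma (z (tn n.+2 (1 :: rcons s 1))))) => //.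
apply: ind_gen_ext => // [|s sz].
  split=> [|ab x]; first exact: (lin_comp (proj1 od) (proj1 oh)).
  by rewrite (proj2 oh) (proj2 od).
by rewrite ind_barB_liftE // (proj2 od) dz -(proj2 oz) barB_act !mulr1.
Qed.

Lemma ophom_indP_dif n : ophom (@cdif _ _ (indP A) n).
Proof. exact: ophom_ind_map (ophom_barP_dif n). Qed.

Section Homotopy.
Variables theta theta' : forall n, barB A n -> indP A n.
Hypotheses (c1 : comparison theta) (c2 : comparison theta').

Let tau n (x : barB A n) := @theta n x - @theta' n x.

Let ophom_tau n : ophom (@tau n).
Proof.
have [o1 _ _] := c1; have [o2 _ _] := c2.
exact: (@ophomB _ _ (barB A) (indP A n) (@lin_ind_act _ _ _) n).
Qed.

Let dif_tau n (x : barB A n.+1) :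
  @cdif _ _ (indP A) n (tau x) = tau (@cdif _ _ (barB A) n x).
Proof.
have [_ d1 _] := c1; have [_ d2 _] := c2.
by rewrite /tau (linB (proj1 (ophom_indP_dif n))) d1 d2.
Qed.

Lemma homotopy0 : exists2 h : barB A 0 -> indP A 1, ophom h &
  forall x, @cdif _ _ (indP A) 0 (h x) = @theta 0%N x - @theta' 0%N x.
Proof.
apply: (lift_cycle (sigma := ind_contraction (@barP_contraction 0)) (ophom_indP_dif 0) _ (ophom_tau 0)).
  exact: (lin_ind_contraction (is_action_barP 0) (@lin_barP_contraction 0)).
move=> x; apply: indP_exact0; have [_ _ a1] := c1; have [_ _ a2] := c2.
by rewrite /tau (linB (lin_ind_map ophom_barP_aug)) a1 a2 subrr.
Qed.

Let step n (l : barB A n -> indP A n.+1) : ophom l ->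
  (forall x : barB A n.+1, tau (@cdif _ _ (barB A) n x)
     = @cdif _ _ (indP A) n (l (@cdif _ _ (barB A) n x))) ->
  exists2 h : barB A n.+1 -> indP A n.+2, ophom h &
    forall x, @cdif _ _ (indP A) n.+1 (h x) = tau x - l (@cdif _ _ (barB A) n x).
Proof.
move=> ol lE; have [ld ad] := @ophom_barB_dif _ A n.
apply: (lift_cycle (z := fun x => tau x - l (@cdif _ _ (barB A) n x))
  (sigma := ind_contraction (@barP_contraction n.+1)) (ophom_indP_dif n.+1)).
- exact: (lin_ind_contraction (is_action_barP n.+1) (@lin_barP_contraction n.+1)).
- apply: (ophomB (C := barB A) (@lin_ind_act _ _ _) (ophom_tau n.+1)).
  by split=> [|ab x]; [exact: (lin_comp (proj1 ol) ld) | rewrite ad (proj2 ol)].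
- move=> x; apply: indP_exact.
  by rewrite (linB (proj1 (ophom_indP_dif n))) dif_tau lE subrr.
Qed.

(** Two consecutive components of a homotopy suffice for a statement about one degree, and they can
    be carried through the induction without building a dependent family. *)
Lemma homotopyS n : exists2 l : barB A n -> indP A n.+1, ophom l &
  exists2 h : barB A n.+1 -> indP A n.+2, ophom h & forall x,
    @cdif _ _ (indP A) n.+1 (h x)
    = @theta n.+1 x - @theta' n.+1 x - l (@cdif _ _ (barB A) n x).
Proof.
elim: n => [|n [l ol [h oh hE]]].
  have [l ol lE] := homotopy0; exists l => //; apply: step => // x.
exists h => //; apply: step => // x.
by rewrite hE barB_difK (lin0 (proj1 ol)) subr0.
Qed.

End Homotopy.

(* theta0 (a (x) c (x) b) = (a (x) c_2 b) (x)_A (1 (x) c_1), where c_2 is the       *)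
(* product of the second Sweedler components of the entries of c.                *)
Definition theta0 n : barB A n -> indP A n :=
  @ind_barB_lift (barP A n) n (fun s => swsum (fun u v =>
    @ind_tens _ _ (barP A n) 1 (\prod_(y <- v) y) (tn n.+1 (1 :: u))) s).

Lemma bmlin_theta0 n : bmlin (fun u v =>
  @ind_tens _ _ (barP A n) 1 (\prod_(y <- v) y) (tn n.+1 (1 :: u))).
Proof.
have [h1 h2 h3] := lin_ind_tens (barP A n); split=> u.
- exact: (mlin_comp (h3 1 _) (@mlin_tn1 n)).
- exact: (mlin_comp (h2 1 _) (@mlin_prod _ A)).
Qed.

Lemma theta0E n a s b :
  theta0 (tn n.+2 (a :: rcons s b)) = swsum (fun u v =>
    @ind_tens _ _ (barP A n) a (\prod_(y <- v) y * b) (tn n.+1 (1 :: u))) s.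
Proof.
have lz := mlin_swsum (bmlin_theta0 n).
have [sz|sz] := eqVneq (size s) n; last first.
  rewrite tn_size ?size_ends // [LHS](lin0 (proj1 (ophom_ind_barB_lift n lz))).
  rewrite (eq_swsum_size (chi' := fun _ _ => 0)) => [|u v su _].
    by rewrite /swsum big1.
  have [_ _ h3] := lin_ind_tens (barP A n).
  by rewrite tn_size ?(lin0 (h3 _ _)) //= su eqSS.
rewrite /theta0 ind_barB_liftE // (swsum_lin _ _ (@lin_ind_act _ _ _ (a, b))).
by apply: eq_swsum => u v; rewrite ind_act mulr1.
Qed.

(** Multiplying two neighbours commutes with splitting them, and does not change the product of the
    second components. *)
Lemma dmul_swsum U (psi : seq A -> A -> U) s :
  (forall y, mlin (psi^~ y)) -> (forall u, linear (psi u)) ->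
  dmul (swsum (fun u v => psi u (\prod_(y <- v) y))) s
  = swsum (fun u v => dmul (psi^~ (\prod_(y <- v) y)) u) s.
Proof.
have bm (chi : seq A -> A -> U) : (forall y, mlin (chi^~ y)) -> (forall u, linear (chi u)) ->
    bmlin (fun u v => chi u (\prod_(y <- v) y)).
  by move=> g1 g2; split=> v; [exact: g1 | exact: (mlin_comp (g2 _) (@mlin_prod _ A))].
elim: s psi => [|a s IH] psi h1 h2.
  by rewrite swsum_nil !dmul0 //; apply/mlin_swsum/bm.
case: s IH => [|b s] IH.
  rewrite dmul1; last exact/mlin_swsum/bm.
  by rewrite swsum_cons big1 // => x _; rewrite swsum_nil dmul1.
pose psi' (x : A * A) u y := psi (x.1 :: u) (x.2 * y).
have g1 x y : mlin (fun u => psi' x u y) by exact: (mlin_cons x.1 (h1 _)).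
have g2 x u : linear (psi' x u) by exact: (lin_comp (h2 _) (lin_mull x.2)).
have consE c r : swsum (fun u v => psi u (\prod_(y <- v) y)) (c :: r)
    = \sum_(x <- sw c) swsum (fun u v => psi' x u (\prod_(y <- v) y)) r.
  rewrite swsum_cons; apply: eq_bigr => x _; apply: eq_swsum => u v.
  by rewrite /psi' big_cons.
rewrite dmul_cons; under [X in _ - X]eq_dmul => r do rewrite consE.
have -> : dmul (fun r => \sum_(x <- sw a) swsum (fun u v => psi' x u (\prod_(y <- v) y)) r) (b :: s)
    = \sum_(x <- sw a) swsum (fun u v => dmul ((psi' x)^~ (\prod_(y <- v) y)) u) (b :: s).
  under [RHS]eq_bigr => x _ do rewrite -IH //.
  rewrite /dmul insE; under [RHS]eq_bigr => x _ do rewrite insE.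
  rewrite exchange_big; apply: eq_bigr => i _ /=.
  by rewrite -scaler_sumr.
rewrite consE (swM _ _ (b := fun x y => swsum (fun u v => psi' (x, y) u (\prod_(y <- v) y)) s)).
  rewrite -sumrB [RHS]swsum_cons; apply: eq_bigr => x _.
  rewrite swsum_cons -sumrB swsum_cons; apply: eq_bigr => y _.
  rewrite /swsum -sumrB; apply: eq_bigr => p _ /=.
  by rewrite dmul_cons !big_cons /psi' /= !mulrA.
split=> z; apply: lin_swsum => u v.
  exact: (mlin_hd u (h1 (z * \prod_(y <- v) y))).
exact: (lin_comp (h2 (z :: u)) (lin_mulr (\prod_(y <- v) y))).
Qed.

(** On a generator the two sides are matched term by term: the first outer term by
    [ind_tens_absorb], which lets the first entry pass to the A^e factor, the inner terms by
    [dmul_swsum], and the last outer term by the counit law for the last entry. The augmentation is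
    compared in the same way. *)
Lemma comparison_theta0 : comparison theta0.
Proof.
split=> [n|n|].
- exact: ophom_ind_barB_lift (mlin_swsum (bmlin_theta0 n)).
- have [od1 ad1] := @ophom_barB_dif _ A n; have [od2 ad2] := ophom_indP_dif n.
  have o p : ophom (@theta0 p) := ophom_ind_barB_lift p (mlin_swsum (bmlin_theta0 p)).
  apply: ind_gen_ext => [||s sz].
  + split=> [|ab x]; first exact: (lin_comp od2 (proj1 (o _))).
    by rewrite (proj2 (o _)) ad2.
  + split=> [|ab x]; first exact: (lin_comp (proj1 (o _)) od1).
    by rewrite ad1 (proj2 (o _)).
  rewrite barB_dif_tn (dmul_lin _ _ (proj1 (o n))) theta0E (swsum_lin _ _ od2).
  case: s sz => // c s [sz]; case/lastP E: (c :: s) => [|t e] //; rewrite -E.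
  have szt : size t = n by have := congr1 size E; rewrite /= size_rcons sz => -[].
  rewrite (dmul_ends _ _ _ E); last exact: (mlin_comp (proj1 (o n)) (@mlin_tn _ A n.+2)).
  have [h1 h2 h3] := lin_ind_tens (barP A n).
  pose p3 := @ind_tens _ _ (barP A n).
  (* The differential of 1 (x) u in the bar resolution of k, in three groups; [drop n u] consists of
     the last entry of u and [take n u] of the others. *)
  rewrite (eq_swsum_size (chi' := fun u v =>
      p3 1 (\prod_(y <- v) y) (tn n.+1 u)
      - p3 1 (\prod_(y <- v) y) (dmul (fun r => tn n.+1 (1 :: r)) u)
      - (-1) ^+ n *: (counit (\prod_(y <- drop n u) y) *:
          p3 1 (\prod_(y <- v) y) (tn n.+1 (1 :: take n u))))); last first.
    move=> u v szu _; rewrite mulr1 [cdif _]ind_map_pure; last exact: ophom_barP_dif.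
    case: u szu => // x u [szu]; rewrite sz in szu.
    case/lastP F: (x :: u) => [|w y] //.
    have szw : size w = n by have := congr1 size F; rewrite /= size_rcons szu => -[].
    rewrite take_rcons_size // drop_rcons_size // big_seq1 -F.
    rewrite (barP_dif_cons _ szu F) mul1r 2!(linB (h3 _ _)) 2!(linZ (h3 _ _)).
    by [].
  rewrite /swsum !sumrB -scaler_sumr mul1r mulr1 szt; congr (_ - _ - _ *: _).
  + rewrite -/(swsum (fun u v => p3 1 (\prod_(y <- v) y) (tn n.+1 u)) (c :: s)).
    rewrite theta0E swsum_cons -swsum_sum; apply: eq_swsum => u v.
    rewrite -[c in RHS]mul1r -(ind_tens_absorb _ _ _ _ (is_action_barP n)).
    by apply: eq_bigr => x _; rewrite big_cons barP_act !mulr1.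
  + rewrite -/(swsum (fun u v =>
      p3 1 (\prod_(y <- v) y) (dmul (fun r => tn n.+1 (1 :: r)) u)) (c :: s)).
    transitivity (dmul (swsum (fun u v => p3 1 (\prod_(y <- v) y) (tn n.+1 (1 :: u)))) (c :: s)).
      rewrite (dmul_swsum (psi := fun u y => p3 1 y (tn n.+1 (1 :: u)))).
      * by apply: eq_swsum => u v; rewrite -(dmul_lin _ _ (h3 _ _)).
      * by move=> y; exact: (mlin_comp (h3 1 y) (@mlin_tn1 n)).
      * by move=> u; apply: h2.
    by apply: eq_dmul => r; rewrite theta0E; apply: eq_swsum => u v; rewrite mulr1.
  + rewrite -/(swsum (fun u v => counit (\prod_(y <- drop n u) y) *:
      p3 1 (\prod_(y <- v) y) (tn n.+1 (1 :: take n u))) (c :: s)).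
    rewrite theta0E E -cats1 swsum_cat; apply: eq_swsum_size => u v szu _.
    rewrite swsum_cons.
    rewrite -(counit_sw_l e (f := fun y => @ind_tens _ _ (barP A n) 1 (\prod_(z <- v) z * y) (tn n.+1 (1 :: u)))).
      apply: eq_bigr => x _; rewrite swsum_nil big_cat big_seq1 /= cats1.
      by rewrite take_rcons_size ?szu // drop_rcons_size ?szu // big_seq1.
    exact: (lin_comp (h2 1 _) (lin_mull _)).
- have oa := ophom_ind_map ophom_barP_aug.
  have [h1 h2 h3] := lin_ind_tens (trivial_mod A).
  have augE : @barB_aug _ A = tlift (fun t : 2.-tuple A => mul2 t).
    by apply/funext => u; apply: eq_tlift => t; case: t => -[|x [|y [|]]].
  have la : linear (@barB_aug _ A) by rewrite augE; apply/lin_tlift/mlin_mul2.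
  have o0 : ophom (@theta0 0) := ophom_ind_barB_lift 0 (mlin_swsum (bmlin_theta0 0)).
  apply: (barB_ext (lin_comp (proj1 oa) (proj1 o0)) (lin_comp (h1 1 (1 : k^o)) la)) => a [|//] b _.
  rewrite theta0E swsum_nil big_nil mul1r augE tlift_tn //; last first.
    exact: mlin_mul2.
  rewrite ind_map_pure; last exact: ophom_barP_aug.
  rewrite barP_aug_tn rmorph1 /= -(ind_tens_absorb _ _ _ _ is_action_trivial).
  rewrite -[in LHS](counit_sw_l b (f := fun y => @ind_tens _ _ (trivial_mod A) a y (1 : k^o))); last exact: h2.
  apply: eq_bigr => x _; rewrite mulr1 /=.
  by rewrite -(linZ (h3 _ _)).
Qed.

End Comparison.

(** * Cochains with coefficients in the adjoint module *)

Section AdjointCochains.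
Variables (k : fieldType) (A : hopfAlgType k).
Implicit Types (U : lmodType k) (s u v : seq A) (m n : nat) (a b c : A).

Lemma bilin_adjoint b : bilin (fun x y : A => x * b * antipode y).
Proof.
split=> z; first exact: (lin_comp (lin_mulr _) (lin_mulr b)).
exact: (lin_comp (lin_mull _) (@antipode_lin _ A)).
Qed.

Lemma adjointE a b :
  opact (o := adjoint_mod A) a b = \sum_(p <- sw a) p.1 * b * antipode p.2.
Proof. exact: (tlift_pairs _ (bilin_adjoint b)). Qed.

Lemma adjoint_act_lin a : linear (opact (o := adjoint_mod A) a).
Proof.
move=> c x y; rewrite !adjointE.
apply: (@lin_bigsum _ _ _ _ (sw a) (fun p (z : A) => p.1 * z * antipode p.2)) => p.
exact: (lin_comp (lin_mulr _) (lin_mull _)).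
Qed.

Lemma adjoint_lin_act b : linear (fun a => opact (o := adjoint_mod A) a b).
Proof. by move=> c x y; rewrite !adjointE; apply: (lin_sw (bilin_adjoint b)). Qed.

Lemma adjointM a b x :
  opact (o := adjoint_mod A) (a * b) x
  = opact (o := adjoint_mod A) a (opact (o := adjoint_mod A) b x).
Proof.
rewrite !adjointE (swM _ _ (bilin_adjoint x)); apply: eq_bigr => p _.
rewrite mulr_sumr mulr_suml; apply: eq_bigr => q _.
by rewrite antipodeM !mulrA.
Qed.

Lemma adjoint1 x : opact (o := adjoint_mod A) 1 x = x.
Proof.
have := sw_antipoder (1 : A); rewrite rmorph1 scale1r.
rewrite (sw1 (b := fun y z : A => y * antipode z)).
  by rewrite mul1r => S1; rewrite adjointE (sw1 (bilin_adjoint x)) mul1r S1 mulr1.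
split=> z; first exact: lin_mulr.
exact: (lin_comp (lin_mull _) (@antipode_lin _ A)).
Qed.

(** This is the A-linearity of the counit from A^ad to k; it rests on [counit_antipode]. *)
Lemma counit_adjoint a b :
  counit (opact (o := adjoint_mod A) a b : A) = counit a * counit b :> k^o.
Proof.
rewrite adjointE (lin_sum (@counit_lin _ A)).
rewrite -[in RHS](counit_sw_l a (@lin_id _ A)) (lin_sum (@counit_lin _ A)) mulr_suml.
apply: eq_bigr => p _; rewrite !rmorphM (linZ (@counit_lin _ A)).
by rewrite mulrAC; congr (_ * _); apply: (congr1 _ (counit_antipode p.2)).
Qed.

(** Balancing is the linearity of f for the adjoint action: sum a x_1 f(q) S(x_2) b = a f(x q) b. *)
Lemma balanced_es n (f : barP A n -> adjoint_mod A) : ophom f ->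
  balanced_trilin (fun a b (q : barP A n) => a * (f q : A) * b).
Proof.
move=> [lf af]; split=> [q|a b|a b x q].
- split=> z; first exact: (lin_comp (lin_mulr z) (lin_mulr _)).
  exact: lin_mull.
- exact: (lin_comp (lin_mulr b) (lin_comp (lin_mull a) lf)).
- rewrite af adjointE mulr_sumr mulr_suml; apply: eq_bigr => p _.
  by rewrite !mulrA.
Qed.

Lemma es_ind_tens n (f : barP A n -> adjoint_mod A) a b q : ophom f ->
  eckmann_shapiro f (ind_tens a b q) = a * (f q : A) * b.
Proof. by move=> /balanced_es h; exact: (indliftE a b q h). Qed.

Lemma lin_es n (f : barP A n -> adjoint_mod A) : ophom f -> linear (eckmann_shapiro f).
Proof. by move=> /balanced_es h; exact: (lin_indlift h). Qed.

Lemma ophom_es n (f : barP A n -> adjoint_mod A) : ophom f -> ophom (eckmann_shapiro f).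
Proof.
move=> of_; have l := lin_es of_; split=> // -[a b].
have l1 := lin_comp l (@lin_ind_act _ _ (barP A n) (a, b)).
have l2 : linear (fun z => opact (o := bimod A) (a, b) (eckmann_shapiro f z)).
  exact: (lin_comp (@bimod_act_lin _ A (a, b)) l).
apply: (ind_ext l1 l2) => x y q.
by rewrite ind_act !es_ind_tens //= !mulrA.
Qed.

Lemma es_dif n (f : barP A n -> adjoint_mod A) z : ophom f ->
  eckmann_shapiro f (@cdif _ _ (indP A) n z)
  = eckmann_shapiro (fun x => f (@cdif _ _ (barP A) n x)) z.
Proof.
move=> of_; have [ld ad] := @ophom_barP_dif _ A n.
have od : ophom (fun x : barP A n.+1 => f (@cdif _ _ (barP A) n x)).
  by split=> [|a x]; [exact: (lin_comp (proj1 of_) ld) | rewrite ad (proj2 of_)].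
move: z; apply: ind_ext (lin_comp (lin_es of_) (proj1 (@ophom_indP_dif _ A n))) (lin_es od) _.
by move=> a b q; rewrite es_ind_tens // [cdif _]ind_map_pure ?es_ind_tens.
Qed.

Lemma es_cocycle n (f : barP A n -> adjoint_mod A) z : cocycle f ->
  eckmann_shapiro f (@cdif _ _ (indP A) n z) = 0.
Proof.
move=> [of_ df]; rewrite es_dif //.
rewrite (_ : (fun x => _) = fun=> 0); last exact/funext.
have o0 := @ophom0 _ _ (barP A) (adjoint_mod A) adjoint_act_lin n.+1.
have l0 : linear (fun _ : ind (barP A n.+1) => 0 : A).
  by move=> c x y; rewrite scaler0 addr0.
move: z; apply: (ind_ext (lin_es o0) l0) => a b q.
by rewrite es_ind_tens // mulr0 mul0r.
Qed.

Lemma esB n (f g : barP A n -> adjoint_mod A) z : ophom f -> ophom g ->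
  eckmann_shapiro (fun x => f x - g x) z = eckmann_shapiro f z - eckmann_shapiro g z.
Proof.
move=> of_ og; have o := ophomB adjoint_act_lin of_ og.
have l : linear (fun z => eckmann_shapiro f z - eckmann_shapiro g z).
  by move=> c x y; rewrite (lin_es of_) (lin_es og) scalerBr opprD addrACA.
move: z; apply: (ind_ext (lin_es o) l) => a b q.
by rewrite !es_ind_tens // mulrBr mulrBl.
Qed.

Definition ad_ext n (phi : seq A -> A) : barP A n -> adjoint_mod A :=
  barP_lift (fun a s => opact (o := adjoint_mod A) a (phi s)).

Lemma bilinP_ad_ext phi : mlin phi ->
  bilinP (fun a s => opact (o := adjoint_mod A) a (phi s)).
Proof.
move=> h; split=> [s|a]; first exact: adjoint_lin_act.
exact: (mlin_comp (adjoint_act_lin a) h).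
Qed.

Lemma ad_extE n phi a s : mlin phi -> size s = n ->
  @ad_ext n phi (tn n.+1 (a :: s)) = opact (o := adjoint_mod A) a (phi s).
Proof. by move=> h sz; rewrite /ad_ext (barP_liftE _ (bilinP_ad_ext h)). Qed.

Lemma ophom_ad_ext n phi : mlin phi -> ophom (@ad_ext n phi).
Proof.
move=> h; have l : linear (@ad_ext n phi) := lin_barP_lift (bilinP_ad_ext h).
split=> // a; have l1 := lin_comp l (@lin_barP_act _ A n a).
apply: (barP_ext l1 (lin_comp (adjoint_act_lin a) l)) => b s sz.
by rewrite barP_act !ad_extE // adjointM.
Qed.

Definition hatP n (N : opmod k A) (f : barP A n -> N) s : N := f (tn n.+1 (1 :: s)).

Lemma mlin_hatP n (N : opmod k A) (f : barP A n -> N) : linear f -> mlin (hatP f).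
Proof. by move=> l; apply: (mlin_comp l (@mlin_tn1 _ A n)). Qed.

Lemma adP_ext n (f g : barP A n -> adjoint_mod A) : ophom f -> ophom g ->
  (forall s, size s = n -> hatP f s = hatP g s) -> f =1 g.
Proof.
move=> [lf af] [lg ag] fg; apply: (barP_ext lf lg) => a s sz.
have -> : tn n.+1 (a :: s) = opact (o := barP A n) a (tn n.+1 (1 :: s)).
  by rewrite barP_act mulr1.
by rewrite af ag; congr opact; apply: fg.
Qed.

(* The cochain isomorphism Hom_A(P_n, A^ad) ~ Hom_{A^e}(B_n, A). *)
Definition ad_bar n (f : barP A n -> adjoint_mod A) : barB A n -> bimod A :=
  fun x => eckmann_shapiro f (theta0 x).

Lemma ophom_theta0 n : ophom (@theta0 _ A n).
Proof. by have [h _ _] := @comparison_theta0 _ A; apply: h. Qed.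

Lemma ophom_ad_bar n (f : barP A n -> adjoint_mod A) : ophom f -> ophom (ad_bar f).
Proof.
move=> of_; have [l a] := ophom_es of_; have [lt at_] := @ophom_theta0 n.
by split=> [|ab x]; [exact: (lin_comp l lt) | rewrite /ad_bar at_ a].
Qed.

Lemma hat_ad_bar n (f : barP A n -> adjoint_mod A) s : ophom f ->
  hat (ad_bar f) s = swsum (fun u v => (hatP f u : A) * \prod_(y <- v) y) s.
Proof.
move=> of_; rewrite /hat /ad_bar theta0E (swsum_lin _ _ (lin_es of_)).
by apply: eq_swsum => u v; rewrite es_ind_tens // mul1r mulr1.
Qed.

Lemma ad_bar_dif n (f : barP A n -> adjoint_mod A) x : ophom f ->
  ad_bar (fun y => f (@cdif _ _ (barP A) n y)) x
  = ad_bar f (@cdif _ _ (barB A) n x).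
Proof.
move=> of_; rewrite /ad_bar -es_dif //; congr eckmann_shapiro.
by have [_ h _] := @comparison_theta0 _ A; rewrite h.
Qed.

Lemma bmlin_prod (phi : seq A -> A) (f : A -> A) : mlin phi -> linear f ->
  bmlin (fun u v => phi u * f (\prod_(y <- v) y)).
Proof.
move=> h lf; split=> u; first exact: (mlin_comp (lin_mulr _) h).
exact: (mlin_comp (lin_mull _) (mlin_comp lf (@mlin_prod _ A))).
Qed.

Lemma tmlin_prod2 (phi : seq A -> A) (f g : A -> A) : mlin phi -> linear f -> linear g ->
  tmlin (fun u v w => phi u * f (\prod_(y <- v) y) * g (\prod_(y <- w) y)).
Proof.
move=> h lf lg; split=> u v.
- exact: (mlin_comp (lin_mulr _) (mlin_comp (lin_mulr _) h)).
- exact: (mlin_comp (lin_mulr _) (mlin_comp (lin_mull _) (mlin_comp lf (@mlin_prod _ A)))).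
- exact: (mlin_comp (lin_mull _) (mlin_comp lg (@mlin_prod _ A))).
Qed.

(* Here f and g are the identity and the antipode, in either order. *)
Lemma twistK (phi : seq A -> A) (f g : A -> A) s : mlin phi -> linear f -> linear g ->
  (forall x, \sum_(p <- sw x) f p.1 * g p.2 = (counit x : k) *: (1 : A)) ->
  swsum (fun w v => swsum (fun u u' => phi u * f (\prod_(y <- u') y)) w
                      * g (\prod_(y <- v) y)) s = phi s.
Proof.
move=> h lf lg fg.
transitivity (swsum (fun w v => swsum (fun u u' =>
    phi u * f (\prod_(y <- u') y) * g (\prod_(y <- v) y)) w) s).
  by apply: eq_swsum => w v; rewrite /swsum mulr_suml.
rewrite (swsum_coassoc _ (tmlin_prod2 h lf lg)) -[RHS](swsum_counitr _ h).
apply: eq_swsum => u w.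
transitivity (phi u * \sum_(p <- sw (\prod_(y <- w) y)) f p.1 * g p.2).
  rewrite -(swsum_prod (b := fun x y => f x * g y)).
    by rewrite /swsum mulr_sumr; apply: eq_bigr => p _; rewrite mulrA.
  split=> z; first exact: (lin_comp (lin_mulr _) lf).
  exact: (lin_comp (lin_mull _) lg).
by rewrite fg -scalerAr mulr1.
Qed.

(** The inverse of the twist c |-> sum phi(c_1) c_2 of [hat_ad_bar]. *)
Definition untwist (phi : seq A -> A) : seq A -> A :=
  swsum (fun u v => phi u * antipode (\prod_(y <- v) y)).

Lemma mlin_untwist phi : mlin phi -> mlin (untwist phi).
Proof. by move=> h; apply/mlin_swsum/bmlin_prod => //; apply: antipode_lin. Qed.

Lemma hatP_ad_ext n phi s : mlin phi -> size s = n -> hatP (@ad_ext n phi) s = phi s.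
Proof. by move=> h sz; rewrite /hatP ad_extE // adjoint1. Qed.

Lemma ad_bar_ad_ext n (F : barB A n -> bimod A) : ophom F ->
  ad_bar (@ad_ext n (untwist (hat F))) =1 F.
Proof.
move=> oF; have h := mlin_hat (proj1 oF); have hu := mlin_untwist h.
have oa := ophom_ad_ext n hu.
apply: bimod_ext (ophom_ad_bar oa) oF _ => s sz; rewrite hat_ad_bar //.
rewrite (eq_swsum_size (chi' := fun u v => untwist (hat F) u * \prod_(y <- v) y)).
  rewrite (twistK _ h (@antipode_lin _ A) (@lin_id _ A)) // => x.
  exact: sw_antipodel.
by move=> u v szu _; rewrite hatP_ad_ext ?szu.
Qed.

Lemma untwist_hat_ad_bar n (f : barP A n -> adjoint_mod A) s : ophom f ->
  untwist (hat (ad_bar f)) s = hatP f s.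
Proof.
move=> of_; have h := mlin_hatP (proj1 of_).
rewrite -[RHS](twistK s h (@lin_id _ A) (@antipode_lin _ A)).
  by apply: eq_swsum => u v; rewrite hat_ad_bar.
exact: sw_antipoder.
Qed.

Lemma ad_bar_inj n (f g : barP A n -> adjoint_mod A) : ophom f -> ophom g ->
  ad_bar f =1 ad_bar g -> f =1 g.
Proof.
move=> of_ og /funext fg; apply: adP_ext => // s _.
by rewrite -!untwist_hat_ad_bar // fg.
Qed.

Lemma ad_barB n (f g : barP A n -> adjoint_mod A) x : ophom f -> ophom g ->
  ad_bar (fun y => f y - g y) x = ad_bar f x - ad_bar g x.
Proof. by move=> of_ og; apply: esB. Qed.

Lemma ad_bar0 n x : ad_bar (fun _ : barP A n => 0 : adjoint_mod A) x = 0.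
Proof.
have o0 := @ophom0 _ _ (barP A) (adjoint_mod A) adjoint_act_lin n.
by have := ad_barB x o0 o0; rewrite !subrr.
Qed.

Lemma cocycle_ad_bar n (f : barP A n -> adjoint_mod A) :
  ophom f -> cocycle f <-> cocycle (ad_bar f).
Proof.
move=> of_; have [ld ad] := @ophom_barP_dif _ A n.
have od : ophom (fun x : barP A n.+1 => f (@cdif _ _ (barP A) n x)).
  by split=> [|a x]; [exact: (lin_comp (proj1 of_) ld) | rewrite ad (proj2 of_)].
have o0 := @ophom0 _ _ (barP A) (adjoint_mod A) adjoint_act_lin n.+1.
split=> [[_ df]|[_ df]]; split=> //.
- exact: ophom_ad_bar.
- move=> x; rewrite -ad_bar_dif // -[RHS](ad_bar0 x); congr ad_bar.
  exact/funext.
- move=> x; apply: (ad_bar_inj od o0) => y.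
  by rewrite ad_bar_dif // df ad_bar0.
Qed.

(** [ad_bar] is bijective and commutes with the differentials, so primitives correspond as well. *)
Lemma coboundary_ad_bar n (f : barP A n -> adjoint_mod A) : ophom f ->
  coboundary f <-> coboundary (ad_bar f).
Proof.
have o0 p := @ophom0 _ _ (barP A) (adjoint_mod A) adjoint_act_lin p.
case: n f => [|n] f of_; split.
- move=> f0 x; rewrite -[RHS](ad_bar0 x); congr ad_bar; exact/funext.
- move=> f0; apply: (ad_bar_inj of_ (o0 0)) => x; rewrite ad_bar0; exact: f0.
- move=> [h oh fh]; exists (ad_bar h); first exact: ophom_ad_bar.
  by move=> x; rewrite -ad_bar_dif //; congr ad_bar; apply/funext.
- move=> [H oH fH]; have hH := mlin_untwist (mlin_hat (proj1 oH)).
  have oh := ophom_ad_ext n hH; exists (@ad_ext n (untwist (hat H))) => //.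
  have [ld ad] := @ophom_barP_dif _ A n.
  have od : ophom (fun x : barP A n.+1 => @ad_ext n (untwist (hat H)) (@cdif _ _ (barP A) n x)).
    by split=> [|a x]; [exact: (lin_comp (proj1 oh) ld) | rewrite ad (proj2 oh)].
  apply: (ad_bar_inj of_ od) => x.
  by rewrite ad_bar_dif // ad_bar_ad_ext // fH.
Qed.

(** Composed with a cocycle f, the part of the homotopy formula that ends in a differential of A^e
    (x)_A P vanishes and the other part is a coboundary, absent in degree 0. *)
Lemma comparison_cohom n (theta : forall n, barB A n -> indP A n)
    (f : barP A n -> adjoint_mod A) : comparison theta -> cocycle f ->
  coboundary (fun x => eckmann_shapiro f (theta n x) - ad_bar f x).
Proof.
move=> c cf; have of_ := proj1 cf; have [l a] := ophom_es of_.
case: n f cf of_ l a => [|n] f cf of_ l a.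
  have [h _ hE] := homotopy0 c (@comparison_theta0 _ A) => x.
  by rewrite /ad_bar -(linB l) -hE es_cocycle.
have [g og [h oh hE]] := homotopyS c (@comparison_theta0 _ A) n.
exists (fun x => eckmann_shapiro f (g x)).
  by split=> [|ab x]; [exact: (lin_comp l (proj1 og)) | rewrite (proj2 og) a].
move=> x; rewrite /ad_bar -(linB l).
have -> : theta n.+1 x - theta0 x = @cdif _ _ (indP A) n.+1 (h x) + g (@cdif _ _ (barB A) n x).
  by rewrite hE subrK.
by rewrite (linD l) es_cocycle // add0r.
Qed.

(** All comparison maps and all representatives give the same class, so the union is that class. *)
Lemma ad_to_HHE n (h : barP A n -> adjoint_mod A) : cocycle h ->
  ad_to_HH (coclass h) = coclass (ad_bar h).
Proof.
move=> ch; have oh := proj1 ch.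
have E (theta : forall n, barB A n -> indP A n) h' : comparison theta -> coclass h h' ->
    coclass (eckmann_shapiro h' \o theta n) = coclass (ad_bar h).
  move=> c [ch' dh]; have oh' := proj1 ch'.
  apply: (coclass_eq (@bimod_act_lin _ A)).
  apply: (coboundary_trans (@bimod_act_lin _ A) (comparison_cohom c ch')).
  have := (coboundary_ad_bar (ophomB adjoint_act_lin oh' oh)).1 dh.
  by apply: eq_coboundary => x; rewrite ad_barB.
apply/seteqP; split=> F.
  by move=> [theta c [h' hh']]; rewrite E.
move=> hF; exists (@theta0 _ A); first exact: comparison_theta0.
exists h; first exact: (mem_coclass adjoint_act_lin ch).
by rewrite E //; [exact: comparison_theta0 | exact: (mem_coclass adjoint_act_lin ch)].
Qed.

(** [ad_bracket] is specified by its image in HH(A); as [ad_bar] reflects coboundaries, the cocycles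
    with that image form a single class. *)
Lemma ad_bracketE m n (f : barP A m -> adjoint_mod A) (g : barP A n -> adjoint_mod A)
    (h : barP A (m + n).-1 -> adjoint_mod A) :
  cocycle f -> cocycle g -> ophom h -> ad_bar h =1 HH_cochain_bracket (ad_bar f) (ad_bar g) ->
  cocycle h /\ ad_bracket (coclass f) (coclass g) = coclass h.
Proof.
move=> cf cg oh /funext hE.
have cF := (cocycle_ad_bar (proj1 cf)).1 cf.
have cG := (cocycle_ad_bar (proj1 cg)).1 cg.
have cH := cocycle_HHbr cF cG; rewrite -hE in cH.
have ch := (cocycle_ad_bar oh).2 cH; split=> //.
rewrite /ad_bracket !ad_to_HHE // HH_bracketE // -hE.
apply/seteqP; split=> l [cl].
  rewrite ad_to_HHE // => el; split=> //.
  have ol := proj1 cl.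
  apply: (coboundary_ad_bar (ophomB adjoint_act_lin ol oh)).2.
  have := coclass_inj (@bimod_act_lin _ A) ((cocycle_ad_bar ol).1 cl) el.
  by apply: eq_coboundary => x; rewrite ad_barB.
move=> dl; split=> //; rewrite ad_to_HHE //.
apply: (coclass_eq (@bimod_act_lin _ A)); have ol := proj1 cl.
have := (coboundary_ad_bar (ophomB adjoint_act_lin ol oh)).1 dl.
by apply: eq_coboundary => x; rewrite ad_barB.
Qed.

End AdjointCochains.

(** * The formula for the bracket *)

Section Bullet.
Variables (k : fieldType) (A : hopfAlgType k).
Implicit Types (U : lmodType k) (s u v w : seq A) (m n i : nat) (a b c : A).

Definition column (p : nat) (r : seq (seq A)) : seq A := [seq x`_p | x <- r].

Lemma part_column r p j : part r p j = (column p r)`_j.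
Proof. by rewrite /part; elim: r j => [|x r IH] [|j] //=; rewrite nth_nil. Qed.

(** A transposition: [sweedler] keeps the three components of each entry together, whereas the
    nested [swsum] collects all first, all second and all third components. *)
Lemma sweedlerE U (phi : seq (seq A) -> U) (t : seq A -> seq A -> seq A -> U) s :
  tmlin t ->
  (forall r, size r = size s -> phi r = t (column 0 r) (column 1 r) (column 2 r)) ->
  sweedler s phi = swsum (fun w v => swsum (fun u u' => t u u' v) w) s.
Proof.
elim: s phi t => [|c s IH] phi t ht e; first by rewrite !swsum_nil /= e.
pose T x y z := swsum (fun w v => swsum (fun u u' => t (x :: u) (y :: u') (z :: v)) w) s.
have [h1 h2 h3] := ht.
have hT : trilin T.
  split=> a b; apply: lin_swsum => w v.
  - by apply: lin_swsum => u u'; exact: (mlin_hd u (h1 _ _)).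
  - by apply: lin_swsum => u u'; exact: (mlin_hd u' (h2 _ _)).
  - by apply: lin_swsum => u u'; exact: (mlin_hd v (h3 _ _)).
transitivity (tlift (fun r : 3.-tuple A => T r`_0 r`_1 r`_2) (comul2 c)).
  apply: eq_tlift => r; apply: IH => [|r' sz]; first exact: tmlin_cons.
  by rewrite e //= sz.
rewrite tlift_comul2 // swsum_cons; apply: eq_bigr => p _.
rewrite -swsum_sum; apply: eq_swsum => w v.
by rewrite swsum_cons.
Qed.

Lemma prod_part s p l : (p + l <= size s)%N ->
  \prod_(p <= j < p + l) s`_j = \prod_(x <- take l (drop p s)) x.
Proof.
move=> le; have szt : size (take l (drop p s)) = l.
  by rewrite size_take size_drop; case: ltnP; lia.
rewrite [in RHS](big_nth 0) szt -{1}[p]add0n big_addn addKn.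
by apply: eq_big_nat => j /andP[_ jl]; rewrite nth_take // nth_drop addnC.
Qed.

Lemma lin_eta : linear (@eta k A : k^o -> A).
Proof. by move=> c x y; rewrite /eta scalerDl scalerA. Qed.

Lemma swsum_mulr (chi : seq A -> seq A -> A) s c :
  swsum chi s * c = swsum (fun u v => chi u v * c) s.
Proof. exact: mulr_suml. Qed.

(** The bar cochain that corresponds to [eta_push f]; the value of [eta_hat g] on a block is the
    element c^* of the theorem. *)
Definition eta_hat n (f : barP A n -> trivial_mod A) : seq A -> A :=
  swsum (fun u v => @eta k A (hatP f u) * \prod_(y <- v) y).

Lemma arity_eta_hat n (f : barP A n -> trivial_mod A) : linear f -> arity n (eta_hat f).
Proof.
move=> lf s sz; rewrite /eta_hat (eq_swsum_size (chi' := fun _ _ => 0)).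
  by rewrite /swsum big1.
move=> u u' szu _; rewrite /hatP tn_size /= ?eqSS ?szu // (lin0 lf).
by rewrite (lin0 lin_eta) mul0r.
Qed.

Lemma mlin_eta_hat n (f : barP A n -> trivial_mod A) : linear f -> mlin (eta_hat f).
Proof.
move=> lf; apply: mlin_swsum.
exact: bmlin_prod (mlin_comp lin_eta (mlin_hatP lf)) (@lin_id _ A).
Qed.

(** * The summands of the bullet product as an insertion of bar cochains *)

Section Formula.
Variables (m n : nat) (f : barP A m -> trivial_mod A) (g : barP A n -> trivial_mod A).
Hypotheses (f_lin : linear f) (g_lin : linear g).

Definition cstar_seq u v : A := @eta k A (hatP g u) * \prod_(x <- v) x.

(** Here x, z are the first and x', z' the second components of the entries before and after the
    inserted block, v holds all third components, and d1, d2 come from the coproduct of c^*. *)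
Definition summand x z x' z' v (d1 d2 : A) : A :=
  @eta k A (hatP f (x ++ d1 :: z)) * \prod_(t <- x') t
    * d2 * \prod_(t <- z') t * antipode (\prod_(t <- v) t).

Definition term x y z x' y' z' v : A :=
  \sum_(d <- sw (cstar_seq y y')) summand x z x' z' v d.1 d.2.

Definition terms u u' v : A :=
  \sum_(i < m) (-1) ^+ (n.+1 * i) *:
    term (take i u) (take n (drop i u)) (drop n (drop i u))
         (take i u') (take n (drop i u')) (drop n (drop i u')) v.

Let etaf_mlin : mlin (fun s => @eta k A (hatP f s)).
Proof. exact: (mlin_comp lin_eta (mlin_hatP f_lin)). Qed.

Lemma bilin_summand x z x' z' v : bilin (summand x z x' z' v).
Proof.
split=> t.
- do 4!apply: (lin_comp (lin_mulr _)).
  exact: (mlin_lin x z etaf_mlin).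
- do 2!apply: (lin_comp (lin_mulr _)); exact: lin_mull.
Qed.

Lemma tmlin_terms : tmlin terms.
Proof.
have P := @mlin_prod k A.
have r4 (phi : seq A -> A) a b c d : mlin phi ->
    mlin (fun s => phi s * a * b * c * d).
  move=> h; do 4!apply: (mlin_comp (lin_mulr _)); exact: h.
split=> [u' v|u v|u u']; apply: mlin_bigsum => i; apply: mlinZ.
- apply: (mlin_cut3 (chi := fun x y z => term x y z (take i u') (take n (drop i u'))
    (drop n (drop i u')) v)) => x y.
  + by apply: mlin_bigsum => d; apply: r4; exact: (mlin_catr (d.1 :: y) etaf_mlin).
  + apply: (mlin_comp (lin_sw (bilin_summand _ _ _ _ _))).
    exact: (mlin_comp (lin_mulr _) (mlin_comp lin_eta (mlin_hatP g_lin))).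
  + apply: mlin_bigsum => d; apply: r4.
    exact: (mlin_cons d.1 (mlin_catl x etaf_mlin)).
- apply: (mlin_cut3 (chi := fun x y z => term (take i u) (take n (drop i u))
    (drop n (drop i u)) x y z v)) => x y.
  + apply: mlin_bigsum => d; do 3!apply: (mlin_comp (lin_mulr _)).
    exact: (mlin_comp (lin_mull _) P).
  + apply: (mlin_comp (lin_sw (bilin_summand _ _ _ _ _))).
    exact: (mlin_comp (lin_mull _) P).
  + apply: mlin_bigsum => d; apply: (mlin_comp (lin_mulr _)).
    exact: (mlin_comp (lin_mull _) P).
- apply: mlin_bigsum => d.
  exact: (mlin_comp (lin_mull _) (mlin_comp (@antipode_lin _ A) P)).
Qed.

(** The outer splitting is that of [untwist]. In the inner one the block contributes [eta_hat g] of
    itself, that is c^*, and the coproduct of c^* is its share of the splitting in [eta_hat f]. *)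
Lemma swsum_terms N s : N = (m + n).-1 -> size s = N ->
  swsum (fun w v => swsum (fun u u' => terms u u' v) w) s
  = untwist (ins n (sgn k n) (eta_hat g) (eta_hat f)) s.
Proof.
move=> NE sz; apply: eq_swsum_size => w v szw _.
have szwN : size w = (m + n).-1 by rewrite szw sz.
rewrite (ins_trunc _ szwN (mlin_eta_hat f_lin) (arity_eta_hat f_lin) (arity_eta_hat g_lin)).
rewrite mulr_suml.
rewrite swsum_sum; apply: eq_bigr => i _.
rewrite /sgn -exprM -scalerAl /swsum -scaler_sumr -!/(swsum _ _); congr (_ *: _).
rewrite -/(swsum (fun u u' => term (take i u) (take n (drop i u)) (drop n (drop i u))
         (take i u') (take n (drop i u')) (drop n (drop i u')) v) w).
set w1 := take i w; set w2 := take n (drop i w); set w3 := drop n (drop i w).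
have wE : w = w1 ++ (w2 ++ w3) by rewrite !cat_take_drop.
have sz1 : size w1 = i by rewrite size_takel // szwN; have := ltn_ord i; lia.
have sz2 : size w2 = n.
  by rewrite /w2 size_take size_drop szwN; have im := ltn_ord i; case: ltnP; lia.
have cutE (x y z : seq A) : size x = i -> size y = n -> [/\ take i (x ++ y ++ z) = x,
    take n (drop i (x ++ y ++ z)) = y & drop n (drop i (x ++ y ++ z)) = z].
  by move=> <- <-; rewrite take_size_cat // drop_size_cat // take_size_cat // drop_size_cat.
(* L is linear in the inserted element c, so the sum over the components of the block can be taken
   inside and becomes [eta_hat g w2]. *)
pose L x x' c := swsum (fun z z' => \sum_(d <- sw c) summand x z x' z' v d.1 d.2) w3.
have linL x x' : linear (L x x').
  by apply: lin_swsum => z z'; apply/lin_sw/bilin_summand.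
transitivity (swsum (fun x x' => L x x' (eta_hat g w2)) w1).
  rewrite {1}wE swsum_cat; apply: eq_swsum_size => x x' szx szx'.
  rewrite swsum_cat /eta_hat (swsum_lin _ _ (linL x x')).
  apply: eq_swsum_size => y y' szy szy'; apply: eq_swsum_size => z z' _ _.
  have [||-> -> ->] := cutE x y z; rewrite ?szx ?szy //.
  by have [||-> -> ->] := cutE x' y' z'; rewrite ?szx' ?szy'.
rewrite [eta_hat f _]/eta_hat swsum_cat swsum_mulr; apply: eq_swsum => x x'.
rewrite swsum_cons /L swsum_sum mulr_suml; apply: eq_bigr => d _.
rewrite swsum_mulr; apply: eq_swsum => z z'.
by rewrite /summand big_cat big_cons /= !mulrA.
Qed.

Lemma prod_part_column r (N i l : nat) p : size r = N -> (i + l <= N)%N ->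
  \prod_(i <= j < i + l) part r p j = \prod_(x <- take l (drop i (column p r))) x.
Proof.
move=> sz le; rewrite -prod_part ?size_map ?sz //.
by apply: eq_bigr => j _; rewrite part_column.
Qed.

Lemma tens_cons_mktuple p (E : 'I_p -> A) s : size s = p ->
  (forall j : 'I_p, E j = s`_j) ->
  tens [tuple of 1 :: [tuple E j | j < p]] = tn p.+1 (1 :: s).
Proof.
move=> sz e; apply: tens_tn; congr cons.
rewrite -[RHS](map_nth_ord (n := p)) //=.
by apply: eq_map => j; rewrite e.
Qed.

Lemma bulletE N : N = (m + n).-1 ->
  bullet f g = @barP_lift k A N (k^o) (fun a s =>
    counit a * counit (untwist (ins n (sgn k n) (eta_hat g) (eta_hat f)) s)).
Proof.
move=> NE; apply/funext => x; apply: eq_tlift; case/tupleP => a t.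
rewrite /= take0 drop0 big_seq1; congr (_ * counit _).
rewrite -(swsum_terms NE) ?size_tuple //; apply: sweedlerE; first exact: tmlin_terms.
move=> r; rewrite size_tuple => szr; apply: eq_bigr => i _; congr (_ *: _).
have im := ltn_ord i.
have szu p : size (column p r) = N by rewrite size_map.
have cE : cstar g i r = cstar_seq (take n (drop i (column 0 r))) (take n (drop i (column 1 r))).
  rewrite /cstar /cstar_seq (prod_part_column 1 szr); last by lia.
  congr (eta _ _ * _); congr g; apply: tens_cons_mktuple.
    by rewrite size_take size_drop szu; case: ltnP; lia.
  by move=> j; rewrite nth_take // nth_drop part_column.
rewrite cE (tlift_pairsE (b := summand (take i (column 0 r)) (drop n (drop i (column 0 r)))
  (take i (column 1 r)) (drop n (drop i (column 1 r))) (column 2 r))) //.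
  exact: bilin_summand.
move=> d; rewrite /summand.
have -> : \prod_(0 <= j < i) part r 1 j = \prod_(t <- take i (column 1 r)) t.
  by rewrite -[X in index_iota _ X]add0n (prod_part_column 1 szr) ?drop0 //; lia.
have -> : \prod_(0 <= j < N) part r 2 j = \prod_(t <- column 2 r) t.
  by rewrite -[X in index_iota _ X]add0n (prod_part_column 2 szr) // drop0 take_oversize ?szu.
have -> : \prod_(i + n <= j < N) part r 1 j = \prod_(t <- drop n (drop i (column 1 r))) t.
  (* The range up to N is written as start plus length, the form that [prod_part_column] accepts. *)
  have NiE : N = (i + n + (N - (i + n)))%N by lia.
  rewrite [X in index_iota _ X]NiE (prod_part_column 1 szr); last by lia.
  by rewrite drop_drop addnC take_oversize // size_drop szu.
congr (eta _ _ * _ * _ * _ * _); congr f; apply: tens_cons_mktuple.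
  by rewrite size_cat /= size_takel ?size_drop ?szu; lia.
move=> j; have jm := ltn_ord j.
rewrite nth_cat size_takel ?szu; last by lia.
rewrite -val_eqE /=; case: ltngtP => ji; first by rewrite nth_take // part_column.
  rewrite -[(j - i)%N]prednK ?subn_gt0 //= !nth_drop part_column; congr nth; lia.
by rewrite ji subnn.
Qed.

End Formula.

Lemma trivial_act_lin a : linear (opact (o := trivial_mod A) a).
Proof. by have [_ h _ _] := @is_action_trivial _ A; apply: h. Qed.

Lemma ophom_eta_push n (f : barP A n -> trivial_mod A) : ophom f -> ophom (eta_push f).
Proof.
move=> [lf af]; split=> [|a x]; first exact: (lin_comp lin_eta lf).
rewrite /eta_push af adjointE /= /eta.
under eq_bigr => p _ do rewrite -scalerAr mulr1 -scalerAl.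
by rewrite -scaler_sumr sw_antipoder scalerA mulrC.
Qed.

Lemma ophom_eps_push n (f : barP A n -> adjoint_mod A) : ophom f -> ophom (eps_push f).
Proof.
move=> [lf af]; split=> [|a x]; first exact: (lin_comp (@counit_lin _ A) lf).
by rewrite /eps_push af counit_adjoint.
Qed.

Lemma coh_map_coclass (M N : opmod k A) n
    (u : (barP A n -> M) -> (barP A n -> N)) (f : barP A n -> M) :
  (forall a, linear (opact (o := M) a)) -> (forall a, linear (opact (o := N) a)) ->
  cocycle f ->
  (forall h, cocycle h -> coboundary (fun x => h x - f x) ->
     coboundary (fun x => u h x - u f x)) ->
  coh_map u (coclass f) = coclass (u f).
Proof.
move=> lM lN cf hu; apply/seteqP; split=> [h [g [cg dg]]|h hh].
  by rewrite (coclass_eq lN (hu _ cg dg)).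
by exists f; [exact: (mem_coclass lM) | exact: hh].
Qed.

Lemma eta_push_coclass n (f : barP A n -> trivial_mod A) : cocycle f ->
  coh_map (@eta_push k A n) (coclass f) = coclass (eta_push f).
Proof.
move=> cf; apply: coh_map_coclass => //; [exact: trivial_act_lin | exact: adjoint_act_lin|].
move=> h _; case: n f h cf => [|n] f h cf /= dh.
  by move=> x; rewrite -(linB lin_eta) dh (lin0 lin_eta).
case: dh => l ol lE; exists (eta_push l); first exact: ophom_eta_push.
by move=> x; rewrite /eta_push -(linB lin_eta) lE.
Qed.

Lemma eps_push_coclass n (f : barP A n -> adjoint_mod A) : cocycle f ->
  coh_map (@eps_push k A n) (coclass f) = coclass (eps_push f).
Proof.
move=> cf; apply: coh_map_coclass => //; [exact: adjoint_act_lin | exact: trivial_act_lin|].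
move=> h _; case: n f h cf => [|n] f h cf /= dh.
  by move=> x; rewrite -(linB (@counit_lin _ A)) dh (lin0 (@counit_lin _ A)).
case: dh => l ol lE; exists (eps_push l); first exact: ophom_eps_push.
by move=> x; rewrite /eps_push -(linB (@counit_lin _ A)) lE.
Qed.

Lemma cocycle_eta_push n (f : barP A n -> trivial_mod A) :
  cocycle f -> cocycle (eta_push f).
Proof.
move=> [of_ df]; split=> [|x]; first exact: ophom_eta_push.
by rewrite /eta_push df (lin0 lin_eta).
Qed.

Lemma cocycle_eps_push n (f : barP A n -> adjoint_mod A) :
  cocycle f -> cocycle (eps_push f).
Proof.
move=> [of_ df]; split=> [|x]; first exact: ophom_eps_push.
by rewrite /eps_push df (lin0 (@counit_lin _ A)).
Qed.

(** Untwisting is linear, so the two compositions in the bracket can be treated separately by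
    [bulletE], and the counit of an adjoint action is a product of counits. *)
Lemma eps_push_bracket m n (f : barP A m -> trivial_mod A) (g : barP A n -> trivial_mod A) :
  ophom f -> ophom g ->
  eps_push (@ad_ext k A (m + n).-1
    (untwist (hat (HH_cochain_bracket (ad_bar (eta_push f)) (ad_bar (eta_push g))))))
  = bullet_bracket f g.
Proof.
move=> of_ og; have [oF oG] := (ophom_eta_push of_, ophom_eta_push og).
have [oF' oG'] := (ophom_ad_bar oF, ophom_ad_bar oG).
have hE p (h : barP A p -> trivial_mod A) : ophom h -> hat (ad_bar (eta_push h)) = eta_hat h.
  by move=> oh; apply/funext => s; rewrite hat_ad_bar //; apply: ophom_eta_push.
have [mF mG] := (mlin_eta_hat (proj1 of_), mlin_eta_hat (proj1 og)).
have HE : hat (HH_cochain_bracket (ad_bar (eta_push f)) (ad_bar (eta_push g)))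
    = gbr n m (eta_hat g) (eta_hat f).
  by apply/funext => s; rewrite hat_HHbr ?hE //; [exact: (proj1 oF') | exact: (proj1 oG')].
have mH := mlin_untwist (mlin_gbr n m mG mF).
have good phi : mlin phi ->
    bilinP (fun a s => counit a * counit (untwist phi s) : k^o).
  move=> h; split=> [s|a].
    by move=> c x y; rewrite linearP mulrDl -[_ *: _]/(_ * _) -mulrA.
  have lc : linear (fun x : A => counit a * counit x : k^o).
    by move=> c x y; rewrite linearP mulrDr; congr (_ + _); apply: mulrCA.
  exact: (mlin_comp lc (mlin_untwist h)).
have g1 := good _ (mlin_ins n (sgn k n) mG mF).
have g2 := good _ (mlin_ins m (sgn k m) mF mG).
have b1 := bulletE (proj1 of_) (proj1 og) (erefl (m + n).-1).
have b2 := bulletE (proj1 og) (proj1 of_) (congr1 predn (addnC m n)).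
have lb : linear (bullet_bracket f g).
  move=> c x y; rewrite /bullet_bracket b1 b2 (lin_barP_lift g1) (lin_barP_lift g2).
  by rewrite scalerBr [_ *: (_ + _)]scalerDr opprD addrACA !scalerA [c * _]mulrC.
rewrite HE; apply/funext; apply: barP_ext (proj1 (ophom_eps_push (ophom_ad_ext _ mH))) lb _ => a s sz.
rewrite /eps_push ad_extE // counit_adjoint /bullet_bracket b1 b2 !barP_liftE //.
have -> : untwist (gbr n m (eta_hat g) (eta_hat f)) s
    = untwist (ins n (sgn k n) (eta_hat g) (eta_hat f)) s
      - (-1) ^+ (m.+1 * n.+1) *: untwist (ins m (sgn k m) (eta_hat f) (eta_hat g)) s.
  rewrite /untwist /swsum scaler_sumr -sumrB; apply: eq_bigr => p _.
  by rewrite /gbr /sgn_xchg mulnC mulrBl -scalerAl.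
rewrite (linB (@counit_lin _ A)) (linZ (@counit_lin _ A)) mulrBr.
by congr (_ - _); apply: mulrCA.
Qed.

End Bullet.

Theorem mainTheorem2 (k : fieldType) (A : hopfAlgType k)
    (S_bij : bijective (antipode : A -> A)) (m n : nat) (mn_gt0 : (0 < m + n)%N)
    (f : barP A m -> trivial_mod A) (g : barP A n -> trivial_mod A)
    (f_cocycle : cocycle f) (g_cocycle : cocycle g) :
  cocycle (bullet_bracket f g) /\
  hopf_bracket (coclass f) (coclass g) = coclass (bullet_bracket f g).
Proof.
have [cF cG] := (cocycle_eta_push f_cocycle, cocycle_eta_push g_cocycle).
have [oF oG] := (ophom_ad_bar (proj1 cF), ophom_ad_bar (proj1 cG)).
have oH : ophom (HH_cochain_bracket (ad_bar (eta_push f)) (ad_bar (eta_push g))).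
  by case: (cocycle_HHbr ((cocycle_ad_bar (proj1 cF)).1 cF) ((cocycle_ad_bar (proj1 cG)).1 cG)).
(* The untwisted Hochschild bracket represents the bracket of the classes of eta f and eta g in H(A,
   A^ad). *)
have oh := ophom_ad_ext (m + n).-1 (mlin_untwist (mlin_hat (proj1 oH))).
have [ch hE] := ad_bracketE cF cG oh (ad_bar_ad_ext oH).
rewrite -(eps_push_bracket (proj1 f_cocycle) (proj1 g_cocycle)); split.
  exact: cocycle_eps_push.
by rewrite /hopf_bracket !eta_push_coclass // hE eps_push_coclass.
Qed.
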